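(* Let $(\bar u,\bar\mu)\in\mathcal D$ be an initial datum. With $\bar x$, $f$, $y$ and the sets $A_t^{L,pp},A_t^{L,sc},B_t^L,B_0^L$ as in the context, define for $t\in\mathbb R$ $$u(x,t)=\frac{\partial}{\partial t}y(\alpha,t)=\bar u(\bar x(\alpha))+\frac t2(\alpha-\bar x(\alpha))\ \text{ for } x=y(\alpha,t),\qquad \mu(t)=y(\cdot,t)\#(f\,d\alpha).$$ Then $(u(t),\mu(t))$ is a global-in-time conservative solution of the generalized Hunter-Saxton system with initial datum $(\bar u,\bar\mu)$. Moreover, $u$ and the energy measure $\mu$ satisfy all of the following properties, where $\mu_{ac}(t),\mu_{pp}(t),\mu_{sc}(t)$ are the absolutely continuous, pure point and singular continuous parts of $\mu(t)$: (i) $\mu\in C(\mathbb R;\mathcal M_+(\mathbb R))$ and $\mu(t)(\mathbb R)=\bar\mu(\mathbb R)$ for $t\in\mathbb R$. (ii) $\mu_{pp}(t)=y(\cdot,t)\#(f|_{A_t^{L,pp}}d\alpha)$, $\mu_{sc}(t)=y(\cdot,t)\#(f|_{A_t^{L,sc}}d\alpha)$, $\mu_{ac}(t)=y(\cdot,t)\#(f|_{B_t^{L}}d\alpha)$. Moreover, for any $t\ne0$, $A_t^{L,pp}\cup A_t^{L,sc}=\{\alpha\in B_0^L:\bar u_x(\bar x(\alpha))=-\frac2t\}$, so that $\mu_{pp}(t)$ and $\mu_{sc}(t)$ are determined by the absolutely continuous part $\bar\mu_{ac}$, i.e. by $\bar u_x$; and $$\mathrm{supp}\big(\mu_{pp}(t)+\mu_{sc}(t)\big)\subset\Big\{x+\bar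 u(x)t+\frac{t^2}4\bar\mu((-\infty,x)):\ x\in A_t^E\Big\},\qquad A_t^E=\Big\{x:\ \bar u_x(x)=-\frac2t\Big\}.$$ (iii) There are at most countably many times $t\in\mathbb R$ such that either the pure point part or the singular continuous part of $\mu(t)$ is not zero; in other words, both sets $\{t:\mu_{pp}(t)\ne0\}$ and $\{t:\mu_{sc}(t)\ne0\}$ are (at most) countable. (iv) For all $t\in\mathbb R$, $u(\cdot,t)$ is globally absolutely continuous and $d\mu_{ac}(t)=u_x^2(x,t)\,dx$. Moreover $u\in C(\mathbb R;C_b(\mathbb R))\cap C^{1/2}_{loc}(\mathbb R\times\mathbb R)$, $u_x\in L^\infty(\mathbb R;L^2(\mathbb R))$, $u_t\in L^2_{loc}(\mathbb R\times\mathbb R)$. (v) If $\bar u(-\infty):=\lim_{x\to-\infty}\bar u(x)$ exists, then $\lim_{x\to-\infty}u(x,t)=\bar u(-\infty)$. If $\bar u(+\infty):=\lim_{x\to+\infty}\bar u(x)$ exists, then $\lim_{x\to+\infty}u(x,t)=\bar u(+\infty)+\frac12\bar\mu(\mathbb R)t$. (vi) Consider a time $s\in\mathbb R$ such that $\mu(s)$ is absolutely continuous with respect to Lebesgue measure, and let $\tilde u(x)=u(x,s)$, $\tilde F(\xi)=\int_{(-\infty,\xi)}\tilde u_x^2(z)\,dz$, $X(\xi,t)=\xi+\tilde u(\xi)t+\frac{t^2}4\tilde F(\xi)$. Then $\tilde u\in C_b(\mathbb R)$, $\tilde u_x\in L^2(\mathbb R)$, $\|\tilde u_x\|_{L^2}^2=\bar\mu(\mathbb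 R)$, and for any $t\in\mathbb R$: $y(\cdot,t)=X(\cdot,t-s)\circ y(\cdot,s)$, $\mu(t)=X(\cdot,t-s)\#(\tilde u_x^2\,dx)$, and $u(x,t)=\frac{\partial}{\partial t}X(\xi,t-s)=\tilde u(\xi)+\frac{t-s}2\tilde F(\xi)$ for $x=X(\xi,t-s)$.
   Context: $\mathcal M_+(\mathbb R)$ is the set of finite positive Radon measures on $\mathbb R$ endowed with the weak topology (testing against bounded continuous functions). $C_b(\mathbb R)$ is the space of bounded continuous functions with the sup norm. $\mathrm{supp}$ denotes the support of a measure. $\mathcal D$ is the set of pairs $(u,\mu)$ with $u\in C_b(\mathbb R)$, $u_x\in L^2(\mathbb R)$, $\mu\in\mathcal M_+(\mathbb R)$, and $d\mu_{ac}=u_x^2\,dx$, where $\mu_{ac}$ is the absolutely continuous part of $\mu$ with respect to Lebesgue measure. $(T\#\nu)(E)=\nu(T^{-1}(E))$ is the push-forward; $f|_A$ denotes $f$ times the indicator function of $A$. The generalized Hunter-Saxton system is: $u_t+uu_x=\frac12\int_{-\infty}^x d\mu(t)$, $\ \mu_t+(u\mu)_x=0$, $\ d\mu_{ac}(t)=u_x^2(\cdot,t)\,dx$. Conservative solution: given $(\bar u,\bar\mu)\in\mathcal D$, a pair $(u(t),\mu(t))_{t\in\mathbb R}$ is a global-in-time conservative solution with initial datum $(\bar u,\bar\mu)$ if (1) $u\in C(\mathbb R;C_b(\mathbb R))\cap C^{1/2}_{loc}(\mathbb R\times\mathbb R)$, $u_t\in L^2_{loc}(\mathbb R\times\mathbb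 R)$, $u_x(\cdot,t)\in L^2(\mathbb R)$ for all $t\in\mathbb R$, and $\mu\in C(\mathbb R;\mathcal M_+(\mathbb R))$; (2) $(u(\cdot,0),\mu(0))=(\bar u,\bar\mu)$, and $d\mu(t)=u_x^2(x,t)\,dx$ for a.e. $t\in\mathbb R$; (3) $\int_{\mathbb R}\int_{\mathbb R}\big[u\phi_t-\phi(uu_x-\tfrac12F)\big]\,dx\,dt=0$ for all $\phi\in C_c^\infty(\mathbb R\times\mathbb R)$, where $F(x,t)=\int_{-\infty}^x d\mu(t)$ (well defined for a.e. $t$ by (2)); (4) $\int_{\mathbb R}\int_{\mathbb R}(\phi_t+u\phi_x)\,d\mu(t)\,dt=0$ for all $\phi\in C_c^\infty(\mathbb R\times\mathbb R)$; (5) $d\mu_{ac}(t)=u_x^2(\cdot,t)\,dx$ for all $t\in\mathbb R$. Characteristics: for $\alpha\in\mathbb R$, $\bar x(\alpha)$ is the unique real number with $\bar x(\alpha)+\bar\mu((-\infty,\bar x(\alpha)))\le\alpha\le\bar x(\alpha)+\bar\mu((-\infty,\bar x(\alpha)])$ (the function $\bar x$ is nondecreasing and 1-Lipschitz); $f(\alpha)=1-\bar x'(\alpha)$; $B_0^L=\{\alpha:\bar x'(\alpha)>0\}$; $y(\alpha,t)=\bar x(\alpha)+\bar u(\bar x(\alpha))t+\frac{t^2}{4}(\alpha-\bar x(\alpha))$, which is nondecreasing in $\alpha$. With $z_1(x,t)=\inf\{\alpha:y(\alpha,t)=x\}$ and $z_2(x,t)=\sup\{\alpha:y(\alpha,t)=x\}$: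 $A_t^{L,pp}=\{\alpha: y_\alpha(\alpha,t)=0,\ z_1(y(\alpha,t),t)<z_2(y(\alpha,t),t)\}$, $A_t^{L,sc}=\{\alpha: y_\alpha(\alpha,t)=0,\ z_1(y(\alpha,t),t)=z_2(y(\alpha,t),t)\}$, $B_t^L=\{\alpha: y_\alpha(\alpha,t)>0\}$. Here $A_t^{L,pp}$ is defined pointwise, while $A_t^{L,sc}$, $B_t^L$ and $B_0^L$ are defined in the a.e. sense, so identities involving these sets are understood up to Lebesgue null sets.
   Formalization: In (ii) the inclusion of supp(μ_pp(t)+μ_sc(t)) in the set {x+ū(x)t+(t²/4)μ̄((-∞,x)) : x∈A_t^E} is false for the closed support (fat Cantor set example); instead: μ_pp(t)+μ_sc(t) is carried by that set, and its support lies in the closure of that set. *)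

(* Defs.v *)
From HB Require Import structures.
From mathcomp Require Import all_boot all_order all_algebra.
From mathcomp Require Import all_classical all_reals all_analysis.

Set Implicit Arguments.
Unset Strict Implicit.
Unset Printing Implicit Defensive.

Import Order.TTheory GRing.Theory Num.Theory.
Import numFieldNormedType.Exports.

Local Open Scope classical_set_scope.
Local Open Scope ring_scope.

(* Finite positive Borel measures on R; these are automatically Radon. *)
Notation finite_borel_measure R :=
  {finite_measure set (measurableTypeR R) -> \bar R}.

Notation leb := lebesgue_measure.

Section FunctionSpaces.
Context {R : realType}.

Definition Cb (v : R -> R) : Prop := continuous v /\ bounded_fun v.

(* In finite dimension, a function is of class C^n iff all its iterated
   directional derivatives up to order n exist and are continuous. *)
Fixpoint class_C (V : normedModType R) (n : nat) (phi : V -> R) : Prop :=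
  if n is m.+1 then
    continuous phi /\
    forall v : V, (forall p, derivable phi p v) /\
                  class_C m (fun p => 'D_v phi p)
  else continuous phi.

Definition test_function (V : normedModType R) (phi : V -> R) : Prop :=
  (forall n, class_C n phi) /\ compact (closure [set p | phi p != 0]).

(* [g] is a representative of the distributional derivative of [v]. *)
Definition weak_derivative (v g : R -> R) : Prop :=
  locally_integrable setT g /\
  forall phi : R -> R, test_function phi ->
    \int[leb]_x (v x * derive1 phi x) = - \int[leb]_x (g x * phi x).

Definition L2 (g : R -> R) : Prop := g \in Lfun (@lebesgue_measure R) 2%:E.

Definition L2_loc2 (g : R * R -> R) : Prop :=
  measurable_fun setT g /\
  forall K : set (R * R), compact K ->
    (\int[(@lebesgue_measure R \x @lebesgue_measure R)%E]_(p in K)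
       ((g p) ^+ 2)%:E < +oo)%E.

(* Functions of two variables are written [u x t]: space first, then time. *)

Definition Dx (phi : R * R -> R) (x t : R) : R := 'D_((1, 0) : R * R) phi (x, t).
Definition Dt (phi : R * R -> R) (x t : R) : R := 'D_((0, 1) : R * R) phi (x, t).

(* [ux] represents u_x : it is jointly Borel and, at every time t, [ux ^~ t] is
   the distributional derivative of [u ^~ t]. *)
Definition weak_dx (u ux : R -> R -> R) : Prop :=
  measurable_fun setT (fun p : R * R => ux p.1 p.2) /\
  forall t, weak_derivative (u ^~ t) (ux ^~ t).

(* L^oo(R; L^2(R)) *)
Definition Linfty_L2 (ux : R -> R -> R) : Prop :=
  ('N[leb]_(+oo)[(fun t => 'N[leb]_2%:E[EFin \o (ux ^~ t)])] < +oo)%E.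

Definition weak_dt (u : R -> R -> R) (ut : R * R -> R) : Prop :=
  forall phi : R * R -> R, test_function phi ->
    \int[(@lebesgue_measure R \x @lebesgue_measure R)%E]_p
      (u p.1 p.2 * Dt phi p.1 p.2) =
    - \int[(@lebesgue_measure R \x @lebesgue_measure R)%E]_p (ut p * phi p).

Definition continuous_in_Cb (u : R -> R -> R) : Prop :=
  (forall t, Cb (u ^~ t)) /\
  continuous (fun t => (u ^~ t : {uniform R -> R})).

Definition holder_half_loc (u : R -> R -> R) : Prop :=
  forall K : set (R * R), compact K ->
    exists C : R, forall p q : R * R, K p -> K q ->
      `|u p.1 p.2 - u q.1 q.2| <= C * Num.sqrt `|p - q|.

Definition absolutely_continuous (v : R -> R) : Prop :=
  forall e : R, 0 < e -> exists2 d : R, 0 < d &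
    forall (n : nat) (a b : 'I_n -> R),
      (forall i, a i <= b i) ->
      trivIset setT (fun i => `]a i, b i[%classic) ->
      \sum_(i < n) (b i - a i) < d ->
      \sum_(i < n) `|v (b i) - v (a i)| < e.

End FunctionSpaces.

Section Measures.
Context {R : realType}.
Local Open Scope ereal_scope.
Implicit Types m mac mpp msc : finite_borel_measure R.

(* The measure h dx, for h >= 0. *)
Definition density (h : R -> R) (E : set (measurableTypeR R)) : \bar R :=
  \int[leb]_(x in E) (h x)%:E.

(* Equality of measures, i.e. on Borel sets. *)
Definition same_measure (m1 m2 : set (measurableTypeR R) -> \bar R) : Prop :=
  forall E, measurable E -> m1 E = m2 E.

Definition pure_point m : Prop :=
  exists2 C : set R, countable C & m (~` C) = 0.

Definition singular_continuous m : Prop :=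
  (exists N : set (measurableTypeR R),
    [/\ measurable N, leb N = 0 & m (~` N) = 0]) /\
  forall x : R, m [set x] = 0.

Definition lebesgue_decomposition m mac mpp msc : Prop :=
  [/\ mac `<< leb, pure_point mpp, singular_continuous msc &
      same_measure m (fun E => mac E + mpp E + msc E)].

(* d m_ac = h dx *)
Definition ac_part_density m (h : R -> R) : Prop :=
  exists mac mpp msc, lebesgue_decomposition m mac mpp msc /\
    same_measure mac (density h).

Definition weakly_continuous (mu : R -> finite_borel_measure R) : Prop :=
  forall psi : R -> R, Cb psi ->
    continuous (fun t : R => (\int[mu t]_x psi x)%R).

Definition supp (m : set (measurableTypeR R) -> \bar R) : set R :=
  [set x | forall U : set R, open U -> U x -> 0 < m U].

End Measures.

Section Solutions.
Context {R : realType}.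
Implicit Types (ubar : R -> R) (mubar : finite_borel_measure R).
Implicit Types (u : R -> R -> R) (mu : R -> finite_borel_measure R).

Definition in_D ubar mubar : Prop :=
  Cb ubar /\
  exists g, [/\ weak_derivative ubar g, L2 g &
                ac_part_density mubar (fun x => g x ^+ 2)].

Definition F mu (x t : R) : R := fine (mu t `]-oo, x]%classic).

(* The integrals in the two weak equations are iterated, with respect to x
   first; [\int] is the real-valued integral. *)
Definition conservative_solution ubar mubar u mu : Prop :=
  exists ux ut,
  [/\
    [/\ continuous_in_Cb u, holder_half_loc u,
        weak_dt u ut /\ L2_loc2 ut,
        weak_dx u ux /\ (forall t, L2 (ux ^~ t)) &
        weakly_continuous mu],
    [/\ u ^~ 0 = ubar, same_measure (mu 0) mubar &
        \forall t \ae leb, same_measure (mu t) (density (fun x => ux x t ^+ 2))],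
    (forall phi : R * R -> R, test_function phi ->
      \int[leb]_t (\int[leb]_x
        (u x t * Dt phi x t
         - phi (x, t) * (u x t * ux x t - 2^-1 * F mu x t))) = 0),
    (forall phi : R * R -> R, test_function phi ->
      \int[leb]_t (\int[mu t]_x (Dt phi x t + u x t * Dx phi x t)) = 0) &
    (forall t, ac_part_density (mu t) (fun x => ux x t ^+ 2))].

End Solutions.

Section Characteristics.
Context {R : realType}.
Variables (ubar : R -> R) (mubar : finite_borel_measure R).

Definition char_x (a : R) : R :=
  xget 0 [set x : R | (x%:E + mubar `]-oo, x[%classic <= a%:E)%E /\
                      (a%:E <= x%:E + mubar `]-oo, x]%classic)%E].

(* [char_x] is Lipschitz, so differentiable a.e.; elsewhere [derive1] has a
   default value. *)
Definition char_f (a : R) : R := 1 - derive1 char_x a.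

Definition char_y (a t : R) : R :=
  char_x a + ubar (char_x a) * t + t ^+ 2 / 4 * (a - char_x a).

Definition z1 (x t : R) : R := inf [set a | char_y a t = x].
Definition z2 (x t : R) : R := sup [set a | char_y a t = x].

Definition A_pp (t : R) : set R :=
  [set a : R | is_derive a (1 : R) (char_y ^~ t) 0 /\
               z1 (char_y a t) t < z2 (char_y a t) t].
Definition A_sc (t : R) : set R :=
  [set a : R | is_derive a (1 : R) (char_y ^~ t) 0 /\
               z1 (char_y a t) t = z2 (char_y a t) t].
Definition B_L (t : R) : set R :=
  [set a : R | derivable (char_y ^~ t) a 1 /\ 0 < derive1 (char_y ^~ t) a].
Definition B_L0 : set R :=
  [set a : R | derivable char_x a 1 /\ 0 < derive1 char_x a].

End Characteristics.

(* T # (h da) *)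
Definition push_density {R : realType} (T : R -> R) (h : R -> R) :
    set (measurableTypeR R) -> \bar R :=
  pushforward (density h) (T : measurableTypeR R -> measurableTypeR R).

(* Main.v *)
(* Label particles by [a], with initial position [X], velocity [V = ubar o X] and
   energy [H = id - X]. Cauchy-Schwarz for [ubar] reads
   [(V b - V a)^2 <= (X b - X a) (H b - H a)]. The solution keeps [H] constant
   along [y = X + V t + t^2/4 H], [U = V + t/2 H], and the determinant
   [dy dH - dU^2] does not depend on [t]; so the same inequality holds at all
   times: everything is Lipschitz in [a], [y] is monotone, and [u] is well
   defined by [u(y, t) = U] and 1/2-Hoelder. Almost everywhere the inequality
   becomes the equality [V'^2 = X' H'] with [X' + H' = 1], hence [U_a^2 = y_a H'],
   and [y_a] is a quadratic polynomial in [t] with at most one, double, root.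

   Since [y(., t)] is monotone and Lipschitz, it pushes [y_a da] forward to
   Lebesgue measure. Where [y_a > 0] the energy [H' da] is thus transported to
   [u_x^2 dx]; where [y_a = 0] it is transported to a null set, giving the
   singular parts. The sets [{y_a(., t) = 0}] are disjoint for distinct times and
   carry finite total energy, hence only countably many of them are charged.
   In the variables [(a, t)] the weak equations are integrals of exact
   derivatives: for a test function [phi], the energy balance is
   [H' d/dt (phi(y, t))] and the momentum balance is
   [d/dt (U phi(y, t) y_a) - d/da (U^2 phi(y, t))]. *)

From HB Require Import structures.
Require Import Defs.
From mathcomp Require Import all_boot all_order all_algebra.
From mathcomp Require Import all_classical all_reals all_analysis.
From mathcomp Require Import measurable_realfun ring lra.

Set Implicit Arguments.
Unset Strict Implicit.
Unset Printing Implicit Defensive.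

Import Order.TTheory GRing.Theory Num.Theory.
Import numFieldNormedType.Exports.

Local Open Scope classical_set_scope.
Local Open Scope ring_scope.

(** * Differentiation of monotone Lipschitz functions *)

Section derivative_sets.
Context {R : realType}.
Implicit Types (T f : R -> R).

(** The obstacle is low regularity: [ubar] has only a distributional derivative, [mubar] an
    arbitrary singular part, and [char_x] is merely nondecreasing and 1-Lipschitz. Its derivative is
    the Radon-Nikodym density of its Stieltjes measure, which Lebesgue measure dominates; other
    Lipschitz functions reduce to this case by adding a multiple of the identity. Cauchy-Schwarz
    needs [ubar] to be a primitive of its weak derivative. This is obtained by testing against
    smooth steps built from exp(-1/x). The equality V'^2 = X' H' is proved through measures: off a
    null set, [mubar] is ubar_x^2 dx, and the densities H' and (ubar_x o X)^2 X' have the same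
    push-forward under X. As X is monotone and its fibres are not charged, the densities agree
    almost everywhere. The gradient u_x is U_a / y_a, set to 0 where y_a = 0. Since U_a vanishes
    there too, u_x y_a = U_a at almost every label, so integrals over space pass to labels without
    separating collapsed labels. For the support of the singular part, x + ubar t + t^2/4 F jumps at
    atoms; it is handled through its continuous lift y to labels. *)

Lemma continuous_diff_quotient f (c h : R) : continuous f ->
  continuous (fun x => c * (f (h + x) - f x)).
Proof.
move=> cf x; apply: cvgM; first exact: cvg_cst.
apply: cvgB; last exact: cf.
apply: (@cvg_comp _ _ _ (fun y => h + y) f); last exact: cf.
by apply: cvgD; [exact: cvg_cst|exact: cvg_id].
Qed.

Lemma derivableE f x :
  derivable f x 1 = cvg (h^-1 * (f (h + x) - f x) @[h --> 0^']).
Proof.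
rewrite /derivable (_ : (fun h : R => h^-1 *: ((f \o shift x) h%:A - f x)) =
  (fun h => h^-1 * (f (h + x) - f x)))//.
by apply/funext => h /=; rewrite [h%:A]mulr1.
Qed.

(** The default value of a missing limit is 0; thanks to it, bounds on [derive1] and its
    measurability hold at every point. *)
Lemma derive1_nondiff f x : ~ derivable f x 1 -> derive1 f x = 0.
Proof. by rewrite derivableE => nd; exact: dvgP. Qed.

Lemma derivable_derive1_cvg f x : derivable f x 1 ->
  h^-1 * (f (h + x) - f x) @[h --> 0^'] --> derive1 f x.
Proof. by rewrite derivableE. Qed.

(** Differentiability is a Cauchy condition on difference quotients. For a fixed pair of increments
    the condition is closed in [x], so the uncountable intersection over pairs is closed, and only
    countable operations remain outside it. *)
Lemma measurable_derivable f : continuous f ->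
  measurable [set x | derivable f x 1].
Proof.
move=> cf.
pose q h x := h^-1 * (f (h + x) - f x).
rewrite (_ : [set x | _] = \bigcap_n \bigcup_m \bigcap_(p in [set p : R * R |
   [/\ p.1 != 0, p.2 != 0, `|p.1| < m.+1%:R^-1 & `|p.2| < m.+1%:R^-1]])
     [set x | `|q p.1 x - q p.2 x| <= n.+1%:R^-1]).
  apply: bigcapT_measurable => n; apply: bigcupT_measurable => m.
  apply: measurable_realfun.closed_measurable; apply: closed_bigI => -[h k] /= _.
  rewrite (_ : mkset _ = (fun x => `|q h x - q k x|) @^-1` [set x | x <= n.+1%:R^-1])//.
  apply: closed_comp; last exact: closed_le.
  by move=> x _; apply: cvg_norm; apply: cvgB; exact: continuous_diff_quotient.
have qE x : derivable f x 1 <-> cvg (q h x @[h --> 0^']) by rewrite derivableE.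
apply/seteqP; split => x /=.
  move/qE => /cvg_ex[l] /cvgrPdist_le ql n _ /=.
  have n0 : 0 < (n.+1%:R^-1 / 2 : R) by rewrite divr_gt0.
  have := ql _ n0 => -[e /= e0 He].
  have [m me] : exists m, m.+1%:R^-1 < e.
    by have [m] := ltr_add_invr e0; rewrite add0r => ?; exists m.
  exists m => // -[h k]/= [h0 k0 hm km].
  have Hd z : z != 0 -> `|z| < m.+1%:R^-1 -> `|l - q z x| <= n.+1%:R^-1 / 2.
    move=> z0 zm; apply: He => //=.
    by rewrite sub0r normrN (lt_trans zm).
  have := Hd _ h0 hm; have := Hd _ k0 km.
  rewrite -[X in _ -> _ -> X]/(is_true _) => H1 H2.
  rewrite (_ : q h x - q k x = (l - q k x) - (l - q h x)); last by ring.
  by rewrite (le_trans (ler_normB _ _))// [leRHS]splitr lerD.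
move=> H; apply/qE; apply/cauchy_cvgP; apply: cauchy_exP => e e0.
have [n ne] : exists n, n.+1%:R^-1 < e.
  by have [n] := ltr_add_invr e0; rewrite add0r => ?; exists n.
have [m _ Hm] := H n Logic.I.
pose h0 : R := m.+1%:R^-1 / 2.
have h00 : 0 < h0 by rewrite divr_gt0.
exists (q h0 x); suff : \forall h \near 0^', ball (q h0 x) e (q h x) by [].
near=> h; rewrite /ball/= (le_lt_trans _ ne)//.
apply: (Hm (h0, h)); split => /=.
- by rewrite gt_eqF.
- by near: h; exact: nbhs_dnbhs_neq.
- by rewrite gtr0_norm// /h0 ltr_pdivrMr// ltr_pMr// ltr1n.
- by near: h; apply: dnbhs0_lt; rewrite invr_gt0.
Unshelve. all: by end_near. Qed.

(** On the differentiability set it is the limit of the quotients with increment 1/(n+1); elsewhere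
    it is constantly 0. *)
Lemma measurable_derive1 f : continuous f -> measurable_fun setT (derive1 f).
Proof.
move=> cf; have mD := measurable_derivable cf.
rewrite -(setUv [set x | derivable f x 1]).
apply/measurable_funU => //; first exact: measurableC.
split.
  pose q n x := n.+1%:R * (f (n.+1%:R^-1 + x) - f x).
  apply: (measurable_realfun.measurable_fun_cvg (h := q)).
    move=> n; apply: measurable_funTS; apply: continuous_measurable_fun => x.
    exact: continuous_diff_quotient.
  move=> x /= /derivable_derive1_cvg /cvgr_dnbhsP/(_ (fun n => n.+1%:R^-1)); rewrite /q => H.
  under eq_fun do rewrite -[X in X * _]invrK.
  apply: H; split => [n|]; first by rewrite gt_eqF.
  exact: cvg_harmonic.
apply/(eq_measurable_fun (cst (0 : R))) => [x|]; last exact: measurable_cst.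
by rewrite inE => /derive1_nondiff ->.
Qed.

End derivative_sets.

Section almost_everywhere.
Context d (T : measurableType d) (R : realType) (mu : {measure set T -> \bar R}).

Lemma aeS (P Q : T -> Prop) : (forall x, P x -> Q x) ->
  {ae mu, forall x, P x} -> {ae mu, forall x, Q x}.
Proof. by move=> PQ [E [mE E0 H]]; exists E; split => // x /= nQ; apply: H => /PQ. Qed.

Lemma aeI (P Q : T -> Prop) : {ae mu, forall x, P x} ->
  {ae mu, forall x, Q x} -> {ae mu, forall x, P x /\ Q x}.
Proof.
move=> aP aQ; have := negligibleU aP aQ; apply: negligibleS => x /= /not_andP; exact.
Qed.

End almost_everywhere.

Section slow_functions.
Context {R : realType}.
Notation mu := (@lebesgue_measure R).

Lemma leb_itv_lty (a b : R) (x y : bool) :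
  (mu [set` Interval (BSide x a) (BSide y b)] < +oo)%E.
Proof. by rewrite lebesgue_measure_itv/=; case: ifP => _; rewrite ltry. Qed.

(** Nondecreasing and 1-Lipschitz at once. The class is stable under T |-> id - T, which exchanges
    initial positions and energies. *)
Definition slow (T : R -> R) := forall a b, a <= b -> 0 <= T b - T a <= b - a.

Lemma slow_continuous T : slow T -> continuous T.
Proof.
move=> sT x; apply/cvgrPdist_le => e e0.
have H y : `|T x - T y| <= `|x - y|.
  have [xy|/ltW yx] := leP x y; last first.
    by have /andP[? ?] := sT _ _ yx; rewrite !ger0_norm// subr_ge0.
  by have /andP[? ?] := sT _ _ xy; rewrite distrC (distrC x) !ger0_norm// subr_ge0.
near=> y; apply: (le_trans (H y)).
by near: y; apply: cvgr_dist_le => //; exact: cvg_id.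
Unshelve. all: by end_near. Qed.

Lemma slow_nondecreasing T : slow T -> {homo T : a b / a <= b}.
Proof. by move=> sT a b /sT/andP[]; rewrite subr_ge0. Qed.

Lemma slow_complement T : slow T -> slow (fun x => x - T x).
Proof. by move=> sT a b ab; have := sT _ _ ab; lra. Qed.

Lemma slow_cumulative T : slow T -> exists F : cumulative R R, (F : R -> R) = T.
Proof.
move=> sT.
have nd : nondecreasing T by exact: slow_nondecreasing.
have rc : right_continuous T.
  by move=> x; apply: cvg_within_filter; exact: slow_continuous.
by exists (HB.pack T (isCumulative.Build _ _ _ _ nd rc) : cumulative R R).
Qed.

Lemma stieltjes_ocitv (F : cumulative R R) a b : a <= b ->
  lebesgue_stieltjes_measure F `]a, b] = (F b - F a)%:E.
Proof.
move=> ab; rewrite /lebesgue_stieltjes_measure /measure_extension/=.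
rewrite measurable_mu_extE/=; last exact: is_ocitv.
by rewrite wlength_itv_bnd.
Qed.

(** The Stieltjes measures of F and of id - F add up to Lebesgue measure, because they do so on
    half-open intervals. *)
Lemma slow_stieltjes_le (F : cumulative R R) : slow F ->
  forall A, measurable A -> (lebesgue_stieltjes_measure F A <= mu A)%E.
Proof.
move=> sF A mA; have [G GE] := slow_cumulative (slow_complement sF).
pose m := measure_add (lebesgue_stieltjes_measure F) (lebesgue_stieltjes_measure G).
have -> : mu A = m A.
  apply: lebesgue_measure_unique => // _ [[a b] _ <-] /=.
  rewrite [RHS]measure_addE.
  have [ab|ba] := leP a b; last first.
    by rewrite set_itv_ge ?measure0 ?adde0// bnd_simp -leNgt ltW.
  rewrite -[LHS]/(lebesgue_stieltjes_measure idfun _) /= !stieltjes_ocitv//.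
  rewrite GE -EFinD.
  by congr EFin => /=; ring.
by rewrite [leRHS]measure_addE; exact: leeDl.
Qed.

Lemma derive1_slow T x : slow T -> 0 <= derive1 T x <= 1.
Proof.
move=> sT; have [dT|/derive1_nondiff->] := pselect (derivable T x 1); last by rewrite lexx ler01.
have := derivable_derive1_cvg dT.
have H : \forall h \near 0^', 0 <= h^-1 * (T (h + x) - T x) <= 1.
  near=> h; have h0 : h != 0 by near: h; exact: nbhs_dnbhs_neq.
  have [h0'|h0'|] := ltgtP h 0; last by move/eqP; rewrite (negbTE h0).
    have := sT (h + x) x; rewrite gerDr => /(_ (ltW h0')).
    rewrite ler_ndivrMl// ler_ndivlMl// mulr1 mulr0; lra.
  have := sT x (h + x); rewrite lerDr => /(_ (ltW h0')).
  rewrite ler_pdivrMl// ler_pdivlMl// mulr1 mulr0; lra.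
move=> C; rewrite -(cvg_lim (@Rhausdorff R) C).
have cC : cvg (h^-1 * (T (h + x) - T x) @[h --> 0^']) by apply/cvg_ex; eexists; exact: C.
apply/andP; split.
  by apply: limr_ge => //; apply: filterS H => h /andP[].
by apply: limr_le => //; apply: filterS H => h /andP[].
Unshelve. all: by end_near. Qed.

(** The Stieltjes measure of T, restricted to ]-n, n] to be finite, is dominated by Lebesgue
    measure. T is a primitive of its Radon-Nikodym density, so Lebesgue differentiation yields T'
    almost everywhere and identifies it with that density. *)
Lemma slow_ae_derivable_itv T (n : R) : slow T -> 0 < n ->
  {ae mu, forall x, x \in `]-n, n[ -> derivable T x 1} /\
  (forall a b, - n <= a -> a <= b -> b < n ->
    (\int[mu]_(x in `]a, b]) (derive1 T x)%:E = (T b - T a)%:E)%E).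
Proof.
move=> sT n0; have [F FE] := slow_cumulative sT.
have sF : slow F by rewrite FE.
have mD : measurable (`]- n, n]%classic : set (measurableTypeR R)) by [].
have nn : - n <= n by lra.
have FD : (lebesgue_stieltjes_measure F [set` `]- n, n]%R] < +oo)%E.
  by rewrite stieltjes_ocitv// ltry.
pose nu : {finite_measure set (measurableTypeR R) -> \bar R} := mfrestr mD FD.
have nuE A : nu A = lebesgue_stieltjes_measure F (A `&` `]- n, n]) by [].
have numu : nu `<< mu.
  apply/null_content_dominatesP => A mA A0; rewrite nuE.
  apply/eqP; rewrite eq_le measure_ge0 andbT.
  rewrite (le_trans (slow_stieltjes_le sF _))//; first exact: measurableI.
  by rewrite -A0 le_measure// inE//; exact: measurableI.
have [g [g0 gfin ig gE]] := radon_nikodym_sigma_finite numu.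
pose h x := fine (g x).
have hE x : (h x)%:E = g x by rewrite fineK.
have ih : mu.-integrable setT (EFin \o h).
  by rewrite (_ : EFin \o h = g)//; apply/funext => x /=.
have FTC a b : - n <= a -> a <= b -> b <= n ->
    (\int[mu]_(x in `]a, b]) (h x)%:E = (T b - T a)%:E)%E.
  move=> na ab bn; under eq_integral do rewrite hE.
  rewrite -gE// nuE setIidl ?stieltjes_ocitv ?FE//.
  by apply: subset_itv; rewrite bnd_simp.
have lh : locally_integrable [set: R] h.
  by apply: open_integrable_locally => //; exact: openT.
have := @FTC1 R h (BRight (- n)) (fun y => integrableS measurableT _ (subsetT _) ih) lh.
pose G y := (\int[mu]_(t in [set` Interval (BRight (- n)) (BRight y)]) (h t))%R.
have GE y : y \in `]- n, n[ -> T y = T (- n) + G y.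
  rewrite in_itv/= => /andP[ny yn]; rewrite /G /Rintegral.
  by rewrite (FTC _ _ (lexx _) (ltW ny) (ltW yn))/= addrC subrK.
move=> aeG.
have ae1 : {ae mu, forall x, x \in `]-n, n[ -> derivable T x 1 /\ derive1 T x = h x}.
  move: (aeG (fun y => measurable_itv _)); apply: aeS => x; rewrite -/G => + xn.
  have nx : (BRight (- n) < BRight x)%O.
    by move: xn; rewrite in_itv/= bnd_simp => /andP[].
  move=> /(_ nx)[dG Gh].
  have nE : \forall z \near x, T (-n) + G z = T z.
    have := near_in_itvoo xn; apply: filterS => z zn; exact/esym/GE.
  have dT : is_derive x 1 (fun z => T (-n) + G z) (h x).
    have dG' : is_derive x 1 G (h x).
      by apply: DeriveDef; [exact: dG|rewrite -derive1E; exact: Gh].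
    have := is_deriveD (is_derive_cst (T (- n)) x 1) dG'.
    by rewrite add0r.
  have /(near_eq_is_derive nE) dT' := dT.
  by split; [exact: ex_derive|rewrite derive1E; exact: derive_val].
split.
  by move: ae1; apply: aeS => x H /H[].
move=> a b na ab bn; rewrite -FTC// ?ltW//.
apply: ge0_ae_eq_integral => //.
- apply/measurable_EFinP; apply: measurable_funTS.
  by apply: measurable_derive1; exact: slow_continuous.
- by apply: measurable_funTS; exact: measurable_int ih.
- by move=> x _; rewrite lee_fin; case/andP: (derive1_slow x sT).
- by move=> x _; rewrite hE.
move: ae1; apply: aeS => x H /=; rewrite in_itv/= => /andP[ax xb].
by rewrite (H _).2// in_itv/= (le_lt_trans na ax) (le_lt_trans xb bn).
Qed.

Lemma slow_ae_derivable T : slow T -> {ae mu, forall x, derivable T x 1}.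
Proof.
move=> sT; have H n : {ae mu, forall x, x \in `]-n.+1%:R, n.+1%:R[ -> derivable T x 1}.
  by apply: (slow_ae_derivable_itv sT _).1.
move/ae_foralln : H; apply: aeS => x /(_ (Num.bound x)); apply.
rewrite in_itv/= -ltr_norml (lt_le_trans (unstable.ltr_norm_bound x))//.
by rewrite ler_nat.
Qed.

Lemma slow_FTC T a b : slow T -> a <= b ->
  (\int[mu]_(x in `]a, b]) (derive1 T x)%:E = (T b - T a)%:E)%E.
Proof.
move=> sT ab; apply: (slow_ae_derivable_itv (n := `|a| + `|b| + 1) sT _).2 => //.
- by have := ler_norm (- a); rewrite normrN; have := normr_ge0 b; lra.
- by have := ler_norm b; have := normr_ge0 a; lra.
Qed.

Lemma is_derive_complement T (a : R) : derivable T a 1 ->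
  is_derive a (1 : R) (fun x => x - T x) (1 - derive1 T a).
Proof. by move=> dT; apply: is_deriveB; rewrite derive1E; exact: DeriveDef. Qed.

Lemma slow_complement_FTC T a b : slow T -> a <= b ->
  (\int[mu]_(x in `]a, b]) (1 - derive1 T x)%:E = ((b - T b) - (a - T a))%:E)%E.
Proof.
move=> sT ab; have sC := slow_complement sT.
have mT : measurable_fun setT (derive1 T).
  by apply: measurable_derive1; exact: slow_continuous sT.
rewrite -(slow_FTC sC ab); apply: ge0_ae_eq_integral => //.
- by apply/measurable_EFinP; apply: measurable_funTS; exact: measurable_funB.
- apply/measurable_EFinP; apply: measurable_funTS.
  by apply: measurable_derive1; exact: slow_continuous sC.
- by move=> x _; rewrite lee_fin subr_ge0; case/andP: (derive1_slow x sT).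
- by move=> x _; rewrite lee_fin; case/andP: (derive1_slow x sC).
have := slow_ae_derivable sT; apply: aeS => x /is_derive_complement H _.
by rewrite [in RHS]derive1E (@derive_val _ _ _ _ _ _ _ H).
Qed.

Definition lip (K : R) (T : R -> R) :=
  forall a b, a <= b -> `|T b - T a| <= K * (b - a).

(** Adding K x moves the slopes from [-K, K] to [0, 2K]. Results on slow functions transfer to
    Lipschitz ones by this affine change. *)
Lemma lip_slow K T : 0 < K -> lip K T -> slow (fun x => (T x + K * x) / (2 * K)).
Proof.
move=> K0 lT a b ab; have := lT _ _ ab; rewrite ler_norml => /andP[l1 l2].
have -> : (T b + K * b) / (2 * K) - (T a + K * a) / (2 * K) =
  (T b - T a + K * (b - a)) / (2 * K) by field; rewrite gt_eqF.
rewrite divr_ge0/= ?mulr_ge0 ?(ltW K0)//; last lra.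
rewrite ler_pdivrMr ?mulr_gt0//; nra.
Qed.

Lemma lip_continuous K T : lip K T -> continuous T.
Proof.
move=> lT x; apply/cvgrPdist_le => e e0.
have H y : `|T x - T y| <= `|K| * `|x - y|.
  have [xy|/ltW yx] := leP x y; rewrite -normrM.
    by rewrite distrC (le_trans (lT _ _ xy))// (le_trans (ler_norm _))// !normrM (distrC x).
  by rewrite (le_trans (lT _ _ yx))// ler_norm.
have [K0|K0] := eqVneq K 0.
  by near=> y; rewrite (le_trans (H y))// K0 normr0 mul0r ltW.
have e1 : 0 < e / `|K| by rewrite divr_gt0 ?normr_gt0.
by near=> y; rewrite (le_trans (H y))// mulrC -ler_pdivlMr ?normr_gt0.
Unshelve. all: by end_near. Qed.

Lemma lip_derive1 K T x : 0 < K -> lip K T ->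
  derivable (fun x => (T x + K * x) / (2 * K)) x 1 ->
  is_derive x 1 T (2 * K * derive1 (fun x => (T x + K * x) / (2 * K)) x - K).
Proof.
move=> K0 lT; set S := fun x => _ => dS.
have -> : T = (2 * K) \*: S - K \*: id.
  apply/funext => y; rewrite /S /= !fctE/= /GRing.scale/=.
  by field; rewrite gt_eqF.
have -> : 2 * K * derive1 S x - K = (2 * K) *: derive1 S x - K *: (1 : R).
  by rewrite /GRing.scale/= mulr1.
apply: is_deriveB; apply: is_deriveZ; first by rewrite derive1E; exact: DeriveDef.
Qed.

Lemma lip_ae_derivable K T : 0 < K -> lip K T -> {ae mu, forall x, derivable T x 1}.
Proof.
move=> K0 lT; have := slow_ae_derivable (lip_slow K0 lT).
by apply: aeS => x /(lip_derive1 K0 lT) ?; exact: ex_derive.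
Qed.

Lemma lip_derive1_le K T x : 0 <= K -> lip K T -> `|derive1 T x| <= K.
Proof.
move=> K0 lT; have [dT|/derive1_nondiff->] := pselect (derivable T x 1); last by rewrite normr0.
have H : \forall h \near 0^', `|h^-1 * (T (h + x) - T x)| <= K.
  near=> h; have h0 : h != 0 by near: h; exact: nbhs_dnbhs_neq.
  rewrite normrM normfV ler_pdivrMl ?normr_gt0// mulrC.
  have [h0'|h0'] := leP h 0.
    have := lT (h + x) x; rewrite gerDr => /(_ h0').
    by rewrite distrC (ler0_norm h0'); congr (_ <= K * _); ring.
  have := lT x (h + x); rewrite lerDr => /(_ (ltW h0')).
  by rewrite (gtr0_norm h0'); congr (_ <= K * _); ring.
have /cvg_norm C := derivable_derive1_cvg dT; rewrite -(cvg_lim (@Rhausdorff R) C).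
have cC : cvg (`|h^-1 * (T (h + x) - T x)| @[h --> 0^']).
  by apply/cvg_ex; exists `|derive1 T x|; exact: C.
exact: limr_le.
Unshelve. all: by end_near. Qed.

Lemma lip_FTC K T a b : 0 < K -> lip K T -> a <= b ->
  (\int[mu]_(x in `]a, b]) (derive1 T x)%:E = (T b - T a)%:E)%E.
Proof.
move=> K0 lT ab; set S := fun x => (T x + K * x) / (2 * K).
have sS := lip_slow K0 lT.
transitivity (\int[mu]_(x in `]a, b]) ((2 * K)%:E * (derive1 S x)%:E - K%:E))%E.
  apply: ae_eq_integral => //.
  - apply/measurable_EFinP; apply: measurable_funTS.
    by apply: measurable_derive1; exact: lip_continuous lT.
  - apply: emeasurable_funB => //; apply: emeasurable_funM => //.
    apply/measurable_EFinP; apply: measurable_funTS.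
    by apply: measurable_derive1; exact: slow_continuous.
  - have := slow_ae_derivable sS; apply: aeS => x /(lip_derive1 K0 lT) H _.
    by rewrite derive1E derive_val.
have mS : measurable_fun `]a, b] (derive1 S).
  by apply: measurable_funTS; apply: measurable_derive1; exact: slow_continuous.
have iS : mu.-integrable `]a, b] (EFin \o derive1 S).
  apply: measurable_bounded_integrable => //.
    exact: leb_itv_lty.
  exists 1; split => // M M1 x /= _; have /andP[S0 S1] := derive1_slow x sS.
  by rewrite ger0_norm// (le_trans S1)// ltW.
have iC : mu.-integrable `]a, b] (EFin \o cst K).
  apply: measurable_bounded_integrable => //.
    exact: leb_itv_lty.
  by exists `|K|; split => // M MK x /= _; rewrite ltW.
have iSK : mu.-integrable `]a, b] (EFin \o (fun x => 2 * K * derive1 S x)).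
  by have := integrableZl _ (2 * K) iS; apply.
rewrite (integralB_EFin _ iSK iC)//.
under eq_integral do rewrite EFinM.
have -> : (\int[mu]_(x in `]a, b]) ((2 * K)%:E * (derive1 S x)%:E) = (2 * K)%:E * (S b - S a)%:E)%E.
  by rewrite -slow_FTC// -integralZl.
have -> : (\int[mu]_(x in `]a, b]) (cst K x)%:E = K%:E * mu `]a, b])%E.
  by rewrite -integral_cst.
rewrite lebesgue_measure_itv/=.
move: ab; rewrite le_eqVlt => /orP[/eqP<-|ab].
  by rewrite ltxx mule0 sube0 !subrr mule0.
rewrite lte_fin ab; congr EFin; rewrite /S.
by field; rewrite gt_eqF.
Qed.

End slow_functions.

Lemma nondecreasing_derive1_ge0 {R : realType} (T : R -> R) a :
  {homo T : x y / x <= y} -> 0 <= derive1 T a.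
Proof.
move=> nT; have [dT|/derive1_nondiff->//] := pselect (derivable T a 1).
have C := derivable_derive1_cvg dT; rewrite -(cvg_lim (@Rhausdorff R) C).
have cC : cvg (h^-1 * (T (h + a) - T a) @[h --> 0^']).
  by apply/cvg_ex; eexists; exact: C.
apply: limr_ge => //; near=> h.
have h0 : h != 0 by near: h; exact: nbhs_dnbhs_neq.
have [h0'|h0'|] := ltgtP h 0; last by move/eqP; rewrite (negbTE h0).
  by rewrite mulr_le0// ?invr_le0 ?(ltW h0')// subr_le0 nT// gerDr ltW.
by rewrite mulr_ge0// ?invr_ge0 ?(ltW h0')// subr_ge0 nT// lerDr ltW.
Unshelve. all: by end_near. Qed.

(** * Densities, push-forwards and changes of variables *)

Section density.
Context d (T : measurableType d) (R : realType).
Variables (mu nu : {measure set T -> \bar R}) (g : T -> R).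
Hypotheses (mg : measurable_fun setT g) (g0 : forall x, 0 <= g x)
  (nuE : forall A, measurable A -> nu A = (\int[mu]_(x in A) (g x)%:E)%E).
Import HBNNSimple.

Let nnsfun_density (h : {nnsfun T >-> R}) :
  (\int[nu]_x (h x)%:E = \int[mu]_x ((h x)%:E * (g x)%:E))%E.
Proof.
under eq_integral do rewrite fimfunE -fsumEFin//.
under [RHS]eq_integral => x _.
  rewrite fimfunE -fsumEFin// ge0_mule_fsuml; last first.
    by move=> r; exact: nnfun_muleindic_ge0.
  over.
have mi r : measurable (h @^-1` [set r]) by exact: measurable_sfunP.
have mr r : measurable_fun setT (fun x => (r * \1_(h @^-1` [set r]) x)%:E).
  by apply/measurable_EFinP; apply: measurable_funM => //; exact: measurable_indic.
rewrite !ge0_integral_fsum//.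
- apply: eq_fsbigr => r /[!inE] -[t _ <-].
  under eq_integral do rewrite EFinM.
  under [RHS]eq_integral do rewrite EFinM -muleA.
  rewrite !ge0_integralZl ?lee_fin//.
  + rewrite integral_indic// setIT nuE//; congr (_ * _)%E.
    rewrite integral_mkcond; apply: eq_integral => x _.
    rewrite patchE indicE -EFinM; case: ifPn => _; rewrite ?mul1r ?mul0r//.
  + by apply/measurable_EFinP; apply: measurable_funM => //; exact: measurable_indic.
  + by move=> x _; rewrite -EFinM lee_fin mulr_ge0.
  + by apply/measurable_EFinP; exact: measurable_indic.
- move=> r; apply/measurable_EFinP; apply: measurable_funM => //.
  by apply: measurable_funM => //; exact: measurable_indic.
- by move=> r x _; rewrite mule_ge0 ?lee_fin// -lee_fin nnfun_muleindic_ge0.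
- by move=> r x _; exact: nnfun_muleindic_ge0.
Qed.

(** Extended from simple functions by monotone convergence. *)
Lemma ge0_integral_density (f : T -> \bar R) : measurable_fun setT f ->
  (forall x, 0 <= f x)%E ->
  (\int[nu]_x f x = \int[mu]_x (f x * (g x)%:E))%E.
Proof.
move=> mf f0; pose h := nnsfun_approx measurableT mf.
have hf x : (h n x)%:E @[n --> \oo] --> f x.
  by apply: cvg_nnsfun_approx => // y _; exact: f0.
have nd x : {homo (fun n => (h n x)%:E) : n m / (n <= m)%N >-> (n <= m)%E}.
  by move=> n m nm; rewrite lee_fin; exact/lefP/nd_nnsfun_approx.
transitivity (limn (fun n => \int[nu]_x (h n x)%:E)%E).
  rewrite -monotone_convergence//.
  - by apply: eq_integral => x _; apply/esym/cvg_lim => //; exact: hf.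
  - by move=> n; exact/measurable_EFinP.
  - by move=> n x _; rewrite lee_fin.
under eq_fun do rewrite nnsfun_density.
rewrite -monotone_convergence//.
- apply: eq_integral => x _; apply/cvg_lim => //.
  by apply: cvgeZr => //; exact: hf.
- by move=> n; apply/measurable_EFinP; exact: measurable_funM.
- by move=> n x _; rewrite -EFinM lee_fin mulr_ge0.
- by move=> x _ n m nm; rewrite lee_wpmul2r ?lee_fin// -lee_fin; exact: nd.
Qed.

End density.

Section push.
Context {R : realType}.
Notation mT := (measurableTypeR R).
Notation mu := (@lebesgue_measure R).

Lemma measurable_preimage (T : R -> R) (A : set R) : measurable_fun setT T ->
  measurable A -> measurable (T @^-1` A).
Proof. by move=> mfT mA; rewrite -[X in measurable X]setTI; exact: mfT. Qed.

(** [density] and [push_density] are bare set functions; this lemma and the next two supply measures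
    with the same values. *)
Lemma density_measure (h : R -> R) : measurable_fun setT h -> (forall x, 0 <= h x) ->
  exists m : {measure set mT -> \bar R}, forall A, m A = density h A.
Proof.
move=> mh h0.
have d0 : density h set0 = 0%E by rewrite /density integral_set0.
have dge0 A : (0 <= density h A)%E by apply: integral_ge0 => x _; rewrite lee_fin.
have ds : semi_sigma_additive (density h).
  by apply: semi_sigma_additive_nng_induced => //; exact/measurable_EFinP.
pose M := isMeasure.Build _ _ _ (density h) d0 dge0 ds.
by exists (HB.pack (density h) M : {measure set mT -> \bar R}).
Qed.

Lemma push_measure (T h : R -> R) : measurable_fun setT T ->
  measurable_fun setT h -> (forall x, 0 <= h x) ->
  exists m : {measure set mT -> \bar R}, forall A, m A = push_density T h A.
Proof.
move=> mfT mh h0; have [m mE] := density_measure mh h0.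
have d0 : push_density T h set0 = 0%E.
  by rewrite /push_density /pushforward preimage_set0 -mE measure0.
have dge0 A : (0 <= push_density T h A)%E.
  by rewrite /push_density /pushforward -mE.
have ds : semi_sigma_additive (push_density T h).
  move=> F mF tF mUF; rewrite /push_density /pushforward preimage_bigcup.
  under eq_fun do under eq_bigr do rewrite -mE.
  rewrite -mE; apply: measure_semi_sigma_additive.
  - by move=> n; apply: measurable_preimage => //; exact: mF.
  - apply/trivIsetP => i j _ _ ij; rewrite -preimage_setI.
    by move/trivIsetP : tF => /(_ _ _ Logic.I Logic.I ij) ->; rewrite preimage_set0.
  - by rewrite -preimage_bigcup; apply: measurable_preimage.
pose M := isMeasure.Build _ _ _ (push_density T h) d0 dge0 ds.
by exists (HB.pack (push_density T h) M : {measure set mT -> \bar R}).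
Qed.

Lemma push_finite_measure (T h : R -> R) : measurable_fun setT T ->
  measurable_fun setT h -> (forall x, 0 <= h x) -> (\int[mu]_x (h x)%:E < +oo)%E ->
  exists m : finite_borel_measure R, forall A, m A = push_density T h A.
Proof.
move=> mfT mh h0 hoo; have [m mE] := push_measure mfT mh h0.
have mT_lty : (m setT < +oo)%E by rewrite mE /push_density /pushforward preimage_setT.
(* Restriction to the whole line changes no value and provides the finite measure structure. *)
by exists (mfrestr measurableT mT_lty) => A; rewrite /= /mfrestr /mrestr setIT mE.
Qed.

Lemma ge0_integral_push (T h : R -> R) (m : {measure set mT -> \bar R}) (f : R -> \bar R) :
  measurable_fun setT T -> measurable_fun setT h -> (forall x, 0 <= h x) ->
  same_measure m (push_density T h) ->
  measurable_fun setT f -> (forall x, 0 <= f x)%E ->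
  (\int[m]_x f x = \int[mu]_x (f (T x) * (h x)%:E))%E.
Proof.
move=> mfT mh h0 mE mf f0; have [m' m'E] := density_measure mh h0.
transitivity (\int[pushforward m' (T : mT -> mT)]_x f x)%E.
  by apply: eq_measure_integral => A mA _; rewrite mE//; exact/esym/m'E.
rewrite ge0_integral_pushforward//.
rewrite preimage_setT; apply: (@ge0_integral_density _ mT R mu m' h) => //.
  exact: measurableT_comp.
by move=> x; exact: f0.
Qed.

Lemma integral_push (T h : R -> R) (m : {measure set mT -> \bar R}) (f : R -> R) :
  measurable_fun setT T -> measurable_fun setT h -> (forall x, 0 <= h x) ->
  same_measure m (push_density T h) ->
  measurable_fun setT f ->
  (\int[m]_x (f x)%:E = \int[mu]_x (f (T x) * h x)%:E)%E.
Proof.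
move=> mfT mh h0 mE mf; rewrite [LHS]integralE [RHS]integralE; congr (adde _ (oppe _)).
- rewrite (ge0_integral_push mfT mh h0 mE)//; last exact/measurable_funepos/measurable_EFinP.
  apply: eq_integral => x _; rewrite !funeposE -!EFin_max -EFinM; congr EFin.
  by rewrite maxr_pMl// mul0r.
- rewrite (ge0_integral_push mfT mh h0 mE)//; last exact/measurable_funeneg/measurable_EFinP.
  apply: eq_integral => x _; rewrite !funenegE -!EFinN -!EFin_max -EFinM; congr EFin.
  by rewrite maxr_pMl// mul0r mulNr.
Qed.

Lemma Rintegral_push (T h : R -> R) (m : {measure set mT -> \bar R}) (f : R -> R) :
  measurable_fun setT T -> measurable_fun setT h -> (forall x, 0 <= h x) ->
  same_measure m (push_density T h) ->
  measurable_fun setT f ->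
  \int[m]_x f x = \int[mu]_x (f (T x) * h x).
Proof. by move=> mfT mh h0 mE mf; rewrite /Rintegral (integral_push mfT mh h0 mE). Qed.

End push.

Section change_of_variables.
Context {R : realType}.
Notation mu := (@lebesgue_measure R).
Variables (K : R) (T : R -> R).
Hypotheses (K0 : 0 < K) (lT : lip K T) (nT : {homo T : a b / a <= b})
  (sT : forall x, exists a, T a = x).

Let derive1_ge0 a : 0 <= derive1 T a.
Proof. exact: nondecreasing_derive1_ge0. Qed.

Let mT : measurable_fun setT T.
Proof. by apply: continuous_measurable_fun; exact: lip_continuous lT. Qed.

Let mT' : measurable_fun setT (derive1 T).
Proof. by apply: measurable_derive1; exact: lip_continuous lT. Qed.

(** [z] is the supremum of the sublevel set; the Lipschitz bound shows that it is attained. *)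
Lemma preimage_ray x : exists z, forall a, (T a <= x) = (a <= z).
Proof.
have [a0 Ta0] := sT x; have [b0 Tb0] := sT (x + 1).
pose S := [set a | T a <= x]; have Sa0 : S a0 by rewrite /S/= Ta0.
have ubS : ubound S b0.
  move=> a /= Sa; rewrite leNgt; apply/negP => /ltW/nT; rewrite Tb0 => h.
  by have := le_trans h Sa; lra.
have hS : has_sup S by split; [exists a0|exists b0].
exists (sup S) => a; apply/idP/idP => [Ta|aS].
  by apply: ub_le_sup; [exists b0|].
apply: (le_trans (nT aS)); apply/ler_addgt0Pr => e e0.
have [c Sc cS] := sup_adherent (divr_gt0 e0 K0) hS.
have cs : c <= sup S by apply: ub_le_sup; [exists b0|].
have := lT cs; rewrite ger0_norm; last by rewrite subr_ge0 nT.
rewrite lerBlDr => /le_trans; apply; rewrite addrC lerD//.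
by rewrite mulrC -ler_pdivlMr//; lra.
Qed.

(** The preimage of ]x, y] is a half-open interval whose endpoints are mapped to x and y, so the
    integral of T' over it is y - x; Lebesgue measure is determined by these values. *)
Lemma push_derive1 : same_measure mu (push_density T (derive1 T)).
Proof.
have [m mE] := push_measure mT mT' derive1_ge0.
move=> E mE'; rewrite -mE; apply: lebesgue_measure_unique => // _ [[x y] _ <-]/=.
have [xy|yx] := leP x y; last first.
  by rewrite set_itv_ge ?measure0 ?adde0// bnd_simp -leNgt ltW.
have [[a aE] [b bE]] := (preimage_ray x, preimage_ray y).
rewrite mE /push_density /pushforward.
have -> : T @^-1` `]x, y] = `]a, b]%classic.
  by apply/seteqP; split => z /=; rewrite !in_itv/= !ltNge aE bE.
have Te z w : (forall c, (T c <= z) = (c <= w)) -> T w = z.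
  move=> H; apply/le_anti; rewrite H lexx/=.
  have [c Tc] := sT z; rewrite -Tc nT//.
  by rewrite -H Tc.
rewrite /density (lip_FTC K0 lT); last by rewrite -bE (Te _ _ aE).
by rewrite (Te _ _ aE) (Te _ _ bE) -[LHS]/(lebesgue_stieltjes_measure idfun _) stieltjes_ocitv.
Qed.

Lemma ge0_change_of_variables (f : R -> \bar R) : measurable_fun setT f ->
  (forall x, 0 <= f x)%E ->
  (\int[mu]_x f x = \int[mu]_a (f (T a) * (derive1 T a)%:E))%E.
Proof. by move=> mf f0; exact: ge0_integral_push push_derive1 _ _. Qed.

Lemma change_of_variables (f : R -> R) : measurable_fun setT f ->
  (\int[mu]_x (f x)%:E = \int[mu]_a (f (T a) * derive1 T a)%:E)%E.
Proof. by move=> mf; exact: integral_push push_derive1 _. Qed.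

Lemma Rintegral_change_of_variables (f : R -> R) : measurable_fun setT f ->
  \int[mu]_x f x = \int[mu]_a (f (T a) * derive1 T a).
Proof. by move=> mf; exact: Rintegral_push push_derive1 _. Qed.

(** The preimage of a null set may have positive measure, but T' integrates to 0 over it and hence
    vanishes almost everywhere there. *)
Lemma ae_pullback (P : R -> Prop) : {ae mu, forall x, P x} ->
  {ae mu, forall a, 0 < derive1 T a -> P (T a)}.
Proof.
move=> [N [mN N0 NP]]; have := push_derive1 mN; rewrite /= N0 /push_density /pushforward /density.
have mTN : measurable (T @^-1` N) by exact: measurable_preimage.
move/esym; rewrite integral_mkcond => H.
have : ae_eq mu setT ((fun x => (derive1 T x)%:E) \_ (T @^-1` N)) (cst 0%E).
  apply/ae_eq_integral_abs => //.
    apply/(measurable_restrictT _ _).1 => //.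
    by apply/measurable_EFinP; exact: measurable_funTS.
  rewrite -[RHS]H; apply: eq_integral => x _; rewrite gee0_abs// patchE.
  by case: ifP => // _; rewrite lee_fin.
apply: aeS => x /(_ Logic.I) /= + Tx; apply: contraPP => nP; rewrite patchE.
rewrite mem_set/=; last by apply: NP.
by case=> T0; rewrite T0 ltxx in Tx.
Qed.

End change_of_variables.

(** * Smooth test functions *)

Section class_C.
Context {R : realType}.
Implicit Types V : normedModType R.

Lemma class_C_continuous V n (phi : V -> R) : class_C n phi -> continuous phi.
Proof. by case: n => [//|n] []. Qed.

Lemma class_CW V n (phi : V -> R) : class_C n.+1 phi -> class_C n phi.
Proof.
elim: n phi => [phi []//|n IHn phi [cphi H]]; split=> // v.
by have [d /IHn] := H v.
Qed.

Lemma class_C_cst V n (c : R) : @class_C R V n (fun=> c).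
Proof.
elim: n c => [c x|n IHn c]; first exact: cvg_cst.
split=> [x|v]; first exact: cvg_cst.
split=> [p|]; first exact: derivable_cst.
rewrite (_ : 'D_v (fun=> c) = fun=> 0); first exact: IHn.
by apply/funext => p; rewrite derive_cst.
Qed.

Lemma class_CD V n (f g : V -> R) : class_C n f -> class_C n g ->
  class_C n (fun x => f x + g x).
Proof.
elim: n f g => [f g cf cg x|n IHn f g [cf Hf] [cg Hg]].
  by apply: cvgD; [exact: cf|exact: cg].
split=> [x|v]; first by apply: cvgD; [exact: cf|exact: cg].
have [df Df] := Hf v; have [dg Dg] := Hg v.
split=> [p|]; first exact: derivableD.
rewrite (_ : (fun p => _) = (fun p => 'D_v f p + 'D_v g p)); first exact: IHn.
by apply/funext => p; rewrite -deriveD.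
Qed.

Lemma class_CM V n (f g : V -> R) : class_C n f -> class_C n g ->
  class_C n (fun x => f x * g x).
Proof.
elim: n f g => [f g cf cg x|n IHn f g Cf Cg].
  by apply: cvgM; [exact: cf|exact: cg].
have [cf Hf] := Cf; have [cg Hg] := Cg.
split=> [x|v]; first by apply: cvgM; [exact: cf|exact: cg].
have [df Df] := Hf v; have [dg Dg] := Hg v.
split=> [p|]; first exact: derivableM.
rewrite (_ : (fun p => _) = (fun p => f p * 'D_v g p + g p * 'D_v f p)).
  by apply: class_CD; apply: IHn => //; exact: class_CW.
by apply/funext => p; rewrite -[RHS]deriveM.
Qed.

Lemma is_derive_quotient (f : R -> R) (x l : R) :
  h^-1 * (f (h + x) - f x) @[h --> 0^'] --> l -> is_derive x (1 : R) f l.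
Proof.
move=> H; apply: DeriveDef; first by rewrite derivableE; apply/cvg_ex; exists l.
by rewrite -derive1E; exact: cvg_lim H.
Qed.

Lemma is_derive_dir (f : R -> R) (x v l : R) : is_derive x (1 : R) f l ->
  is_derive x v f (v * l).
Proof.
move=> [d dl]; have /derivable1_diffP D := d.
apply: DeriveDef; first exact: diff_derivable.
rewrite deriveE// -dl deriveE// -[v in LHS]mulr1 -[_ * 1]/(v *: 1).
by rewrite linearZ.
Qed.

(** On the line every directional derivative is a multiple of the ordinary one. The smooth functions
    below are all obtained through this step. *)
Lemma class_C_primitive n (F f : R -> R) : (forall x : R, is_derive x (1 : R) F (f x)) ->
  class_C n f -> class_C n.+1 F.
Proof.
move=> dF Cf; split=> [x|v].
  by apply: differentiable_continuous; apply/derivable1_diffP.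
split=> [p|]; first by have [] := is_derive_dir v (dF p).
rewrite (_ : 'D_v F = (fun p => v * f p)).
  by apply: class_CM => //; exact: class_C_cst.
by apply/funext => p; have [] := is_derive_dir v (dF p).
Qed.

Lemma class_C_affine n (f : R -> R) (m c : R) : class_C n f ->
  class_C n (fun x => f (m * x + c)).
Proof.
have ca : continuous (fun x : R => m * x + c).
  move=> x; apply: cvgD; last exact: cvg_cst.
  by apply: cvgM; [exact: cvg_cst|exact: cvg_id].
have cc g : continuous g -> continuous (fun x : R => g (m * x + c)).
  by move=> cg x; apply: (@cvg_comp _ _ _ (fun x : R => m * x + c) g); [exact: ca|exact: cg].
elim: n f => [f cf|n IHn f [cf Hf]]; first exact: cc.
have [df Df] := Hf 1.
apply: (@class_C_primitive n (fun x => f (m * x + c))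
  (fun x => 'D_1 f (m * x + c) * m)) => [x|].
  apply: (@is_derive1_comp _ f (fun x => m * x + c)).
    by apply: DeriveDef => //; exact: df.
  rewrite -[X in is_derive _ _ _ X]addr0; apply: is_deriveD.
  have := is_deriveZ (m : R) (@is_derive_id _ _ x (1 : R)).
  by rewrite /GRing.scale/= mulr1.
apply: class_CM; last exact: class_C_cst.
exact: (IHn ('D_1 f) Df).
Qed.

End class_C.

Section flat.
Context {R : realType}.

(* The functions p(1/x) exp(-1/x), extended by 0 to x <= 0, are stable under
   differentiation. *)
Definition flat (p : {poly R}) (x : R) : R :=
  if 0 < x then p.[x^-1] * expR (- x^-1) else 0.

(** Each monomial satisfies y^i <= i! exp(y), a single term of the exponential series; the constant
    is the sum of |q_i| i!. *)
Lemma poly_exp_bounded (q : {poly R}) :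
  exists C, forall y, 0 < y -> `|q.[y]| * expR (- y) <= C.
Proof.
exists (\sum_(i < size q) `|q`_i| * (i`!)%:R) => y y0.
rewrite horner_coef (le_trans (ler_wpM2r (expR_ge0 _) (ler_norm_sum _ _ _)))//.
rewrite mulr_suml; apply: ler_sum => i _.
rewrite normrM -mulrA ler_wpM2l// normrX gtr0_norm//.
rewrite expRN ler_pdivrMr ?expR_gt0//.
case: (nat_of_ord i) => [|n]; first by rewrite expr0 mul1r -expR0 ler_expR ltW.
rewrite -ler_pdivrMl ?ltr0n ?fact_gt0// mulrC.
by apply: le_trans (expR_ge1Dxn n (ltW y0)); rewrite lerDr.
Qed.

(** For x > 0, differentiating p(1/x) exp(-1/x) gives x^-2 (p - p')(1/x) exp(-1/x), which is again
    of the same form. *)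
Lemma is_derive_flat p (x : R) :
  is_derive x (1 : R) (flat p) (flat ((p - p^`()) * 'X^2) x).
Proof.
have [x0|x0|->] := ltgtP x 0.
- have -> : flat ((p - p^`()) * 'X^2) x = 0 by rewrite /flat ltNge (ltW x0).
  apply: (@near_eq_is_derive _ _ _ (cst 0)) => //.
  by near=> y; rewrite /flat ltNge (ltW _)//; near: y; exact: lt_nbhsl.
- have xn0 : x != 0 by rewrite gt_eqF.
  have := @is_deriveV R id x 1 1 xn0 (@is_derive_id _ _ x (1:R)).
  rewrite [_ *: _]mulr1 => dV.
  have dp : is_derive x 1 (fun y : R => p.[y^-1]) (p^`().[x^-1] * (- x ^- 2)).
    by apply: (@is_derive1_comp _ (horner p) (fun y => y^-1)) => //; exact: is_derive_poly.
  have de : is_derive x 1 (fun y : R => expR (- y^-1)) (expR (- x^-1) * (x ^- 2)).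
    apply: (@is_derive1_comp _ expR (fun y => - y^-1)).
    by rewrite -[X in is_derive _ _ _ X]opprK; apply: is_deriveN.
  have := is_deriveM dp de; rewrite /GRing.scale/= => H.
  have -> : flat ((p - p^`()) * 'X^2) x =
      p.[x^-1] * (expR (- x^-1) * x ^- 2) + expR (- x^-1) * (p^`().[x^-1] * - x ^- 2).
    by rewrite /flat x0 !hornerE/= ?exprVn; field.
  apply: near_eq_is_derive H; near=> y; rewrite /flat ifT//.
  by near: y; exact: lt_nbhsr.
- have -> : flat ((p - p^`()) * 'X^2) 0 = 0 by rewrite /flat ltxx.
  apply: is_derive_quotient.
  (* The difference quotient at 0 contributes one factor 1/h. Bounding p X^2 controls two such
     factors, so the quotient is at most C h. *)
  have [C HC] := poly_exp_bounded (p * 'X^2).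
  have C0 : 0 <= C by apply: le_trans (HC 1 ltr01); rewrite mulr_ge0 ?expR_ge0.
  apply/cvgr0Pnorm_le => e e0; near=> h.
  have h0 : h != 0 by near: h; exact: nbhs_dnbhs_neq.
  have eC : 0 < e / (C + 1) by rewrite divr_gt0// ltr_wpDl.
  have he : `|h| < e / (C + 1) by near: h; apply: dnbhs0_lt; rewrite divr_gt0// ltr_wpDl.
  rewrite addr0 /flat ltxx subr0; case: ifPn => hp; last by rewrite mulr0 normr0 ltW.
  rewrite gtr0_norm// in he.
  have := HC h^-1; rewrite invr_gt0 => /(_ hp).
  rewrite hornerE !normrM hornerXn (ger0_norm (expR_ge0 _)).
  rewrite (gtr0_norm (exprn_gt0 2 _)) ?invr_gt0// => H.
  rewrite gtr0_norm ?invr_gt0//.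
  have -> : h^-1 * (`|p.[h^-1]| * expR (- h^-1)) =
     (`|p.[h^-1]| * h^-1 ^+ 2 * expR (- h^-1)) * h by field.
  apply: (le_trans (ler_wpM2r (ltW hp) H)).
  move: he; rewrite ltr_pdivlMr ?ltr_wpDl// => he; nra.
Unshelve. all: by end_near. Qed.

Lemma class_C_flat n p : class_C n (flat p).
Proof.
elim: n p => [p x|n IHn p].
  by apply: differentiable_continuous; apply/derivable1_diffP; have [] := is_derive_flat p x.
by apply: class_C_primitive (IHn _) => x; exact: is_derive_flat.
Qed.

(** This is exp(-1/x - 1/(1 - x)) on ]0, 1[ and 0 elsewhere; the second argument has the shape
    expected by [class_C_affine]. *)
Definition bump (x : R) : R := flat 1 x * flat 1 (- 1 * x + 1).

Lemma class_C_bump n : class_C n bump.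
Proof.
by apply: class_CM; [exact: class_C_flat|apply: class_C_affine; exact: class_C_flat].
Qed.

Lemma bump_ge0 x : 0 <= bump x.
Proof.
rewrite /bump /flat mulr_ge0//; case: ifP => // _;
  by rewrite mulr_ge0 ?expR_ge0// hornerC.
Qed.

Lemma bump_gt0 x : 0 < x < 1 -> 0 < bump x.
Proof.
move=> /andP[x0 x1]; rewrite /bump /flat x0 ifT; last lra.
by rewrite !hornerC !mul1r mulr_gt0 ?expR_gt0.
Qed.

Lemma bump_eq0 x : x \notin `]0, 1[ -> bump x = 0.
Proof.
rewrite in_itv/= negb_and -!leNgt /bump /flat => /orP[x0|x1].
  by rewrite ltNge x0 mul0r.
by rewrite [X in _ * X]ifF ?mulr0//; apply/negbTE; rewrite -leNgt; lra.
Qed.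

Lemma continuous_bump : continuous bump.
Proof. exact: class_C_continuous (class_C_bump 0). Qed.

End flat.

(** * Smoothed indicators and primitives of weak derivatives *)

Section smooth_step.
Context {R : realType}.
Notation mu := (@lebesgue_measure R).

Lemma integrable_continuous_itv (f : R -> R) (a b : R) : continuous f ->
  mu.-integrable `[a, b] (EFin \o f).
Proof.
move=> cf; apply: continuous_compact_integrable; first exact: segment_compact.
exact: continuous_subspaceT.
Qed.

Let cb := @continuous_bump R.

Lemma integrable_continuous_supp (f : R -> R) (a b : R) : continuous f ->
  (forall x, x \notin `[a, b] -> f x = 0) -> mu.-integrable setT (EFin \o f).
Proof.
move=> cf f0; have := @integrable_continuous_itv f a b cf.
rewrite integrable_mkcond//; congr (_.-integrable _ _).
apply/funext => x; rewrite patchE; case: ifPn => //.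
by rewrite notin_setE/= => /negP /f0 ->.
Qed.

Lemma integrable_bump : mu.-integrable setT (EFin \o @bump R).
Proof.
apply: (@integrable_continuous_supp _ 0 1 cb) => x x01.
by rewrite bump_eq0//; apply: contra x01; rewrite !in_itv/= => /andP[/ltW-> /ltW->].
Qed.

Let prim (x : R) : R := \int[mu]_(t in `]-oo, x]) bump t.

Let is_derive_prim (x : R) : is_derive x (1 : R) prim (bump x).
Proof.
have xx : x < x + 1 by rewrite ltrDl.
have i1 : mu.-integrable `]-oo, x + 1] (EFin \o @bump R).
  by apply: integrableS integrable_bump.
have [d dE] := continuous_FTC1 xx i1 (ltNyr x) (@cb x).
by apply: DeriveDef; [exact: d|rewrite -derive1E; exact: dE].
Qed.

Lemma MVT_is_derive (f g : R -> R) (a b : R) : (forall x : R, is_derive x (1 : R) f (g x)) ->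
  a < b -> exists2 c, a < c < b & f b - f a = g c * (b - a).
Proof.
move=> df ab; have cf : {within `[a, b], continuous f}.
  apply: continuous_subspaceT => x.
  by apply: differentiable_continuous; apply/derivable1_diffP; have [] := df x.
have [c + E] := MVT ab (fun x _ => df x) cf.
by rewrite in_itv/= => acb; exists c.
Qed.

Let prim_le0 x : x <= 0 -> prim x = 0.
Proof.
move=> x0; rewrite /prim; under eq_Rintegral => t.
  rewrite inE/= in_itv/= => tx; rewrite bump_eq0; last first.
    by rewrite in_itv/= negb_and -leNgt (le_trans tx x0).
  over.
by rewrite Rintegral_cst//= mul0r.
Qed.

Let mass : R := prim 1.

Let mass_gt0 : 0 < mass.
Proof.
have [c c01 E] := MVT_is_derive is_derive_prim ltr01.
have -> : mass = bump c by move: E; rewrite (prim_le0 (lexx 0)) !subr0 mulr1.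
exact: bump_gt0.
Qed.

Definition step (x : R) : R := prim x / mass.

Lemma is_derive_step (x : R) : is_derive x (1 : R) step (bump x / mass).
Proof.
have := is_deriveZ (mass^-1 : R) (is_derive_prim x).
rewrite /GRing.scale/= mulrC; congr (is_derive _ _ _ _).
by apply/funext => y; rewrite /step mulrC.
Qed.

Lemma class_C_step n : class_C n step.
Proof.
apply: class_CW; apply: class_C_primitive; first exact: is_derive_step.
by apply: class_CM; [exact: class_C_bump|exact: class_C_cst].
Qed.

Lemma step_le0 x : x <= 0 -> step x = 0.
Proof. by move=> x0; rewrite /step prim_le0// mul0r. Qed.

Lemma step_ge1 x : 1 <= x -> step x = 1.
Proof.
rewrite le_eqVlt => /orP[/eqP<-|x1]; first by rewrite /step divff// gt_eqF.
have [c /andP[c1 _] E] := MVT_is_derive is_derive_prim x1.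
move: E; rewrite bump_eq0; last first.
  by rewrite in_itv/= negb_and orbC -leNgt (ltW c1).
by rewrite mul0r => /eqP; rewrite subr_eq0 /step => /eqP->; rewrite divff// gt_eqF.
Qed.

Lemma step_bound x : `|step x| <= 1.
Proof.
have step0 : 0 <= step x.
  by rewrite divr_ge0 ?(ltW mass_gt0)// Rintegral_ge0// => t _; exact: bump_ge0.
rewrite ger0_norm//; have [/step_ge1->//|x1] := leP 1 x.
have [c _ E] := MVT_is_derive is_derive_step x1.
rewrite -(step_ge1 (lexx 1)) -subr_ge0 E mulr_ge0 ?subr_ge0 ?(ltW x1)//.
by rewrite divr_ge0 ?bump_ge0// ltW.
Qed.

Lemma Rdominated_cvg d (T : measurableType d) (m : {measure set T -> \bar R})
  (f_ : nat -> T -> R) (f g : T -> R) :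
  (forall n, measurable_fun setT (f_ n)) ->
  (forall x, f_ n x @[n --> \oo] --> f x) ->
  m.-integrable setT (EFin \o g) -> (forall n x, `|f_ n x| <= g x) ->
  \int[m]_x f_ n x @[n --> \oo] --> \int[m]_x f x.
Proof.
move=> mf ff ig fg.
have mlim : measurable_fun setT f.
  by apply: (measurable_realfun.measurable_fun_cvg mf) => x _; exact: ff.
have fgx x : `|f x| <= g x.
  have C : `|f_ n x| @[n --> \oo] --> `|f x| by apply: cvg_norm; exact: ff.
  rewrite -(cvg_lim (@Rhausdorff R) C).
  by apply: limr_le; [apply/cvg_ex; eexists; exact: C|apply: nearW => n; exact: fg].
have if_ : m.-integrable setT (EFin \o f).
  apply: le_integrable ig => //; first exact/measurable_EFinP.
  by move=> x _ /=; rewrite lee_fin (le_trans (fgx x)) ?ler_norm.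
apply: fine_cvg; rewrite fineK; last exact: integrable_fin_num.
apply: (@dominated_cvg _ _ _ m setT measurableT _ (EFin \o f) (EFin \o g)) => //.
- by move=> n; exact/measurable_EFinP.
- by move=> x _; apply: cvg_EFin; [exact: nearW|exact: ff].
- by move=> n x _; rewrite /= lee_fin.
Qed.

(** The rescaled bumps form an approximate identity at [a], of integral [mass] instead of 1.
    Substituting x = a + z/(n+1) reduces the claim to dominated convergence. *)
Let mollify (v : R -> R) (B a : R) : continuous v -> (forall x, `|v x| <= B) ->
  \int[mu]_x (v x * (n.+1%:R * bump (n.+1%:R * x + - (n.+1%:R * a)))) @[n --> \oo]
    --> v a * mass.
Proof.
move=> cv vB.
have cn n : continuous (fun x : R => n.+1%:R * bump (n.+1%:R * x + - (n.+1%:R * a))).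
  move=> x; apply: cvgM; first exact: cvg_cst.
  by have := class_C_continuous
    (class_C_affine n.+1%:R (- (n.+1%:R * a)) (@class_C_bump R 0)); apply.
have E n : \int[mu]_x (v x * (n.+1%:R * bump (n.+1%:R * x + - (n.+1%:R * a)))) =
    \int[mu]_z (v (a + z / n.+1%:R) * bump z).
  have dT z : is_derive z (1 : R) (fun z : R => a + z / n.+1%:R) n.+1%:R^-1.
    rewrite -[X in is_derive _ _ _ X]add0r; apply: is_deriveD.
    have := is_deriveZ (n.+1%:R^-1 : R) (@is_derive_id _ _ z (1 : R)).
    rewrite /GRing.scale/= mulr1; congr (is_derive _ _ _ _).
    by apply/funext => y; rewrite mulrC.
  have n0 : (n.+1%:R : R) != 0 by rewrite pnatr_eq0.
  rewrite (@Rintegral_change_of_variables _ n.+1%:R^-1 (fun z => a + z / n.+1%:R)).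
  - apply: eq_Rintegral => z _; rewrite derive1E derive_val.
    have -> : n.+1%:R * (a + z / n.+1%:R) - n.+1%:R * a = z.
      by move: n0; move: (n.+1%:R : R) => N N0; field.
    by move: n0; move: (n.+1%:R : R) => N N0; field.
  - by rewrite invr_gt0.
  - move=> x y xy.
    have -> : a + y / n.+1%:R - (a + x / n.+1%:R) = (y - x) / n.+1%:R by ring.
    rewrite ger0_norm ?mulr_ge0 ?subr_ge0//.
    by rewrite mulrC.
  - by move=> x y xy /=; rewrite lerD2l ler_pM2r// invr_gt0.
  - by move=> x; exists ((x - a) * n.+1%:R); move: n0; move: (n.+1%:R : R) => N N0; field.
  - apply: continuous_measurable_fun => x.
    by apply: cvgM; [exact: cv|exact: cn].
under eq_fun do rewrite E.
have -> : v a * mass = \int[mu]_z (v a * bump z).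
  rewrite RintegralZl//; last exact: integrable_bump.
  congr (_ * _); rewrite /mass /prim [RHS](@Rintegral_mkcond _ _ _ mu setT).
  rewrite Rintegral_mkcond; apply: eq_Rintegral => x _.
  rewrite !patchE in_setT; case: ifPn => //.
  rewrite notin_setE/= in_itv/= => /negP; rewrite -ltNge => x1.
  by rewrite bump_eq0// in_itv/= negb_and orbC -leNgt (ltW x1).
apply: (@Rdominated_cvg _ _ mu _ _ (fun z => B * bump z)).
- move=> n; apply: continuous_measurable_fun => x; apply: cvgM; last exact: cb.
  apply: (@cvg_comp _ _ _ (fun z : R => a + z / n.+1%:R) v); last exact: cv.
  by apply: cvgD; [exact: cvg_cst|apply: cvgMl; exact: cvg_id].
- move=> x; apply: cvgM; last exact: cvg_cst.
  apply: (@cvg_comp _ _ _ (fun n => a + x / n.+1%:R) v); last exact: cv.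
  have : a + x / n.+1%:R @[n --> \oo] --> a + x * 0.
    apply: cvgD; first exact: cvg_cst.
    by apply: cvgM; [exact: cvg_cst|exact: cvg_harmonic].
  by rewrite mulr0 addr0.
- by have := integrableZl measurableT B integrable_bump.
- by move=> n x; rewrite normrM (ger0_norm (bump_ge0 x)) ler_wpM2r ?bump_ge0.
Qed.

Lemma step_near1 (a x : R) : a < x ->
  \forall n \near \oo, step (n.+1%:R * x + - (n.+1%:R * a)) = 1.
Proof.
rewrite -subr_gt0 => /ltr_add_invr[k]; rewrite add0r => kx.
near=> n; apply: step_ge1; rewrite -mulrBr -ler_pdivrMl ?ltr0n// mulr1.
rewrite (le_trans _ (ltW kx))// lef_pV2 ?posrE ?ltr0n// ler_nat ltnS.
by near: n; exact: nbhs_infty_ge.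
Unshelve. all: by end_near. Qed.

(* Testing against smooth approximations of the indicator of ]a, b]. *)
Lemma weak_derivative_FTC (v g : R -> R) (B a b : R) : continuous v ->
  (forall x, `|v x| <= B) -> weak_derivative v g -> a <= b ->
  v b - v a = \int[mu]_(x in `]a, b]) g x.
Proof.
move=> cv vB [[mg _ gK] vg] ab.
(* It rises right after [a] and falls right after [b], each within 1/(n+1). Since [step 0 = 0], the
   limit is the indicator of ]a, b] at every point, endpoints included, and all supports lie in
   [a, b + 1]. *)
pose phi (n : nat) (x : R) : R := step (n.+1%:R * x + - (n.+1%:R * a)) +
  (-1) * step (n.+1%:R * x + - (n.+1%:R * b)).
have n0 n : 0 < (n.+1%:R : R) by rewrite ltr0n.
have phi_supp n x : x \notin `[a, b + 1] -> phi n x = 0.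
  rewrite in_itv/= negb_and -!ltNge /phi => /orP[xa|xb].
    rewrite !step_le0 ?mulr0 ?addr0//; rewrite -mulrBr mulr_ge0_le0 ?(ltW (n0 _))// subr_le0 ltW//.
    by rewrite (lt_le_trans xa).
  have n1 : 1 <= (n.+1%:R : R) by rewrite ler1n.
  have H c : c <= b -> 1 <= n.+1%:R * x - n.+1%:R * c.
    by move=> cb'; rewrite -mulrBr; nra.
  by rewrite !step_ge1 ?mulr1 ?subrr ?H.
have Cphi n k : class_C k (phi n).
  apply: class_CD; first by apply: class_C_affine; exact: class_C_step.
  apply: class_CM; first exact: class_C_cst.
  by apply: class_C_affine; exact: class_C_step.
have tphi n : test_function (phi n).
  split=> [k|]; first exact: Cphi.
  apply: (@subclosed_compact _ _ `[a, b + 1]%classic).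
  - exact: closed_closure.
  - exact: segment_compact.
  - have /closure_id -> : closed `[a, b + 1]%classic by exact: interval_closed.
    apply: closureS => x /=; apply: contraPP => /negP/phi_supp ->.
    by rewrite eqxx.
pose psi (n : nat) (c x : R) := n.+1%:R * bump (n.+1%:R * x + - (n.+1%:R * c)).
have dphi n (x : R) : derive1 (phi n) x = mass^-1 * psi n a x - mass^-1 * psi n b x.
  have ds c : is_derive x (1 : R) (fun x : R => step (n.+1%:R * x + - (n.+1%:R * c)))
      (mass^-1 * psi n c x).
    have -> : mass^-1 * psi n c x = bump (n.+1%:R * x + - (n.+1%:R * c)) / mass * n.+1%:R.
      by rewrite /psi; ring.
    apply: (@is_derive1_comp _ step (fun x => n.+1%:R * x + - (n.+1%:R * c))).
      exact: is_derive_step.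
    rewrite -[X in is_derive _ _ _ X]addr0; apply: is_deriveD.
    have := is_deriveZ (n.+1%:R : R) (@is_derive_id _ _ x (1 : R)).
    by rewrite /GRing.scale/= mulr1.
  have := is_deriveD (ds a) (is_deriveZ (-1 : R) (ds b)).
  rewrite /GRing.scale/= mulN1r => H.
  by rewrite derive1E; exact: (@derive_val _ _ _ _ _ _ _ H).
have cpsi n c : continuous (psi n c).
  move=> x; apply: cvgM; first exact: cvg_cst.
  exact: (class_C_continuous (class_C_affine n.+1%:R (- (n.+1%:R * c)) (@class_C_bump R 0))).
have ipsi n c : mu.-integrable setT (EFin \o (fun x => mass^-1 * (v x * psi n c x))).
  apply: (@integrable_continuous_supp _ c (c + 1)).
    move=> x; apply: cvgM; first exact: cvg_cst.
    by apply: cvgM; [exact: cv|exact: cpsi].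
  move=> x; rewrite in_itv/= negb_and -!ltNge /psi => xc.
  rewrite bump_eq0 ?mulr0 ?mulr0// in_itv/= negb_and -!leNgt -mulrBr.
  case/orP: xc => [xc|xc]; apply/orP; [left|right].
    by rewrite mulr_ge0_le0 ?(ltW (n0 _))// subr_le0 ltW.
  by have n1 : 1 <= (n.+1%:R : R) by [rewrite ler1n]; nra.
have L : \int[mu]_x (v x * derive1 (phi n) x) @[n --> \oo] --> v a - v b.
  have E n : \int[mu]_x (v x * derive1 (phi n) x) =
    mass^-1 * \int[mu]_x (v x * psi n a x) - mass^-1 * \int[mu]_x (v x * psi n b x).
    have m0 : mass != 0 by rewrite gt_eqF.
    have ip c : mu.-integrable setT (EFin \o (fun x => v x * psi n c x)).
      have := integrableZl measurableT mass (ipsi n c).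
      congr (_.-integrable _ _); apply/funext => x /=.
      by rewrite -EFinM mulrA divff// mul1r.
    have Z c : mass^-1 * \int[mu]_x (v x * psi n c x) = \int[mu]_x (mass^-1 * (v x * psi n c x)).
      by rewrite RintegralZl//; exact: ip.
    rewrite (Z a) (Z b) -(RintegralB measurableT (ipsi n a) (ipsi n b)).
    by apply: eq_Rintegral => x _; rewrite dphi; ring.
  under eq_fun do rewrite E.
  have -> : v a - v b = mass^-1 * (v a * mass) - mass^-1 * (v b * mass).
    by field; rewrite gt_eqF.
  by apply: cvgB; apply: cvgM; [exact: cvg_cst|exact: (mollify cv vB)
    |exact: cvg_cst|exact: (mollify cv vB)].
have abK : compact `[a, b + 1]%classic by exact: segment_compact.
have ig : mu.-integrable `[a, b + 1] (EFin \o g).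
  apply/integrableP; split; first by apply/measurable_EFinP; exact: measurable_funTS.
  exact: gK.
have mphi n : measurable_fun setT (phi n).
  by apply: continuous_measurable_fun; exact: class_C_continuous (Cphi n 0).
have L' : \int[mu]_x (g x * phi n x) @[n --> \oo] --> \int[mu]_(x in `]a, b]) g x.
  rewrite [X in _ --> X]Rintegral_mkcond.
  apply: (@Rdominated_cvg _ _ mu _ _ (fun x => 2 * ((fun x => `|g x|) \_ `[a, b + 1]) x)).
  - by move=> n; apply: measurable_funM => //; exact: mphi.
  - have phi0 x : x <= a -> forall n, phi n x = 0.
      move=> xa n; rewrite /phi !step_le0 ?mulr0 ?addr0//;
      by rewrite -mulrBr mulr_ge0_le0 ?(ltW (n0 _))// subr_le0// (le_trans xa).
    move=> x; rewrite patchE; case: ifPn; last first.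
      rewrite notin_setE/= in_itv/= => /negP; rewrite negb_and -leNgt -ltNge.
      move=> /orP[xa|xb]; apply: cvg_near_cst.
        by apply: nearW => n; rewrite phi0 ?mulr0.
      near=> n; rewrite /phi.
      have -> : step (n.+1%:R * x + - (n.+1%:R * a)) = 1.
        by near: n; apply: step_near1; exact: le_lt_trans xb.
      have -> : step (n.+1%:R * x + - (n.+1%:R * b)) = 1.
        by near: n; exact: step_near1.
      by rewrite mulr1 subrr mulr0.
    rewrite inE/= in_itv/= => /andP[ax xb]; apply: cvg_near_cst.
    near=> n; rewrite /phi.
    have -> : step (n.+1%:R * x + - (n.+1%:R * a)) = 1.
      by near: n; exact: step_near1.
    rewrite (@step_le0 (n.+1%:R * x + - (n.+1%:R * b))) ?mulr0 ?addr0 ?mulr1//.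
    by rewrite -mulrBr mulr_ge0_le0 ?(ltW (n0 _))// subr_le0.
  - have /integrable_mkcond H := integrable_norm ig.
    have := integrableZl measurableT 2 (H (measurable_itv _)).
    by congr (_.-integrable _ _); apply/funext => x /=; rewrite restrict_EFin.
  - move=> n x; rewrite patchE; case: ifPn; last first.
      by rewrite notin_setE/= => /negP /phi_supp ->; rewrite !mulr0 normr0.
    move=> _; rewrite normrM mulrC ler_wpM2r//.
    have := step_bound (n.+1%:R * x + - (n.+1%:R * a)).
    have := step_bound (n.+1%:R * x + - (n.+1%:R * b)).
    rewrite /phi !ler_norml => /andP[? ?] /andP[? ?]; apply/andP; split; lra.
have E n : \int[mu]_x (v x * derive1 (phi n) x) = - \int[mu]_x (g x * phi n x).
  exact: vg.
have L2 : \int[mu]_x (v x * derive1 (phi n) x) @[n --> \oo] --> - \int[mu]_(x in `]a, b]) g x.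
  by under eq_fun do rewrite E; apply: cvgN.
have : v a - v b = - \int[mu]_(x in `]a, b]) g x by exact: cvg_unique L L2.
by move=> H; rewrite -[RHS]opprK -H opprB.
Unshelve. all: by end_near. Qed.

End smooth_step.

(** * The initial characteristic map *)

Section characteristics.
Context {R : realType}.
Notation mT := (measurableTypeR R).
Notation mu := (@lebesgue_measure R).
Variable mubar : finite_borel_measure R.

Definition cdfo (x : R) : R := fine (mubar `]-oo, x[%classic).
Definition cdfc (x : R) : R := fine (mubar `]-oo, x]%classic).
Definition mass : R := fine (mubar setT).

Lemma fin_num_mubar (A : set mT) : measurable A -> mubar A \is a fin_num.
Proof. exact: fin_num_measure. Qed.

Lemma cdfoE x : mubar `]-oo, x[%classic = (cdfo x)%:E.
Proof. by rewrite fineK// fin_num_mubar. Qed.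

Lemma cdfcE x : mubar `]-oo, x]%classic = (cdfc x)%:E.
Proof. by rewrite fineK// fin_num_mubar. Qed.

Lemma massE : mubar setT = mass%:E.
Proof. by rewrite fineK// fin_num_mubar. Qed.

Lemma cdfo_ge0 x : 0 <= cdfo x.
Proof. by rewrite -lee_fin -cdfoE. Qed.

Lemma cdfo_le_cdfc x : cdfo x <= cdfc x.
Proof.
rewrite -lee_fin -cdfoE -cdfcE le_measure// ?inE//.
by move=> y /=; rewrite !in_itv/= => /ltW.
Qed.

Lemma cdfc_le_cdfo x y : x < y -> cdfc x <= cdfo y.
Proof.
move=> xy; rewrite -lee_fin -cdfoE -cdfcE le_measure// ?inE//.
by move=> z /=; rewrite !in_itv/= => /le_lt_trans; apply.
Qed.

Lemma cdfo_nondecreasing : {homo cdfo : x y / x <= y}.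
Proof.
move=> x y; rewrite le_eqVlt => /orP[/eqP->//|xy].
exact: le_trans (cdfo_le_cdfc x) (cdfc_le_cdfo xy).
Qed.

Lemma cdfc_nondecreasing : {homo cdfc : x y / x <= y}.
Proof.
move=> x y; rewrite le_eqVlt => /orP[/eqP->//|xy].
exact: le_trans (cdfc_le_cdfo xy) (cdfo_le_cdfc y).
Qed.

Lemma cdfc_le_mass x : cdfc x <= mass.
Proof. by rewrite -lee_fin -cdfcE -massE le_measure// ?inE. Qed.

Lemma cdfo_le_mass x : cdfo x <= mass.
Proof. exact: le_trans (cdfo_le_cdfc x) (cdfc_le_mass x). Qed.

Lemma invn_le (n m : nat) : (n <= m)%N -> (m.+1%:R^-1 : R) <= n.+1%:R^-1.
Proof. by move=> nm; rewrite lef_pV2 ?posrE ?ltr0n// ler_nat. Qed.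

Lemma cdfo_left x : cdfo (x - n.+1%:R^-1) @[n --> \oo] --> cdfo x.
Proof.
apply: fine_cvg; rewrite -cdfoE.
have -> : `]-oo, x[%classic = \bigcup_n `]-oo, x - n.+1%:R^-1[%classic.
  apply/seteqP; split => y /=; rewrite in_itv/=.
    rewrite -subr_gt0 => /ltr_add_invr[k]; rewrite add0r => kx; exists k => //=.
    by rewrite in_itv/= ltrBrDr addrC -ltrBrDr.
  by move=> [k _] /=; rewrite in_itv/= => /lt_trans; apply; rewrite ltrBlDr ltrDl.
apply: (@nondecreasing_cvg_mu _ mT R mubar (fun n => `]-oo, x - n.+1%:R^-1[%classic)).
- by move=> n; exact: measurable_itv.
- by apply: bigcup_measurable => n _; exact: measurable_itv.
- move=> n m nm; apply/subsetPset => y /=; rewrite !in_itv/= => /lt_le_trans; apply.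
  by rewrite lerD2l lerN2; exact: invn_le.
Qed.

Lemma cdfo_right x : cdfo (x + n.+1%:R^-1) @[n --> \oo] --> cdfc x.
Proof.
apply: fine_cvg; rewrite -cdfcE.
have -> : `]-oo, x]%classic = \bigcap_n `]-oo, x + n.+1%:R^-1[%classic.
  by rewrite (itvNycEbigcap true).
apply: (@nonincreasing_cvg_mu _ mT R mubar (fun n => `]-oo, x + n.+1%:R^-1[%classic)).
- by rewrite -ge0_fin_numE// fin_num_mubar.
- by move=> n; exact: measurable_itv.
- by apply: bigcap_measurable => // n _; exact: measurable_itv.
- move=> n m nm; apply/subsetPset => y /=; rewrite !in_itv/= => /lt_le_trans; apply.
  by rewrite lerD2l; exact: invn_le.
Qed.

Lemma cdfo_Ny : cdfo (- n%:R) @[n --> \oo] --> 0.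
Proof.
have E : \bigcap_n `]-oo, - (n%:R : R)[%classic = set0.
  apply/seteqP; split => // y /(_ (Num.bound y) Logic.I) /=; rewrite in_itv/=.
  by move=> h; have := unstable.ltrNbound y; lra.
have -> : (0 : R) = fine (mubar (\bigcap_n `]-oo, - (n%:R : R)[%classic)).
  by rewrite E measure0.
apply: fine_cvg; rewrite fineK; last by rewrite E measure0.
apply: (@nonincreasing_cvg_mu _ mT R mubar (fun n => `]-oo, - n%:R[%classic)).
- by rewrite -ge0_fin_numE// fin_num_mubar.
- by move=> n; exact: measurable_itv.
- by apply: bigcap_measurable => // n _; exact: measurable_itv.
- move=> n m nm; apply/subsetPset => y /=; rewrite !in_itv/= => /lt_le_trans; apply.
  by rewrite lerN2 ler_nat.
Qed.

Lemma cdfo_y : cdfo n%:R @[n --> \oo] --> mass.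
Proof.
apply: fine_cvg; rewrite -massE.
have <- : \bigcup_n `]-oo, n%:R : R[%classic = setT.
  apply/seteqP; split => // y _; exists (Num.bound y) => //=; rewrite in_itv/=.
  exact: unstable.ltr_bound.
apply: (@nondecreasing_cvg_mu _ mT R mubar (fun n => `]-oo, n%:R[%classic)).
- by move=> n; exact: measurable_itv.
- by apply: bigcup_measurable => n _; exact: measurable_itv.
- move=> n m nm; apply/subsetPset => y /=; rewrite !in_itv/= => /lt_le_trans; apply.
  by rewrite ler_nat.
Qed.

(** The witness is the supremum of the x with x + cdfo x <= a. Left continuity of [cdfo] gives the
    first inequality; the points just above the supremum violate the condition, and the right limit
    of [cdfo] is [cdfc]. *)
Lemma char_x_exists a : exists x, x + cdfo x <= a <= x + cdfc x.
Proof.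
pose S := [set x | x + cdfo x <= a].
have Sub : ubound S a by move=> x; rewrite /S/= => Sx; have := cdfo_ge0 x; lra.
have S0 : S (a - mass) by rewrite /S/=; have := cdfo_le_mass (a - mass); lra.
have hS : has_sup S by split; [exists (a - mass)|exists a].
exists (sup S); apply/andP; split.
  have C : sup S - n.+1%:R^-1 + cdfo (sup S - n.+1%:R^-1) @[n --> \oo] --> sup S - 0 + cdfo (sup S).
    apply: cvgD; last exact: cdfo_left.
    by apply: cvgB; [exact: cvg_cst|exact: cvg_harmonic].
  rewrite subr0 in C; rewrite -(cvg_lim (@Rhausdorff R) C).
  apply: limr_le; first by apply/cvg_ex; eexists; exact: C.
  apply: nearW => n.
  have n0 : 0 < (n.+1%:R^-1 : R) by rewrite invr_gt0.
  have [s Ss ss] := sup_adherent n0 hS.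
  apply: le_trans Ss; rewrite lerD ?(ltW ss)//.
  by apply: cdfo_nondecreasing; exact: ltW.
have C : sup S + n.+1%:R^-1 + cdfo (sup S + n.+1%:R^-1) @[n --> \oo] --> sup S + 0 + cdfc (sup S).
  apply: cvgD; last exact: cdfo_right.
  by apply: cvgD; [exact: cvg_cst|exact: cvg_harmonic].
rewrite addr0 in C; rewrite -(cvg_lim (@Rhausdorff R) C).
apply: limr_ge; first by apply/cvg_ex; eexists; exact: C.
apply: nearW => n; rewrite leNgt; apply/negP => /ltW h.
have : sup S + n.+1%:R^-1 <= sup S by apply: ub_le_sup h; exists a.
by rewrite gerDl leNgt invr_gt0 ltr0n.
Qed.

Notation X := (char_x mubar).

Lemma char_xP a : X a + cdfo (X a) <= a <= X a + cdfc (X a).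
Proof.
have [x /andP[x1 x2]] := char_x_exists a.
have : exists z, [set z : R | (z%:E + mubar `]-oo, z[%classic <= a%:E)%E /\
                      (a%:E <= z%:E + mubar `]-oo, z]%classic)%E] z.
  by exists x; split; rewrite ?cdfoE ?cdfcE -EFinD lee_fin.
by move=> /(xgetPex 0)[]; rewrite -/(X a) cdfoE cdfcE -!EFinD !lee_fin => -> ->.
Qed.

(** Subtracting the defining inequalities at two labels gives b - a >= (X b - X a) + (cdfo (X b) -
    cdfc (X a)), and the last bracket is nonnegative when X a < X b. *)
Lemma slow_char_x : slow X.
Proof.
move=> a b ab; have := char_xP a; have := char_xP b.
move: (X a) (X b) => x y /andP[y1 y2] /andP[x1 x2].
have xy : x <= y.
  by rewrite leNgt; apply/negP => yx; have := cdfc_le_cdfo yx; lra.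
rewrite subr_ge0 xy/=; move: xy; rewrite le_eqVlt => /orP[/eqP->|xy]; first lra.
by have := cdfc_le_cdfo xy; lra.
Qed.

Lemma char_x_unique a x : x + cdfo x <= a <= x + cdfc x -> X a = x.
Proof.
have := char_xP a; move: (X a) => y /andP[y1 y2] /andP[x1 x2].
by have [xy|xy|//] := ltgtP x y; have := cdfc_le_cdfo xy; lra.
Qed.

Lemma char_x_cdfc x : X (x + cdfc x) = x.
Proof. by apply: char_x_unique; rewrite lexx lerD2l cdfo_le_cdfc. Qed.

(** x + cdfc x is the last label at position x. This adjunction turns preimages of rays and
    half-open intervals under X into rays and half-open intervals. *)
Lemma char_x_le a x : (X a <= x) = (a <= x + cdfc x).
Proof.
apply/idP/idP => [|h]; last first.
  by have := slow_nondecreasing slow_char_x h; rewrite char_x_cdfc.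
have /andP[_ h] := char_xP a; move=> Xx; apply: (le_trans h); rewrite lerD//.
exact: cdfc_nondecreasing.
Qed.

Lemma energy_bounds a : cdfo (X a) <= a - X a <= cdfc (X a).
Proof. by have := char_xP a; lra. Qed.

Lemma energy_ge0 a : 0 <= a - X a.
Proof. by have /andP[h _] := energy_bounds a; apply: le_trans h; exact: cdfo_ge0. Qed.

Lemma energy_le_mass a : a - X a <= mass.
Proof. by have /andP[_ h] := energy_bounds a; apply: (le_trans h); exact: cdfc_le_mass. Qed.

(** Labels may split an atom, so only the mass of the open interval certainly lies between the two
    labels. *)
Lemma energy_increment a b : X a < X b ->
  (fine (mubar `]X a, X b[%classic) <= (b - X b) - (a - X a)).
Proof.
move=> xy; have := energy_bounds a; have := energy_bounds b.
have -> : fine (mubar `]X a, X b[%classic) = cdfo (X b) - cdfc (X a).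
  have : mubar `]-oo, X b[%classic = (mubar `]-oo, X a]%classic + mubar `]X a, X b[%classic)%E.
    rewrite -measureU//; last first.
      apply/seteqP; split => // z [] /=; rewrite !in_itv/= => h1 /andP[h2 _].
      by have := le_lt_trans h1 h2; rewrite ltxx.
    congr (mubar _); apply/seteqP; split => z /=; rewrite !in_itv/=.
      by move=> h; have [?|?] := leP z (X a); [left|right].
    by case=> [/le_lt_trans|/andP[]//]; apply.
  rewrite cdfoE cdfcE => /(congr1 fine); rewrite fineD//=; last exact: fin_num_mubar.
  by move=> ->; rewrite addrAC subrr add0r.
lra.
Qed.

Lemma char_x_surjective x : exists a, X a = x.
Proof. by exists (x + cdfc x); exact: char_x_cdfc. Qed.

Lemma lip_char_x : lip 1 X.
Proof. by move=> a b /slow_char_x /andP[h0 h1]; rewrite mul1r ger0_norm. Qed.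

Lemma energyNy e : 0 < e -> exists A, forall a, a <= A -> a - X a <= e.
Proof.
move=> e0; have /cvgrPdist_le/(_ _ e0)[N _ HN] := cdfo_Ny.
(* The extra unit makes X a < -N strict, as needed to bound [cdfc (X a)] by [cdfo (- N)]. *)
exists (- N.+1%:R) => a aN.
have /andP[_ h] := energy_bounds a; apply: (le_trans h).
have h1 : X a < - N%:R.
  have := energy_ge0 a; have : (N%:R : R) < N.+1%:R by rewrite ltr_nat.
  lra.
have := HN N (leqnn N); rewrite /= sub0r normrN ger0_norm ?cdfo_ge0//.
by apply: le_trans; exact: cdfc_le_cdfo.
Qed.

Lemma energy_y e : 0 < e -> exists A, forall a, A <= a -> mass - e <= a - X a.
Proof.
move=> e0; have /cvgrPdist_le/(_ _ e0)[N _ HN] := cdfo_y.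
(* A label exceeds its position by at most the total mass, so X a >= N. *)
exists (N%:R + mass) => a aN.
have /andP[h _] := energy_bounds a; apply: le_trans h.
have h1 : N%:R <= X a by have := energy_le_mass a; lra.
have := HN N (leqnn N); rewrite /= ler_norml => /andP[_ h2].
by have := cdfo_nondecreasing h1; lra.
Qed.

Notation f := (char_f mubar).

Lemma measurable_char_f : measurable_fun setT f.
Proof.
apply: measurable_funB; first exact: measurable_cst.
by apply: measurable_derive1; exact: slow_continuous slow_char_x.
Qed.

Lemma char_f_bounds a : 0 <= f a <= 1.
Proof. by have := derive1_slow a slow_char_x; rewrite /char_f; lra. Qed.

Lemma slow_energy : slow (fun a => a - X a).
Proof. exact/slow_complement/slow_char_x. Qed.

Lemma is_derive_energy (a : R) : derivable X a 1 ->
  is_derive a (1 : R) (fun a => a - X a) (f a).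
Proof. exact: is_derive_complement. Qed.

Lemma integral_char_f a b : a <= b ->
  (\int[mu]_(x in `]a, b]) (f x)%:E = ((b - X b) - (a - X a))%:E)%E.
Proof. by move=> ab; rewrite -(slow_complement_FTC slow_char_x ab). Qed.

(** The preimage of ]x, y] runs from the last label at x to the last label at y, and the energy
    grows there by cdfc y - cdfc x. Half-open intervals determine the measure. *)
Lemma mubar_push : same_measure mubar (push_density X f).
Proof.
have mX : measurable_fun setT X.
  by apply: continuous_measurable_fun; exact: slow_continuous slow_char_x.
have [m mE] := push_measure mX measurable_char_f (fun a => proj1 (andP (char_f_bounds a))).
move=> E mE'; rewrite -mE.
apply: (@measure_unique _ _ mT (@ocitv R) (fun k => `](- k%:R), k%:R]%classic)) => //.
- exact: ocitvI.
- by move=> i; exact: is_ocitv.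
- apply/seteqP; split => // x _; exists (Num.bound x).+1 => //=; rewrite in_itv/=.
  have h1 := unstable.ltrNbound x; have h2 := unstable.ltr_bound x.
  have h3 : ((Num.bound x)%:R : R) < (Num.bound x).+1%:R by rewrite ltr_nat.
  by apply/andP; split; lra.
- move=> _ [[x y] _ <-]/=; have [xy|yx] := leP x y; last first.
    by rewrite set_itv_ge ?measure0 ?adde0// bnd_simp -leNgt ltW.
  rewrite mE /push_density /pushforward.
  have -> : X @^-1` `]x, y] = `]x + cdfc x, y + cdfc y]%classic.
    by apply/seteqP; split => z /=; rewrite !in_itv/= !ltNge !char_x_le.
  rewrite /density integral_char_f; last by rewrite lerD// cdfc_nondecreasing.
  rewrite !char_x_cdfc.
  have : mubar `]-oo, y]%classic = (mubar `]-oo, x]%classic + mubar `]x, y]%classic)%E.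
    rewrite -measureU//; last first.
      apply/seteqP; split => // z [] /=; rewrite !in_itv/= => h1 /andP[h2 _].
      by have := le_lt_trans h1 h2; rewrite ltxx.
    congr (mubar _); apply/seteqP; split => z /=; rewrite !in_itv/=.
      by move=> h; have [?|?] := leP z x; [left|right].
    by case=> [/le_trans|/andP[]//]; apply.
  rewrite -[X in _ = (_ + X)%E -> _]fineK ?fin_num_mubar//.
  rewrite !cdfcE -EFinD => -[->].
  rewrite -[LHS]fineK ?fin_num_mubar//; congr EFin; ring.
- by move=> k; rewrite -ge0_fin_numE// fin_num_mubar.
Qed.

End characteristics.

(** * Primitives, Cauchy-Schwarz, and comparison of densities through a monotone map *)

Section integral_tools.
Context {R : realType}.

Lemma derivable_is_derive1 (f : R -> R) (x : R) : derivable f x 1 ->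
  is_derive x (1 : R) f (derive1 f x).
Proof. by move=> df; apply: DeriveDef; [exact: df|rewrite derive1E]. Qed.

Lemma is_derive1_val (f : R -> R) (x l : R) : is_derive x (1 : R) f l ->
  derive1 f x = l.
Proof. by move=> H; rewrite derive1E (@derive_val _ _ _ _ _ _ _ H). Qed.

Notation mT := (measurableTypeR R).
Notation mu := (@lebesgue_measure R).

Lemma locally_integrable_itv (g : R -> R) (a b : R) : locally_integrable setT g ->
  mu.-integrable `]a, b] (EFin \o g).
Proof.
move=> [mg _ gK]; apply: (@integrableS _ _ _ mu `[a, b]) => //.
  by apply: subset_itv; rewrite bnd_simp.
apply/integrableP; split; first by apply/measurable_EFinP; exact: measurable_funTS.
by apply: gK => //; exact: segment_compact.
Qed.

(** The derivative exists at every Lebesgue point of [g]; near x, the function v differs by a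
    constant from the primitive based at x - 1. *)
Lemma ae_is_derive_primitive (v g : R -> R) : locally_integrable setT g ->
  (forall a b, a <= b -> v b - v a = \int[mu]_(x in `]a, b]) g x) ->
  {ae mu, forall x : R, is_derive x (1 : R) v (g x)}.
Proof.
move=> lg vg; have := lebesgue_differentiation lg; apply: aeS => x gx.
pose F y := \int[mu]_(t in [set` Interval (BRight (x - 1)) (BRight y)]) g t.
have xx : x < x + 1 by rewrite ltrDl.
have ax : (BRight (x - 1) < BRight x)%O by rewrite bnd_simp ltrBlDr ltrDl.
have ig : mu.-integrable [set` Interval (BRight (x - 1)) (BRight (x + 1))] (EFin \o g).
  exact: locally_integrable_itv.
have [dF F'] := FTC1_lebesgue_pt xx ig ax gx.
have dF' : is_derive x (1 : R) F (g x).
  by apply: DeriveDef; [exact: dF|rewrite -derive1E; exact: F'].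
have := is_deriveD (is_derive_cst (v (x - 1)) x (1 : R)) dF'; rewrite add0r.
apply: near_eq_is_derive.
near=> y; rewrite fctE /F -vg; first by rewrite addrC subrK.
by apply: ltW; near: y; apply: lt_nbhsr; rewrite ltrBlDr ltrDl.
Unshelve. all: by end_near. Qed.

(** Expand the integral of (g - c)^2 >= 0, where c is the mean of [g] over the interval. *)
Lemma sqr_integral_le (g : R -> R) (a b : R) : a < b ->
  mu.-integrable `]a, b] (EFin \o g) ->
  mu.-integrable `]a, b] (EFin \o (fun x => g x ^+ 2)) ->
  (\int[mu]_(x in `]a, b]) g x) ^+ 2 <= (b - a) * \int[mu]_(x in `]a, b]) (g x ^+ 2).
Proof.
move=> ab ig ig2; set I := \int[mu]_(x in _) g x; set J := \int[mu]_(x in _) _.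
have ba0 : 0 < b - a by rewrite subr_gt0.
pose c := I / (b - a).
have ic (k : R) : mu.-integrable `]a, b] (EFin \o cst k).
  apply: measurable_bounded_integrable => //; first exact: leb_itv_lty.
  by exists `|k|; split => // M MK x /= _; rewrite ltW.
have i2 : mu.-integrable `]a, b] (EFin \o (fun x => 2 * c * g x)).
  by have := integrableZl _ (2 * c) ig; apply.
have i3 : mu.-integrable `]a, b] (EFin \o (fun x => g x ^+ 2 - 2 * c * g x)).
  by have := integrableB _ ig2 i2; apply.
have E : \int[mu]_(x in `]a, b]) (g x - c) ^+ 2 = J - 2 * c * I + c ^+ 2 * (b - a).
  transitivity (\int[mu]_(x in `]a, b]) ((g x ^+ 2 - 2 * c * g x) + cst (c ^+ 2) x)).
    by apply: eq_Rintegral => x _; rewrite /cst; ring.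
  rewrite RintegralD// RintegralB// RintegralZl// Rintegral_cst//.
  have E2 : mu `]a, b]%classic = (b - a)%:E.
    by rewrite lebesgue_measure_itv/= lte_fin ab -EFinB.
  congr (_ + _ * _); exact: (congr1 fine E2).
have : 0 <= J - 2 * c * I + c ^+ 2 * (b - a).
  by rewrite -E; apply: Rintegral_ge0 => x _; rewrite sqr_ge0.
have -> : J - 2 * c * I + c ^+ 2 * (b - a) = J - I ^+ 2 / (b - a).
  by rewrite /c; field; rewrite gt_eqF.
by rewrite subr_ge0 ler_pdivrMr// mulrC.
Qed.

Lemma push_change_of_variables (K : R) (T h : R -> R) : 0 < K -> lip K T ->
  {homo T : a b / a <= b} -> (forall x, exists a, T a = x) ->
  measurable_fun setT h -> (forall x, 0 <= h x) ->
  same_measure (push_density T (fun a => h (T a) * derive1 T a)) (density h).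
Proof.
move=> K0 lT nT sT mh h0 E mE; rewrite /push_density /pushforward /density.
rewrite [LHS]integral_mkcond [RHS]integral_mkcond.
rewrite [RHS](@ge0_change_of_variables _ K T)//.
- apply: eq_integral => a _; rewrite !patchE.
  have -> : (a \in T @^-1` E) = (T a \in E) by apply/idP/idP; rewrite !inE.
  by case: ifP => _; rewrite ?mul0e// EFinM.
- by apply/(measurable_restrictT _ _).1 => //; apply/measurable_EFinP; exact: measurable_funTS.
- by move=> x; rewrite patchE; case: ifP => // _; rewrite lee_fin.
Qed.

(** Equal push-forwards compare the densities only on unions of fibres of T. As T is monotone and no
    fibre is charged by [h1], hence none by [h2], the comparison extends to all half-open
    intervals. *)
Lemma ae_eq_density (h1 h2 : R -> R) (T : R -> R) :
  measurable_fun setT h1 -> measurable_fun setT h2 -> 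
  (forall x, 0 <= h1 x) -> (forall x, 0 <= h2 x) ->
  continuous T -> {homo T : a b / a <= b} ->
  (\int[mu]_x (h1 x)%:E < +oo)%E ->
  same_measure (push_density T h1) (push_density T h2) ->
  (forall x, push_density T h1 [set x] = 0%E) ->
  {ae mu, forall x, h1 x = h2 x}.
Proof.
move=> m1 m2 p1 p2 cT nT fin1 Teq T0.
have mT' : measurable_fun setT T by exact: continuous_measurable_fun.
have [n1 n1E] := density_measure m1 p1.
have [n2 n2E] := density_measure m2 p2.
have n1fin (A : set mT) : measurable A -> (n1 A < +oo)%E.
  move=> mA; apply: le_lt_trans fin1; rewrite (_ : (\int[mu]_x (h1 x)%:E)%E = n1 setT); last first.
    by rewrite n1E.
  by rewrite le_measure// inE.
have n12 : forall A : set mT, measurable A -> n1 A = n2 A.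
  apply: (@measure_unique _ _ mT (@ocitv R) (fun k => `](- k%:R), k%:R]%classic)) => //.
  - exact: ocitvI.
  - by move=> i; exact: is_ocitv.
  - apply/seteqP; split => // x _; exists (Num.bound x).+1 => //=; rewrite in_itv/=.
    have l1 := unstable.ltrNbound x; have l2 := unstable.ltr_bound x.
    have l3 : ((Num.bound x)%:R : R) < (Num.bound x).+1%:R by rewrite ltr_nat.
    by apply/andP; split; lra.
  - move=> _ [[a b] _ <-]/=.
    have [ab|ba] := leP a b; last first.
      by rewrite set_itv_ge ?measure0// bnd_simp -leNgt ltW.
    (* ]a, b] and the saturated set below differ by two fibres of T *)
    pose S := T @^-1` [set T a] `|` T @^-1` [set T b].
    have mS : measurable (S : set mT).
      by apply: measurableU; apply: measurable_preimage.
    have mT1 x : measurable (T @^-1` [set x] : set mT) by exact: measurable_preimage.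
    have n1x x : n1 (T @^-1` [set x]) = 0%E by rewrite n1E; exact: T0.
    have n2x x : n2 (T @^-1` [set x]) = 0%E.
      by rewrite n2E -[RHS](T0 x); apply/esym/Teq; exact: measurable_set1.
    have n10 : n1 S = 0%E by rewrite measureU0.
    have n20 : n2 S = 0%E by rewrite measureU0.
    have SE : `]a, b] `|` S = T @^-1` `[T a, T b]%classic.
      apply/seteqP; split => x /=; rewrite !in_itv/=.
        by case=> [/andP[/ltW/nT -> /nT->]//|[]-> ]; rewrite lexx nT.
      move=> /andP[ax xb]; have [xa|xa] := leP x a.
        by right; left; apply/le_anti; rewrite /= ax nT.
      have [xb'|xb'] := leP x b; first by left.
      by right; right; apply/le_anti; rewrite /= xb nT// ltW.
    have -> : n1 `]a, b]%classic = n1 (`]a, b] `|` S) by rewrite measureU0.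
    have -> : n2 `]a, b]%classic = n2 (`]a, b] `|` S) by rewrite measureU0.
    by rewrite SE n1E n2E; exact: Teq.
  - by move=> k; exact: n1fin.
have : ae_eq mu setT (EFin \o h1) (EFin \o h2).
  apply: integral_ae_eq => //.
  - apply/integrableP; split; first exact/measurable_EFinP.
    have -> : (\int[mu]_x `|(EFin \o h1) x| = \int[mu]_x (h1 x)%:E)%E.
      by apply: eq_integral => x _; rewrite gee0_abs//= lee_fin.
    exact: fin1.
  - exact/measurable_EFinP.
  - by move=> E _ mE; move: (n12 E mE); rewrite n1E n2E.
by apply: aeS => x /(_ Logic.I) [].
Qed.

End integral_tools.

Lemma bounded_Cb {R : realType} (v : R -> R) : Cb v -> exists B, forall x, `|v x| <= B.
Proof.
move=> [_ [M [_ HM]]]; exists (M + 1) => x.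
by apply: (HM (M + 1)) => //; rewrite ltrDl.
Qed.

(** * Relations between initial position, velocity and energy *)

Section energy_relations.
Context {R : realType}.
Notation mT := (measurableTypeR R).
Notation mu := (@lebesgue_measure R).
Variables (ubar : R -> R) (mubar : finite_borel_measure R).
Hypothesis hD : in_D ubar mubar.
Notation X := (char_x mubar).
Notation f := (char_f mubar).

Lemma weak_derivative_ubar (w : R -> R) : weak_derivative ubar w ->
  forall a b, a <= b -> ubar b - ubar a = \int[mu]_(x in `]a, b]) w x.
Proof.
move=> wu a b ab; have [cbu _] := hD; have [B HB] := bounded_Cb cbu.
by have [cu _] := cbu; exact: weak_derivative_FTC cu HB wu ab.
Qed.

Lemma ae_is_derive_ubar (w : R -> R) : weak_derivative ubar w ->
  {ae mu, forall x : R, is_derive x (1 : R) ubar (w x)}.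
Proof.
move=> wu; apply: ae_is_derive_primitive; first by case: wu.
exact: weak_derivative_ubar.
Qed.

Lemma weak_derivative_ae_unique (w1 w2 : R -> R) : weak_derivative ubar w1 ->
  weak_derivative ubar w2 -> {ae mu, forall x, w1 x = w2 x}.
Proof.
move=> /ae_is_derive_ubar H1 /ae_is_derive_ubar H2.
apply: aeS (aeI H1 H2) => x [D1 D2].
by rewrite -(@derive_val _ _ _ _ _ _ _ D1) (@derive_val _ _ _ _ _ _ _ D2).
Qed.

(** [N] joins the countable set carrying the atoms to the null set carrying the singular continuous
    part. *)
Lemma in_D_singular_support : exists g : R -> R, exists N : set mT,
  [/\ weak_derivative ubar g, mu.-integrable setT (EFin \o (fun x => g x ^+ 2)),
      measurable N, mu N = 0%E &
      forall E, measurable E -> mubar (E `\` N) = density (fun x => g x ^+ 2) E].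
Proof.
have [_ [g [wg Lg [mac [mpp [msc [[acl [C cC C0] [[N [mN N0 mscN] _] decE]] macE]]]]]]] := hD.
have ig : mu.-integrable setT (EFin \o (fun x => g x ^+ 2)) by exact: Lfun2_integrable_sqr.
have mC : measurable (C : set mT).
  by apply: countable_measurable => // t; exact: measurable_set1.
have C0' : mu C = 0%E by exact: countable_lebesgue_measure0.
exists g, (C `|` N); split => //; first exact: measurableU.
  by rewrite measureU0.
have mCN : measurable (C `|` N) by exact: measurableU.
have mg2 (D : set R) : measurable D -> measurable_fun D (fun x => (g x ^+ 2)%:E).
  by move=> mD; apply: measurable_funTS; exact: measurable_int ig.
move=> E mE; have mEC : measurable (E `\` (C `|` N)) by exact: measurableD.
rewrite decE//.
have -> : mpp (E `\` (C `|` N)) = 0%E.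
  apply/eqP; rewrite eq_le measure_ge0 andbT -C0 le_measure// ?inE//.
    exact: measurableC.
  by move=> x [_ /not_orP[]].
have -> : msc (E `\` (C `|` N)) = 0%E.
  apply/eqP; rewrite eq_le measure_ge0 andbT -mscN le_measure// ?inE//.
    exact: measurableC.
  by move=> x [_ /not_orP[]].
rewrite !adde0 macE// /density -ge0_negligible_integral//.
- by apply: mg2.
- by move=> x _; rewrite lee_fin sqr_ge0.
- by rewrite measureU0.
Qed.

(** Cauchy-Schwarz for [ubar] on ]X a, X b], followed by comparison of the integral of g^2 with
    [mubar]. The endpoint X b is dropped from the integral because only the mass of the open
    interval is bounded by the energy increment. *)
Lemma velocity_increment a b : a <= b ->
  (ubar (X b) - ubar (X a)) ^+ 2 <= (X b - X a) * ((b - X b) - (a - X a)).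
Proof.
move=> ab; have /andP[X0 _] := slow_char_x mubar ab.
have /andP[H0 _] := slow_energy mubar ab.
move: X0; rewrite subr_ge0 le_eqVlt => /orP[/eqP e|Xab].
  by rewrite e !subrr expr0n/= mul0r.
have [g [N [wg ig mN N0 gE]]] := in_D_singular_support.
rewrite (weak_derivative_ubar wg (ltW Xab)).
apply: le_trans (sqr_integral_le Xab _ _) _.
- by apply: locally_integrable_itv; case: wg.
- exact: integrableS ig.
rewrite ler_wpM2l ?subr_ge0 ?(ltW Xab)//.
apply: le_trans (energy_increment Xab).
rewrite -[X in X <= _]/(fine _) fine_le//.
- by apply: integrable_fin_num => //; exact: integrableS ig.
- exact: fin_num_mubar.
rewrite -integral_itv_bndo_bndc; last first.
  by apply: measurable_funTS; exact: measurable_int ig.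
rewrite -[leLHS]/(density (fun x => g x ^+ 2) `]X a, X b[%classic) -gE//.
by rewrite le_measure// ?inE//; exact: measurableD.
Qed.

Notation V := (fun a => ubar (X a)).

Lemma lip_velocity : lip 1 V.
Proof.
move=> a b ab; rewrite mul1r; have := velocity_increment ab.
have := slow_char_x mubar ab; have := slow_energy mubar ab.
move: (ubar (X b) - ubar (X a)) => dV /andP[h1 h2] /andP[x1 x2] h.
have : `|dV| ^+ 2 <= (b - a) ^+ 2 by rewrite real_normK ?num_real//; nra.
by rewrite ler_pXn2r ?nnegrE// subr_ge0.
Qed.

Lemma velocity_derive_le (a : R) : derivable X a 1 -> derivable V a 1 ->
  derive1 V a ^+ 2 <= derive1 X a * f a.
Proof.
move=> dX dV; have dH := is_derive_energy dX.
have CX := derivable_derive1_cvg dX; have CV := derivable_derive1_cvg dV.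
have CH := @derivable_derive1_cvg _ (fun a => a - X a) a (@ex_derive _ _ _ _ _ _ _ dH).
rewrite derive1E (@derive_val _ _ _ _ _ _ _ dH) in CH.
have C : h^-1 * (X (h + a) - X a) * (h^-1 * (h + a - X (h + a) - (a - X a))) -
  h^-1 * (ubar (X (h + a)) - ubar (X a)) * (h^-1 * (ubar (X (h + a)) - ubar (X a)))
  @[h --> 0^'] --> derive1 X a * f a - derive1 V a * derive1 V a.
  by apply: cvgB; apply: cvgM.
rewrite -subr_ge0 expr2 -(cvg_lim (@Rhausdorff R) C).
apply: limr_ge; first by apply/cvg_ex; eexists; exact: C.
near=> h; have h0 : h != 0 by near: h; exact: nbhs_dnbhs_neq.
have hh : 0 < h^-1 * h^-1 by rewrite -expr2 exprn_even_gt0// invr_eq0.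
rewrite [X in X - _]mulrACA [X in _ - X]mulrACA -mulrBr mulr_ge0 ?(ltW hh)// subr_ge0 -expr2.
have [ah|ha] := leP a (h + a); first exact: velocity_increment.
have := velocity_increment (ltW ha); rewrite -sqrrN opprB => /le_trans; apply.
by rewrite -[leRHS]mulrNN !opprB.
Unshelve. all: by end_near. Qed.

(** Two densities push forward under X to g^2 dx: the energy density restricted to X^-1 of the
    complement of [N], and (g o X)^2 X'. They agree almost everywhere, and almost every label with
    X' > 0 lies outside X^-1(N). *)
Lemma ae_energy_density : exists g : R -> R,
  weak_derivative ubar g /\
  {ae mu, forall a, 0 < derive1 X a -> f a = g (X a) ^+ 2 * derive1 X a}.
Proof.
have [g [N [wg ig mN N0 gE]]] := in_D_singular_support.
exists g; split => //.
have mg : measurable_fun setT g by case: wg => -[].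
have cX : continuous X by exact/slow_continuous/slow_char_x.
have mX : measurable_fun setT X by exact: continuous_measurable_fun.
have nX := slow_nondecreasing (slow_char_x mubar).
have mX' : measurable_fun setT (derive1 X) by exact: measurable_derive1.
have X'0 a : 0 <= derive1 X a by case/andP: (derive1_slow a (slow_char_x mubar)).
have f0 a : 0 <= f a by case/andP: (char_f_bounds mubar a).
have mf := measurable_char_f mubar.
pose h1 a := \1_(~` N) (X a) * f a.
pose h2 a := g (X a) ^+ 2 * derive1 X a.
have h10 a : 0 <= h1 a by rewrite mulr_ge0// indicE.
have mh1 : measurable_fun setT h1.
  apply: measurable_funM => //; apply: (measurableT_comp _ mX).
  by apply: measurable_indic; exact: measurableC.
have P1 E : measurable E -> push_density X h1 E = mubar (E `\` N).
  move=> mE; rewrite mubar_push; last exact: measurableD.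
  rewrite /push_density /pushforward /density [LHS]integral_mkcond [RHS]integral_mkcond.
  apply: eq_integral => a _; rewrite !patchE /h1 indicE.
  have -> : (a \in X @^-1` (E `\` N)) = (a \in X @^-1` E) && (X a \in ~` N).
    by apply/idP/andP; rewrite !inE.
  by case: (a \in _) => //=; case: (X a \in _); rewrite ?mul1r ?mul0r.
have P2 E : measurable E -> push_density X h2 E = density (fun x => g x ^+ 2) E.
  move=> mE; apply: (@push_change_of_variables _ 1 X (fun x => g x ^+ 2)) => //.
  - exact: lip_char_x.
  - exact: char_x_surjective.
  - exact: measurable_funX.
  - by move=> x; exact: sqr_ge0.
have ae12 : {ae mu, forall x, h1 x = h2 x}.
  apply: (@ae_eq_density _ h1 h2 X) => //.
  - apply: measurable_funM => //; apply: measurable_funX; exact: measurableT_comp.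
  - by move=> a; rewrite mulr_ge0 ?sqr_ge0.
  - have -> : (\int[mu]_x (h1 x)%:E)%E = push_density X h1 setT.
      by rewrite /push_density /pushforward preimage_setT.
    by rewrite P1// -ge0_fin_numE// fin_num_mubar//; exact: measurableD.
  - by move=> E mE; rewrite P1// P2// gE.
  - move=> x; rewrite P1; last exact: measurable_set1.
    rewrite gE; last exact: measurable_set1.
    by rewrite /density (@integral_Sset1 _ _ _ x).
have aeN : {ae mu, forall x, ~ N x} by exists N; split => // x /= /contrapT.
have := ae_pullback ltr01 (lip_char_x mubar) nX (char_x_surjective mubar) aeN.
move=> /(aeI ae12); apply: aeS => a [+ Na] Xa; rewrite /h1 /h2 indicE mem_set ?mul1r//.
exact: Na.
Qed.

(** Almost every label with X' > 0 sits at a point where [ubar] is differentiable, so the chain rule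
    applies; where X' = 0 the inequality forces V' = 0. *)
Lemma ae_relations (w : R -> R) : weak_derivative ubar w ->
  {ae mu, forall a : R, [/\ derivable X a 1, derivable V a 1,
     derive1 V a ^+ 2 = derive1 X a * f a &
     0 < derive1 X a -> derive1 V a = w (X a) * derive1 X a /\
                        f a = w (X a) ^+ 2 * derive1 X a]}.
Proof.
move=> ww; have [g [wg gf]] := ae_energy_density.
have nX := slow_nondecreasing (slow_char_x mubar).
have gw := weak_derivative_ae_unique wg ww.
have H1 := ae_pullback ltr01 (lip_char_x mubar) nX (char_x_surjective mubar)
  (aeI gw (ae_is_derive_ubar ww)).
have H2 := slow_ae_derivable (slow_char_x mubar).
have H3 := lip_ae_derivable ltr01 lip_velocity.
move: (aeI (aeI gf H1) (aeI H2 H3)); apply: aeS => a [[fa Ha] [dX dV]].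
have pos : 0 < derive1 X a -> derive1 V a = w (X a) * derive1 X a /\
                        f a = w (X a) ^+ 2 * derive1 X a.
  move=> Xa; have [gX dU] := Ha Xa; rewrite -gX -fa//; split=> //.
  have dX' := derivable_is_derive1 dX.
  have := @is_derive1_comp _ ubar X a _ _ dU dX' => D.
  by rewrite gX derive1E (@derive_val _ _ _ _ _ _ _ D).
split => //.
have /andP[] := derive1_slow a (slow_char_x mubar).
rewrite le_eqVlt => /orP[/eqP X0 _|Xa _].
  have := velocity_derive_le dX dV; rewrite -X0 mul0r => h.
  by apply/le_anti; rewrite h sqr_ge0.
by have [-> ->] := pos Xa; ring.
Qed.

End energy_relations.

(** * Lagrangian flow *)

(** Monotonicity makes the intervals ]G (a i), G (b i)[ disjoint inside [0, M], so their total
    length is at most M. *)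
Lemma disjoint_itv_variation_le {R : realType} (G : R -> R) (M : R) (n : nat)
    (a b : 'I_n -> R) : {homo G : x y / x <= y} -> (forall x, 0 <= G x <= M) ->
  (forall i, a i <= b i) -> trivIset setT (fun i => `]a i, b i[%classic) ->
  \sum_(i < n) (G (b i) - G (a i)) <= M.
Proof.
move=> nG GM ab tab.
have M0 : 0 <= M by have /andP[h1 h2] := GM 0; exact: le_trans h1 h2.
pose F i : set (measurableTypeR R) := `]G (a i), G (b i)[%classic.
have tF : trivIset setT F.
  apply/trivIsetP => i j _ _ ij; apply/seteqP; split => // g [].
  rewrite /F /= !in_itv/= => /andP[gi1 gi2] /andP[gj1 gj2].
  have lt1 : a j < b i by rewrite ltNge; apply/negP => /nG h; lra.
  have lt2 : a i < b j by rewrite ltNge; apply/negP => /nG h; lra.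
  have lt3 : a i < b i by rewrite ltNge; apply/negP => /nG h; lra.
  have lt4 : a j < b j by rewrite ltNge; apply/negP => /nG h; lra.
  move/trivIsetP : tab => /(_ i j Logic.I Logic.I ij)/seteqP[+ _].
  have m1 : Num.max (a i) (a j) < Num.min (b i) (b j).
    by rewrite gt_max !lt_min lt1 lt2 lt3 lt4.
  move=> /(_ ((Num.max (a i) (a j) + Num.min (b i) (b j)) / 2)); apply.
  have [x1 x2] := midf_lt m1.
  have h1 : a i <= Num.max (a i) (a j) by rewrite le_max lexx.
  have h2 : a j <= Num.max (a i) (a j) by rewrite le_max lexx orbT.
  have h3 : Num.min (b i) (b j) <= b i by rewrite ge_min lexx.
  have h4 : Num.min (b i) (b j) <= b j by rewrite ge_min lexx orbT.
  by split => /=; rewrite in_itv/=; apply/andP; split; lra.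
have mF i : measurable (F i) by exact: measurable_itv.
have lF i : lebesgue_measure (F i) = (G (b i) - G (a i))%:E.
  rewrite /F lebesgue_measure_itv/= lte_fin; case: ltP => [_|h]; first by rewrite -EFinB.
  by congr EFin; apply/esym/eqP; rewrite subr_eq0; apply/eqP/le_anti; rewrite h nG.
rewrite -lee_fin -sumEFin; under eq_bigr do rewrite -lF.
rewrite -measure_semi_additive_ord//; last exact: bigsetU_measurable.
have -> : M%:E = lebesgue_measure (`[0, M]%classic : set (measurableTypeR R)).
  rewrite lebesgue_measure_itv/= lte_fin; case: ltP => [_|h]; first by rewrite sube0.
  by congr EFin; apply/le_anti; rewrite M0 h.
rewrite le_measure// ?inE//; first exact: bigsetU_measurable.
apply: (big_ind (fun A => A `<=` _)) => [|A C hA hC x [/hA|/hC]|i _ x]//.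
rewrite /F /= !in_itv/= => /andP[h1 h2].
have /andP[? _] := GM (a i); have /andP[_ ?] := GM (b i).
by apply/andP; split; lra.
Qed.

(* Lagrangian data at time 0: positions [X], velocities [V], energies [id - X]
   of total mass [M]. The inequality [lag_det] says [V'^2 <= X' (1 - X')],
   with equality almost everywhere by [lag_ae]. *)
Record lagrangian {R : realType} (X V : R -> R) (M B : R) : Prop := {
  lag_slow : slow X;
  lag_det : forall a b, a <= b ->
    (V b - V a) ^+ 2 <= (X b - X a) * ((b - X b) - (a - X a));
  lag_nrg : forall a, 0 <= a - X a <= M;
  lag_nrgNy : forall e, 0 < e -> exists A, forall a, a <= A -> a - X a <= e;
  lag_nrgy : forall e, 0 < e -> exists A, forall a, A <= a -> M - e <= a - X a;
  lag_vel : forall a, `|V a| <= B;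
  lag_ae : \forall a \ae (@lebesgue_measure R),
    [/\ derivable X a 1, derivable V a 1 &
        derive1 V a ^+ 2 = derive1 X a * (1 - derive1 X a)] }.

Section lagrangian.
Context {R : realType}.
Notation mT := (measurableTypeR R).
Notation mu := (@lebesgue_measure R).
Variables (X V : R -> R) (M B : R).
Hypothesis hL : lagrangian X V M B.

Let sX := lag_slow hL.
Let dV := lag_det hL.
Let H0M := lag_nrg hL.
Let HNy := lag_nrgNy hL.
Let Hy := lag_nrgy hL.
Let VB := lag_vel hL.

Definition nrg (a : R) := a - X a.
Definition pos (a t : R) := X a + V a * t + t ^+ 2 / 4 * nrg a.
Definition vel (a t : R) := V a + t / 2 * nrg a.

Lemma nrg_nondecreasing : {homo nrg : a b / a <= b}.
Proof. exact/slow_nondecreasing/slow_complement. Qed.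

Lemma M_ge0 : 0 <= M.
Proof. by have /andP[h1 h2] := H0M 0; exact: le_trans h1 h2. Qed.

Lemma B_ge0 : 0 <= B.
Proof. exact: le_trans (normr_ge0 _) (VB 0). Qed.

Lemma nrg_le a b : a <= b -> 0 <= nrg b - nrg a <= M.
Proof.
move=> ab; rewrite subr_ge0 nrg_nondecreasing//=.
by have := H0M a; have := H0M b; rewrite /nrg; lra.
Qed.

(** With increments x, v, h of X, V and the energy, x times the increment of y is (x + v t/2)^2 +
    t^2/4 (x h - v^2) >= 0. If x = 0, then v = 0 and only the energy term remains. *)
Lemma pos_nondecreasing t : {homo pos ^~ t : a b / a <= b}.
Proof.
move=> a b ab; rewrite -subr_ge0.
have -> : pos b t - pos a t = (X b - X a) + (V b - V a) * t + t ^+ 2 / 4 * (nrg b - nrg a).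
  by rewrite /pos; ring.
have := dV ab; have /andP[] := sX ab; have /andP[] := nrg_le ab.
rewrite -/(nrg a) -/(nrg b); move: (X b - X a) (V b - V a) (nrg b - nrg a) => x v h h0 _.
rewrite le_eqVlt => /orP[/eqP<- _|x0 _].
  rewrite mul0r => v0; have -> : v = 0 by apply/eqP; rewrite -sqrf_eq0 eq_le v0 sqr_ge0.
  by rewrite add0r mul0r add0r mulr_ge0// divr_ge0// sqr_ge0.
move=> vxh; rewrite -(pmulr_rge0 _ x0).
have -> : x * (x + v * t + t ^+ 2 / 4 * h) =
  (x + v * t / 2) ^+ 2 + t ^+ 2 / 4 * (x * h - v ^+ 2) by field.
by rewrite addr_ge0 ?sqr_ge0// mulr_ge0 ?subr_ge0// divr_ge0// sqr_ge0.
Qed.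

(* The determinant dX dH - dV^2 is preserved by the flow. *)
Lemma vel_increment a b t : a <= b ->
  (vel b t - vel a t) ^+ 2 <= (pos b t - pos a t) * (nrg b - nrg a).
Proof.
move=> ab; have := dV ab; rewrite -/(nrg a) -/(nrg b) => h.
rewrite -subr_ge0; move: h; rewrite -subr_ge0.
suff -> : (X b - X a) * (nrg b - nrg a) - (V b - V a) ^+ 2 =
  (pos b t - pos a t) * (nrg b - nrg a) - (vel b t - vel a t) ^+ 2 by [].
by rewrite /pos /vel; field.
Qed.

(** X, V and the energy are each 1-Lipschitz in the label; the factor 1/4 of t^2 is discarded. *)
Definition lipc (t : R) : R := 1 + `|t| + t ^+ 2.

Lemma lipc_gt0 t : 0 < lipc t.
Proof. by rewrite /lipc -addrA ltr_pwDl// addr_ge0// sqr_ge0. Qed.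

Lemma V_lip a b : a <= b -> `|V b - V a| <= b - a.
Proof.
move=> ab; have := dV ab; have := sX ab; have := nrg_le ab; rewrite -/(nrg a) -/(nrg b).
have : X b - X a + (nrg b - nrg a) = b - a by rewrite /nrg; ring.
move: (X b - X a) (V b - V a) (nrg b - nrg a) (b - a) => x v h d e /andP[h0 _] /andP[x0 xd] vxh.
have d0 : 0 <= d by rewrite -e addr_ge0.
have : `|v| ^+ 2 <= d ^+ 2 by rewrite real_normK ?num_real//; nra.
by rewrite ler_pXn2r ?nnegrE.
Qed.

Lemma lip_pos t : lip (lipc t) (pos ^~ t).
Proof.
move=> a b ab; rewrite ger0_norm; last by rewrite subr_ge0 pos_nondecreasing.
have -> : pos b t - pos a t = (X b - X a) + (V b - V a) * t + t ^+ 2 / 4 * (nrg b - nrg a).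
  by rewrite /pos; ring.
have /andP[_ x1] := sX ab.
have h1 : nrg b - nrg a <= b - a.
  by have /andP[x0 _] := sX ab; rewrite /nrg; lra.
have v1 : (V b - V a) * t <= (b - a) * `|t|.
  rewrite (le_trans (ler_norm _))// normrM ler_wpM2r// V_lip//.
have d0 : 0 <= b - a by rewrite subr_ge0.
have t0 := sqr_ge0 t; have /andP[h0 _] := nrg_le ab.
have t2 : t ^+ 2 / 4 * (nrg b - nrg a) <= t ^+ 2 * (b - a).
  by rewrite -mulrA ler_wpM2l//; lra.
rewrite /lipc; lra.
Qed.

Lemma lip_vel t : lip (1 + `|t|) (vel ^~ t).
Proof.
move=> a b ab.
have -> : vel b t - vel a t = (V b - V a) + t / 2 * (nrg b - nrg a) by rewrite /vel; ring.
have /andP[h0 _] := nrg_le ab.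
have h1 : nrg b - nrg a <= b - a.
  by have /andP[x0 _] := sX ab; rewrite /nrg; lra.
rewrite (le_trans (ler_normD _ _))// mulrDl mul1r lerD ?V_lip//.
rewrite normrM (ger0_norm h0) normrM [`|2^-1|]ger0_norm//.
have := normr_ge0 t; nra.
Qed.

(** At each time positions stay at bounded distance from labels. Surjectivity, boundedness of
    fibres, compactness of supports in labels and limits at infinity all rest on this. *)
Lemma pos_bound a t : `|pos a t - a| <= M + B * `|t| + t ^+ 2 * M.
Proof.
have -> : pos a t - a = - nrg a + V a * t + t ^+ 2 / 4 * nrg a by rewrite /pos /nrg; ring.
have /andP[h0 hM] := H0M a; rewrite -/(nrg a) in h0 hM.
apply: le_trans (ler_normD _ _) _; apply: lerD; last first.
  have t0 := sqr_ge0 t.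
  rewrite ger0_norm; last by rewrite mulr_ge0// divr_ge0.
  by rewrite -mulrA ler_wpM2l//; lra.
apply: le_trans (ler_normD _ _) _; apply: lerD; first by rewrite normrN ger0_norm.
by rewrite normrM ler_wpM2r.
Qed.

Lemma continuous_pos t : continuous (pos ^~ t).
Proof. exact: lip_continuous (lip_pos t). Qed.

Lemma pos_surjective t x : exists a, pos a t = x.
Proof.
pose C := M + B * `|t| + t ^+ 2 * M.
have C0 : 0 <= C.
  by rewrite /C !addr_ge0 ?M_ge0// mulr_ge0 ?M_ge0 ?B_ge0 ?sqr_ge0.
have ab : x - C <= x + C by lra.
have cp : {within `[x - C, x + C], continuous (pos ^~ t)}.
  by apply: continuous_subspaceT; exact: continuous_pos.
have p1 := pos_bound (x - C) t; have p2 := pos_bound (x + C) t.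
rewrite -/C !ler_norml in p1 p2.
have l1 : pos (x - C) t <= x by lra.
have l2 : x <= pos (x + C) t by lra.
have := @IVT R (pos ^~ t) (x - C) (x + C) x ab cp.
rewrite minElt maxElt; case: ltP => h; last first.
  by exists (x - C); apply/le_anti; rewrite l1 (le_trans l2).
by case=> [|c _ <-]; [rewrite l1 l2|exists c].
Qed.

(** The first and last labels of a fibre, that is [z1] and [z2] for general Lagrangian data. *)
Definition lab (x t : R) : R := inf [set a | pos a t = x].
Definition lab2 (x t : R) : R := sup [set a | pos a t = x].

Let fibre_bounds x t a : pos a t = x ->
  x - (M + B * `|t| + t ^+ 2 * M) <= a <= x + (M + B * `|t| + t ^+ 2 * M).
Proof. by have := pos_bound a t => /[swap] ->; rewrite ler_norml; lra. Qed.

Lemma has_inf_fibre x t : has_inf [set a | pos a t = x].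
Proof.
split; first by have [a ax] := pos_surjective t x; exists a.
by exists (x - (M + B * `|t| + t ^+ 2 * M)) => a /fibre_bounds /andP[].
Qed.

Lemma has_sup_fibre x t : has_sup [set a | pos a t = x].
Proof.
split; first by have [a ax] := pos_surjective t x; exists a.
by exists (x + (M + B * `|t| + t ^+ 2 * M)) => a /fibre_bounds /andP[].
Qed.

Lemma labK t : cancel (lab ^~ t) (pos ^~ t).
Proof.
move=> x; apply/eqP; rewrite -subr_eq0 -normr_le0; apply/ler_addgt0Pr => e e0.
rewrite add0r.
have e1 : 0 < e / lipc t by rewrite divr_gt0 ?lipc_gt0.
have [a ax] := inf_adherent e1 (has_inf_fibre x t).
rewrite -/(lab x t) => ae; have la : lab x t <= a.
  by apply: (ge_inf _) => //; exact: (has_inf_fibre x t).2.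
rewrite -{2}ax distrC (le_trans (lip_pos t la))//.
by rewrite mulrC -ler_pdivlMr ?lipc_gt0//; lra.
Qed.

Lemma lab2K t : cancel (lab2 ^~ t) (pos ^~ t).
Proof.
move=> x; apply/eqP; rewrite -subr_eq0 -normr_le0; apply/ler_addgt0Pr => e e0.
rewrite add0r.
have e1 : 0 < e / lipc t by rewrite divr_gt0 ?lipc_gt0.
have [a ax] := sup_adherent e1 (has_sup_fibre x t).
rewrite -/(lab2 x t) => ae; have la : a <= lab2 x t.
  by apply: (ub_le_sup _) => //; exact: (has_sup_fibre x t).2.
rewrite -{2}ax (le_trans (lip_pos t la))//.
by rewrite mulrC -ler_pdivlMr ?lipc_gt0//; lra.
Qed.

(** Together with [lab2_ge] this adjunction describes the level sets of both label maps by [pos],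
    and so gives their joint measurability in (x, t). *)
Lemma lab_le x t c : (lab x t <= c) = (x <= pos c t).
Proof.
apply/idP/idP => [/(pos_nondecreasing t)|]; first by rewrite labK.
rewrite le_eqVlt => /orP[/eqP xc|xc].
  by apply: (ge_inf _) => //; exact: (has_inf_fibre x t).2.
rewrite leNgt; apply/negP => /ltW/(pos_nondecreasing t).
by rewrite labK leNgt xc.
Qed.

Lemma lab2_ge x t c : (c <= lab2 x t) = (pos c t <= x).
Proof.
apply/idP/idP => [/(pos_nondecreasing t)|]; first by rewrite lab2K.
rewrite le_eqVlt => /orP[/eqP xc|xc].
  by apply: (ub_le_sup _) => //; exact: (has_sup_fibre x t).2.
rewrite leNgt; apply/negP => /ltW/(pos_nondecreasing t).
by rewrite lab2K leNgt xc.
Qed.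

Lemma lab_le_lab2 x t : lab x t <= lab2 x t.
Proof. by rewrite lab_le lab2K. Qed.

(** The choice of label in the fibre is immaterial: equal positions leave no room for a velocity
    increment in the determinant inequality ([vel_eq]). *)
Definition eul (x t : R) : R := vel (lab x t) t.

Lemma lab_lt t x y : x < y -> lab x t <= lab y t.
Proof.
move=> xy; rewrite leNgt; apply/negP => /ltW/(pos_nondecreasing t).
by rewrite !labK leNgt xy.
Qed.

Lemma lab_nondecreasing t : {homo lab ^~ t : x y / x <= y}.
Proof. by move=> x y; rewrite le_eqVlt => /orP[/eqP->//|]; exact: lab_lt. Qed.

Lemma vel_eq a b t : pos a t = pos b t -> vel a t = vel b t.
Proof.
wlog ab : a b / a <= b.
  by move=> W; have [/W//|/ltW/W h /esym/h] := leP a b.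
move=> e; have := vel_increment t ab; rewrite e subrr mul0r => h.
apply/esym/eqP; rewrite -subr_eq0 -sqrf_eq0; apply/eqP/le_anti.
by rewrite h sqr_ge0.
Qed.

Lemma eulE a t : eul (pos a t) t = vel a t.
Proof. by apply: vel_eq; exact: labK. Qed.

Lemma eul_increment x y t : x <= y ->
  (eul y t - eul x t) ^+ 2 <= (y - x) * (nrg (lab y t) - nrg (lab x t)).
Proof.
by move=> xy; have := vel_increment t (lab_nondecreasing t xy); rewrite !labK.
Qed.

Lemma eul_bound x t : `|eul x t| <= B + `|t| * M.
Proof.
rewrite /eul /vel; have /andP[h0 hM] := H0M (lab x t); rewrite -/(nrg (lab x t)) in h0 hM.
apply: le_trans (ler_normD _ _) _; apply: lerD; first exact: VB.
rewrite normrM (ger0_norm h0) normrM [`|2^-1|]ger0_norm//.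
by have := normr_ge0 t; nra.
Qed.

Lemma eul_holder_x x y t : `|eul x t - eul y t| <= Num.sqrt M * Num.sqrt `|x - y|.
Proof.
wlog xy : x y / x <= y.
  move=> W; have [/W//|/ltW/W] := leP x y.
  by rewrite distrC (distrC x).
rewrite -sqrtrM ?M_ge0// -sqrtr_sqr ler_wsqrtr//.
rewrite distrC ger0_norm ?subr_ge0// -sqrrN opprB mulrC.
apply: le_trans (eul_increment t xy) _; rewrite ler_wpM2l ?subr_ge0//.
by have /andP[] := nrg_le (lab_nondecreasing t xy).
Qed.

Lemma pos_dt a s t : `|pos a t - pos a s| <= (B + (`|t| + `|s|) * M) * `|t - s|.
Proof.
have -> : pos a t - pos a s = (V a + (t + s) / 4 * nrg a) * (t - s) by rewrite /pos; field.
rewrite normrM ler_wpM2r// (le_trans (ler_normD _ _))// lerD ?VB//.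
have /andP[h0 hM] := H0M a; rewrite -/(nrg a) in h0 hM.
rewrite normrM (ger0_norm h0) normrM [`|4^-1|]ger0_norm//.
have := ler_normD t s; have := normr_ge0 (t + s); nra.
Qed.

(** Follow the label that is at x at time t. Its velocity is Lipschitz in time, and at time s it is
    within a multiple of |t - s| of x, where the spatial Hoelder bound applies. *)
Lemma eul_holder_t x s t : `|eul x t - eul x s| <=
  M * `|t - s| + Num.sqrt (M * (B + (`|t| + `|s|) * M)) * Num.sqrt `|t - s|.
Proof.
pose a := lab x t; have xa : x = pos a t by rewrite labK.
have -> : eul x t - eul x s = (vel a t - vel a s) + (eul (pos a s) s - eul (pos a t) s).
  by rewrite eulE -xa /eul -/a; ring.
apply: le_trans (ler_normD _ _) _; apply: lerD.
  have -> : vel a t - vel a s = nrg a / 2 * (t - s) by rewrite /vel; field.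
  have /andP[h0 hM] := H0M a; rewrite -/(nrg a) in h0 hM.
  rewrite normrM ler_wpM2r// ger0_norm ?divr_ge0//; lra.
apply: le_trans (eul_holder_x _ _ _) _.
have c0 : 0 <= B + (`|t| + `|s|) * M by rewrite addr_ge0 ?B_ge0 ?mulr_ge0 ?M_ge0// addr_ge0.
rewrite -!sqrtrM ?mulr_ge0 ?M_ge0// ler_wsqrtr// -mulrA ler_wpM2l ?M_ge0//.
by rewrite distrC pos_dt.
Qed.

Lemma eul_continuous_x t : continuous (eul ^~ t).
Proof.
move=> x; apply/cvgrPdist_le => e e0.
suff : \forall y \near x, `|eul x t - eul y t| <= e by [].
have M1 : 0 < M + 1 by have := M_ge0; lra.
have d0 : 0 < e ^+ 2 / (M + 1) by rewrite divr_gt0// exprn_gt0.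
near=> y.
apply: le_trans (eul_holder_x _ _ _) _.
have /ltW xy : `|x - y| < e ^+ 2 / (M + 1).
  by near: y; exact: cvgr_dist_lt.
have -> : e = Num.sqrt (e ^+ 2) by rewrite sqrtr_sqr gtr0_norm.
rewrite -sqrtrM ?M_ge0// ler_wsqrtr//.
move: xy; rewrite ler_pdivlMr// => xy.
by have := normr_ge0 (x - y); have := M_ge0; nra.
Unshelve. all: by end_near. Qed.

Lemma eul_Cb t : Cb (eul ^~ t).
Proof.
split; first exact: eul_continuous_x.
exists (B + `|t| * M); split; first exact: num_real.
by move=> N BN x _ /=; exact: le_trans (eul_bound x t) (ltW BN).
Qed.

Lemma eul_holder_half_loc : holder_half_loc eul.
Proof.
move=> K cK.
have [r [_ Hr]] := compact_bounded cK.
have Kb p : K p -> `|p| <= `|r| + 1.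
  by move=> Kp; apply: (Hr (`|r| + 1)) => //; rewrite (le_lt_trans (ler_norm r))// ltrDl.
pose c := `|r| + 1; have c0 : 0 <= c by rewrite addr_ge0.
(* The first term is the spatial constant. The second absorbs the linear time term, as |t - s| <= 2
   c; the third is the square-root time term, with |t| + |s| <= 2 c. *)
exists (Num.sqrt M + M * Num.sqrt (2 * c) + Num.sqrt (M * (B + 2 * c * M))).
move=> [x t] [x' s] /Kb p1 /Kb p2 /=.
set d := `|(x, t) - (x', s)|.
have dE : d = Num.max `|x - x'| `|t - s| by [].
have dx : `|x - x'| <= d by rewrite dE le_max lexx.
have dt : `|t - s| <= d by rewrite dE le_max lexx orbT.
have tc : `|t| <= c by apply: le_trans p1; rewrite [leRHS]/(Num.max _ _) le_max lexx orbT.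
have sc : `|s| <= c by apply: le_trans p2; rewrite [leRHS]/(Num.max _ _) le_max lexx orbT.
have -> : eul x t - eul x' s = (eul x t - eul x' t) + (eul x' t - eul x' s) by ring.
apply: le_trans (ler_normD _ _) _; rewrite -[X in _ <= X * _]addrA mulrDl; apply: lerD.
  apply: le_trans (eul_holder_x _ _ _) _.
  by rewrite ler_wpM2l ?sqrtr_ge0// ler_wsqrtr.
apply: le_trans (eul_holder_t _ _ _) _; rewrite [X in _ <= X]mulrDl; apply: lerD.
  rewrite -mulrA ler_wpM2l ?M_ge0// -sqrtrM ?mulr_ge0//.
  rewrite -[leLHS]ger0_norm// -sqrtr_sqr ler_wsqrtr//.
  have ts : `|t - s| <= 2 * c by rewrite (le_trans (ler_normB _ _))//; lra.
  by rewrite expr2 ler_pM.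
apply: ler_pM; rewrite ?sqrtr_ge0// ler_wsqrtr//.
rewrite ler_wpM2l ?M_ge0// lerD2l ler_wpM2r ?M_ge0//; lra.
Qed.

Lemma eul_continuous_in_Cb : continuous_in_Cb eul.
Proof.
split; first exact: eul_Cb.
move=> t A /uniform_nbhs[E [entE EA]].
move: entE; rewrite -entourage_ballE => -[e /= e0 He].
have M0 := M_ge0; have B0 := B_ge0.
pose C := Num.sqrt (M * (B + (2 * `|t| + 1) * M)).
have C0 : 0 <= C by exact: sqrtr_ge0.
have e1 : 0 < e / (2 * (M + 1)) by rewrite divr_gt0// mulr_gt0// ltr_wpDl.
have e2 : 0 < (e / (2 * (C + 1))) ^+ 2.
  by rewrite exprn_gt0// divr_gt0// mulr_gt0// ltr_wpDl.
suff : \forall s \near t, A (eul ^~ s) by [].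
near=> s; apply: EA => x _; apply: He => /=.
have ts1 : `|t - s| < 1 by near: s; exact: cvgr_dist_lt.
have ts2 : `|t - s| < e / (2 * (M + 1)) by near: s; exact: cvgr_dist_lt.
have ts3 : `|t - s| < (e / (2 * (C + 1))) ^+ 2 by near: s; exact: cvgr_dist_lt.
rewrite /ball/=; apply: le_lt_trans (eul_holder_t _ _ _) _.
have s1 : `|s| <= `|t| + 1.
  have -> : s = t - (t - s) by ring.
  by rewrite (le_trans (ler_normB _ _))// lerD2l ltW.
have h1 : M * `|t - s| <= e / 2.
  move: ts2; rewrite ltr_pdivlMr ?mulr_gt0 ?ltr_wpDl// => ts2.
  by have := normr_ge0 (t - s); nra.
have h2 : Num.sqrt (M * (B + (`|t| + `|s|) * M)) * Num.sqrt `|t - s| < e / 2.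
  have hh : Num.sqrt `|t - s| <= e / (2 * (C + 1)).
    have p0 : 0 <= e / (2 * (C + 1)) by rewrite divr_ge0 ?(ltW e0)// mulr_ge0// addr_ge0.
    have -> : e / (2 * (C + 1)) = Num.sqrt ((e / (2 * (C + 1))) ^+ 2).
      by rewrite sqrtr_sqr ger0_norm.
    by rewrite ler_wsqrtr// ltW.
  have hC : Num.sqrt (M * (B + (`|t| + `|s|) * M)) <= C.
    rewrite ler_wsqrtr// ler_wpM2l// lerD2l ler_wpM2r//; lra.
  apply: le_lt_trans (ler_pM (sqrtr_ge0 _) (sqrtr_ge0 _) hC hh) _.
  have -> : C * (e / (2 * (C + 1))) = e / 2 * (C / (C + 1)).
    by field; rewrite gt_eqF// ltr_wpDl.
  by rewrite gtr_pMr ?divr_gt0// ltr_pdivrMr ?mul1r ?ltrDl// ltr_wpDl.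
lra.
Unshelve. all: by end_near. Qed.

(** Young's inequality turns du^2 <= dx dH into |du| <= l/2 dx + dH/(2 l). The sum of the dH is at
    most M, and l = (M + 1)/e makes both contributions at most e/2; M + 1 is used because M may be
    0. *)
Lemma eul_absolutely_continuous t : absolutely_continuous (eul ^~ t).
Proof.
move=> e e0; have M0 := M_ge0; have M1 : 0 < M + 1 by lra.
have e2 : 0 < e ^+ 2 / (M + 1) by rewrite divr_gt0// exprn_gt0.
exists (e ^+ 2 / (M + 1)) => // n a b ab tab sd.
pose l := (M + 1) / e; have l0 : 0 < l by rewrite divr_gt0.
have G : \sum_(i < n) (nrg (lab (b i) t) - nrg (lab (a i) t)) <= M.
  apply: (@disjoint_itv_variation_le R (fun x => nrg (lab x t)) M n a b) => //.
  - by move=> x y xy; exact/nrg_nondecreasing/lab_nondecreasing.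
  - by move=> x; exact: H0M.
have H i : `|eul (b i) t - eul (a i) t| <=
    l / 2 * (b i - a i) + (2 * l)^-1 * (nrg (lab (b i) t) - nrg (lab (a i) t)).
  have := eul_increment t (ab i).
  have /andP[h0 _] := nrg_le (lab_nondecreasing t (ab i)).
  have x0 : 0 <= b i - a i by rewrite subr_ge0.
  move: (eul _ _ - _) (b i - a i) (nrg _ - _) x0 h0 => u x h x0 h0 uxh.
  have r0 : 0 <= l / 2 * x + (2 * l)^-1 * h.
    have ? : 0 <= l / 2 by rewrite divr_ge0// ltW.
    have ? : 0 <= (2 * l)^-1 by rewrite invr_ge0 mulr_ge0// ltW.
    by apply: addr_ge0; exact: mulr_ge0.
  rewrite -(ler_pXn2r (n := 2))// ?nnegrE// real_normK ?num_real//.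
  apply: (le_trans uxh).
  have -> : (l / 2 * x + (2 * l)^-1 * h) ^+ 2 = x * h + (l / 2 * x - (2 * l)^-1 * h) ^+ 2.
    by field; rewrite gt_eqF.
  by rewrite lerDl sqr_ge0.
apply: le_lt_trans (ler_sum _ (fun i _ => H i)) _.
rewrite big_split/= -!mulr_sumr.
have h1 : l / 2 * \sum_(i < n) (b i - a i) < e / 2.
  rewrite -ltr_pdivlMl ?divr_gt0//; apply: (lt_le_trans sd).
  by rewrite le_eqVlt; apply/orP; left; apply/eqP; rewrite /l; field; rewrite !gt_eqF.
have h2 : (2 * l)^-1 * \sum_(i < n) (nrg (lab (b i) t) - nrg (lab (a i) t)) <= e / 2.
  have l2 : 0 < 2 * l by rewrite mulr_gt0.
  rewrite mulrC ler_pdivrMr//; apply: (le_trans G).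
  have -> : e / 2 * (2 * l) = M + 1 by rewrite /l; field; rewrite !gt_eqF.
  by rewrite lerDl.
by rewrite [X in _ < X]splitr ltr_leD.
Qed.

Lemma lab_bound x t : `|lab x t - x| <= M + B * `|t| + t ^+ 2 * M.
Proof. by have := pos_bound (lab x t) t; rewrite labK distrC. Qed.

Lemma lab_cvgNy t : lab x t @[x --> -oo] --> -oo.
Proof.
apply/cvgrNyPle => A; near=> x.
have : `|lab x t - x| <= M + B * `|t| + t ^+ 2 * M by exact: lab_bound.
have : x <= A - (M + B * `|t| + t ^+ 2 * M) by near: x; apply: nbhs_ninfty_le; exact: num_real.
by rewrite ler_norml; lra.
Unshelve. all: by end_near. Qed.

Lemma lab_cvgy t : lab x t @[x --> +oo] --> +oo.
Proof.
apply/cvgryPge => A; near=> x.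
have : `|lab x t - x| <= M + B * `|t| + t ^+ 2 * M by exact: lab_bound.
have : A + (M + B * `|t| + t ^+ 2 * M) <= x by near: x; apply: nbhs_pinfty_ge; exact: num_real.
by rewrite ler_norml; lra.
Unshelve. all: by end_near. Qed.

Lemma nrg_cvgNy : nrg a @[a --> -oo] --> 0.
Proof.
apply/cvgrPdist_le => e e0; have [A hA] := HNy e0.
suff : \forall a \near -oo, `|0 - nrg a| <= e by [].
near=> a; have : a <= A by near: a; apply: nbhs_ninfty_le; exact: num_real.
move=> /hA ha; rewrite sub0r normrN ger0_norm//.
by have /andP[] := H0M a.
Unshelve. all: by end_near. Qed.

Lemma nrg_cvgy : nrg a @[a --> +oo] --> M.
Proof.
apply/cvgrPdist_le => e e0; have [A hA] := Hy e0.
suff : \forall a \near +oo, `|M - nrg a| <= e by [].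
near=> a; have : A <= a by near: a; apply: nbhs_pinfty_ge; exact: num_real.
move=> /hA ha; have /andP[_ h] := H0M a.
by rewrite ger0_norm /nrg; lra.
Unshelve. all: by end_near. Qed.

Lemma eul_cvgNy (l t : R) : V a @[a --> -oo] --> l -> eul x t @[x --> -oo] --> l.
Proof.
move=> Vl; have vl : vel a t @[a --> -oo] --> l.
  have : V a + t / 2 * nrg a @[a --> -oo] --> l + t / 2 * 0.
    by apply: cvgD => //; apply: cvgMr; exact: nrg_cvgNy.
  by rewrite mulr0 addr0.
exact: cvg_comp (@lab_cvgNy t) vl.
Qed.

Lemma eul_cvgy (l t : R) : V a @[a --> +oo] --> l ->
  eul x t @[x --> +oo] --> l + t / 2 * M.
Proof.
move=> Vl; have vl : vel a t @[a --> +oo] --> l + t / 2 * M.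
  by apply: cvgD => //; apply: cvgMr; exact: nrg_cvgy.
exact: cvg_comp (@lab_cvgy t) vl.
Qed.

End lagrangian.

(** * Collapse of characteristics and decomposition of the energy *)

(** T is constant between a and c, so the difference quotients with increments (c - a)/(n+1)
    vanish. *)
Lemma monotone_flat_derive {R : realType} (T : R -> R) (a c : R) :
  {homo T : x y / x <= y} -> derivable T a 1 -> T c = T a -> c != a ->
  derive1 T a = 0.
Proof.
move=> nT dT Tca ca; pose h n := n.+1%:R^-1 * (c - a).
have [h0 hc] : (forall n, h n != 0) /\ h n @[n --> \oo] --> (0 : R).
  split=> [n|]; first by rewrite mulf_neq0 ?subr_eq0// invr_neq0.
  by rewrite -[X in _ --> X](mul0r (c - a)); apply: cvgMl; exact: cvg_harmonic.
move/cvgr_dnbhsP : (derivable_derive1_cvg dT) => /(_ h (conj h0 hc)).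
have -> : (fun n => (h n)^-1 * (T (h n + a) - T a)) = cst 0.
  apply/funext => n; apply/eqP; rewrite mulf_eq0 subr_eq0; apply/orP; right.
  have n1 : (0 <= (n.+1%:R^-1 : R)) && ((n.+1%:R^-1 : R) <= 1).
    by rewrite invr_ge0 ler0n invf_le1// ler1n.
  apply/eqP/le_anti; rewrite /h; move: (n.+1%:R^-1 : R) n1 => r /andP[r0 r1].
  have [ac|/ltW ac] := leP a c.
    have /nT k1 : r * (c - a) + a <= c by nra.
    have /nT k2 : a <= r * (c - a) + a by nra.
    by rewrite k2 andbT -Tca k1.
  have /nT k1 : c <= r * (c - a) + a by nra.
  have /nT k2 : r * (c - a) + a <= a by nra.
  by rewrite k2 -Tca k1.
by move=> C; rewrite -(cvg_lim (@Rhausdorff R) C) lim_cst.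
Qed.

Lemma measurable_nondecreasing {R : realType} (T : R -> R) :
  {homo T : x y / x <= y} -> measurable_fun setT T.
Proof. by move=> nT; apply: nondecreasing_measurable. Qed.

(* Distinct fibres of a monotone map that are not singletons carry disjoint
   open intervals. *)
Lemma countable_jumps {R : realType} (f g : R -> R) :
  (forall x, f x <= g x) -> (forall x y, x < y -> g x <= f y) ->
  countable [set x | f x < g x].
Proof.
move=> fg gf.
pose B x := if f x < g x then `]f x, g x[%classic else setT.
apply: (@separated_open_countable R R B).
- by move=> x; rewrite /B; case: ifP => _; [exact: interval_open|exact: openT].
- move=> x; rewrite /B; case: ifP => h; last by exists 0.
  by exists ((f x + g x) / 2); rewrite /= in_itv/=; have [-> ->] := midf_lt h.
- move=> x y /= hx hy [z]; rewrite /B hx hy /= !in_itv/=.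
  move=> -[/andP[z1 z2] /andP[z3 z4]].
  by have [/gf h|/gf h|//] := ltgtP x y; lra.
Qed.

(** For each n only finitely many sets have mass above 1/(n+1): infinitely many would contain a
    disjoint sequence whose union has infinite mass. *)
Lemma countable_disjoint_mass {R : realType} d (T : measurableType d)
    (m : {finite_measure set T -> \bar R}) (Z : R -> set T) :
  (forall i, measurable (Z i)) -> trivIset setT Z ->
  countable [set i | m (Z i) != 0%E].
Proof.
move=> mZ tZ.
have fZ i : m (Z i) \is a fin_num by exact: fin_num_measure.
rewrite [X in countable X](_ : _ =
    \bigcup_n [set i | (n.+1%:R^-1 < fine (m (Z i)))%R]); last first.
  apply/seteqP; split => [i/= mi|i [n _] /= h].
    have : (0 < fine (m (Z i)))%R.
      by rewrite -lte_fin fineK// lt0e mi measure_ge0.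
    by move=> /ltr_add_invr[k]; rewrite add0r => h; exists k.
  by apply/eqP => m0; move: h; rewrite m0/= ltNge invr_ge0 ler0n.
apply: bigcup_countable => // n _; apply: finite_set_countable.
apply: contrapT => /infiniteP/pcard_leP/injfunPex[/= q q_fun q_inj].
have mU : measurable (\bigcup_k Z (q k)) by exact: bigcup_measurable.
have mUE : m (\bigcup_k Z (q k)) = (\sum_(0 <= k <oo) m (Z (q k)))%E.
  rewrite measure_bigcup//; first by apply: eq_eseriesl => // k; rewrite in_setT.
  by move=> i j _ _ /(tZ _ _ Logic.I Logic.I); apply: q_inj; rewrite inE.
pose c := fine (m (\bigcup_k Z (q k))).
have cE : m (\bigcup_k Z (q k)) = c%:E by rewrite fineK// fin_num_measure.
have [N cN] : exists N : nat, (c < n.+1%:R^-1 * N%:R)%R.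
  exists (Num.Def.archi_bound (c * n.+1%:R)%R); rewrite mulrC ltr_pdivlMr//.
  exact: unstable.ltr_bound.
have : (\sum_(0 <= k < N) m (Z (q k)) <= c%:E)%E.
  by rewrite -cE mUE; exact: nneseries_lim_ge.
rewrite leNgt => /negP; apply.
have -> : (\sum_(0 <= k < N) m (Z (q k)) = (\sum_(0 <= k < N) fine (m (Z (q k))))%:E)%E.
  by rewrite -sumEFin; apply: eq_bigr => k _; rewrite fineK.
rewrite lte_fin (lt_le_trans cN)//.
have -> : (n.+1%:R^-1 * N%:R = \sum_(0 <= k < N) n.+1%:R^-1 :> R)%R.
  by rewrite sumr_const_nat subn0 mulr_natr.
by apply: ler_sum => k _; apply/ltW; exact: q_fun.
Qed.

(** * Derivatives with respect to the label *)

Section lagrangian_derivatives.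
Context {R : realType}.
Notation mT := (measurableTypeR R).
Variables (X V : R -> R) (M B : R).
Hypothesis hL : lagrangian X V M B.

Local Notation y := (pos X V).
Local Notation U := (vel X V).
Local Notation p := (derive1 X).
Local Notation v := (derive1 V).

Definition nrg_dot (a : R) : R := 1 - derive1 X a.
Local Notation q := nrg_dot.

(* The space derivatives of [pos] and [vel] at almost every label. *)
Definition dpos (a t : R) : R := p a + v a * t + t ^+ 2 / 4 * q a.
Definition dvel (a t : R) : R := v a + t / 2 * q a.

(** The conditions do not involve the time, so one null set of labels is discarded for all times at
    once. *)
Definition regular_label (a : R) : Prop :=
  [/\ derivable X a 1, derivable V a 1 & v a ^+ 2 = p a * q a].

Lemma ae_regular : \forall a \ae (@lebesgue_measure R), regular_label a.
Proof. exact: lag_ae hL. Qed.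

Lemma dX_bounds a : 0 <= p a <= 1.
Proof. exact: derive1_slow a (lag_slow hL). Qed.

Lemma nrg_dot_bounds a : 0 <= q a <= 1.
Proof. by have := dX_bounds a; rewrite /q; lra. Qed.

Lemma nrg_dot_ge0 a : 0 <= q a.
Proof. by have /andP[] := nrg_dot_bounds a. Qed.

Lemma dV_bound a : `|v a| <= 1.
Proof.
by apply: lip_derive1_le => // b c bc; rewrite mul1r; exact: (V_lip hL).
Qed.

Lemma is_derive_nrg a : regular_label a -> is_derive a (1 : R) (nrg X) (q a).
Proof. by move=> [dX _ _]; exact: is_derive_complement. Qed.

Lemma is_derive_pos a t : regular_label a ->
  is_derive a (1 : R) (y ^~ t) (dpos a t).
Proof.
move=> ra; have dH := is_derive_nrg ra; case: ra => dX dV _.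
have dX' := derivable_is_derive1 dX; have dV' := derivable_is_derive1 dV.
rewrite /pos /dpos; apply: is_derive_eq.
by rewrite /GRing.scale/=; ring.
Qed.

Lemma is_derive_vel a t : regular_label a ->
  is_derive a (1 : R) (U ^~ t) (dvel a t).
Proof.
move=> ra; have dH := is_derive_nrg ra; case: ra => dX dV _.
have dV' := derivable_is_derive1 dV.
rewrite /vel /dvel; apply: is_derive_eq.
by rewrite /GRing.scale/=; ring.
Qed.

Lemma derive1_pos a t : regular_label a -> derive1 (y ^~ t) a = dpos a t.
Proof. by move=> /(is_derive_pos t) h; exact: is_derive1_val. Qed.

(** Infinitesimal conservation of the determinant: [dvel ^+ 2 - dpos * q] equals v^2 - p q at every
    time. *)
Lemma dvel_sqr a t : regular_label a -> dvel a t ^+ 2 = dpos a t * q a.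
Proof.
move=> [_ _ vpq]; rewrite /dvel /dpos.
suff -> : (v a + t / 2 * q a) ^+ 2 =
  (p a + v a * t + t ^+ 2 / 4 * q a) * q a + (v a ^+ 2 - p a * q a).
  by rewrite vpq; ring.
by field.
Qed.

(** If q > 0, the product with q is a square; if q = 0, then v = 0 and [dpos] reduces to p. *)
Lemma dpos_ge0 a t : regular_label a -> 0 <= dpos a t.
Proof.
move=> ra; have := dvel_sqr t ra; have := nrg_dot_ge0 a.
rewrite le_eqVlt => /orP[/eqP q0|q0 e].
  case: ra => _ _; rewrite /dpos -q0 !mulr0 => /eqP; rewrite sqrf_eq0 => /eqP ->.
  by rewrite mul0r !addr0; have /andP[] := dX_bounds a.
by rewrite -(pmulr_lge0 _ q0) -e sqr_ge0.
Qed.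

Lemma dpos_eq0_dvel a t : regular_label a -> dpos a t = 0 -> dvel a t = 0.
Proof.
by move=> ra d0; have /eqP := dvel_sqr t ra; rewrite d0 mul0r sqrf_eq0 => /eqP.
Qed.

(* The discriminant [v^2 - pq] vanishes, so [dpos a] has a single double root. *)
Lemma dpos_eq0_unique a s t : regular_label a ->
  dpos a s = 0 -> dpos a t = 0 -> s = t.
Proof.
move=> ra s0 t0; have := dpos_eq0_dvel ra s0; have := dpos_eq0_dvel ra t0.
have := nrg_dot_ge0 a; rewrite le_eqVlt => /orP[/eqP q0|q0].
  case: ra => _ _; move: s0; rewrite /dpos -q0 !mulr0 => + /eqP.
  rewrite sqrf_eq0 => + /eqP v0; rewrite v0 mul0r !addr0 => p0 _ _.
  by have : q a = 1 by [rewrite /q p0 subr0]; rewrite -q0 => /esym/eqP; rewrite oner_eq0.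
rewrite /dvel => h1 h2; have : (s - t) * q a = 0 by lra.
by move=> /eqP; rewrite mulf_eq0 (gt_eqF q0) orbF subr_eq0 => /eqP.
Qed.

Lemma lab_pos a t : derivable (y ^~ t) a 1 -> 0 < derive1 (y ^~ t) a ->
  forall c, y c t = y a t -> c = a.
Proof.
move=> dy d0 c yc; apply/eqP/negPn/negP => ca.
by move: d0; rewrite (monotone_flat_derive (pos_nondecreasing hL t) dy yc ca) ltxx.
Qed.

Lemma regular_singleton a t : regular_label a -> 0 < dpos a t ->
  lab X V (y a t) t = a /\ lab2 X V (y a t) t = a.
Proof.
move=> ra d0; have [dy _] := is_derive_pos t ra.
have H := lab_pos (t := t) dy; rewrite derive1_pos// in H.
by split; apply: H => //; [rewrite (labK hL)|rewrite (lab2K hL)].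
Qed.

Lemma measurable_dX : measurable_fun setT p.
Proof. by apply: measurable_derive1; exact: slow_continuous (lag_slow hL). Qed.

Lemma continuous_V : continuous V.
Proof. by apply: (@lip_continuous _ 1) => b c bc; rewrite mul1r; exact: (V_lip hL). Qed.

Lemma measurable_dV : measurable_fun setT v.
Proof. by apply: measurable_derive1; exact: continuous_V. Qed.

Lemma continuous_nrg : continuous (nrg X).
Proof. exact/slow_continuous/slow_complement/(lag_slow hL). Qed.

Lemma measurable_nrg_dot : measurable_fun setT q.
Proof. by apply: measurable_funB => //; exact: measurable_dX. Qed.

Lemma measurable_pos t : measurable_fun setT (y ^~ t).
Proof. exact: measurable_nondecreasing (pos_nondecreasing hL t). Qed.

Lemma measurable_dpos t : measurable_fun setT (dpos ^~ t).
Proof.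
apply: measurable_funD; last by apply: measurable_funM => //; exact: measurable_nrg_dot.
apply: measurable_funD; first exact: measurable_dX.
by apply: measurable_funM => //; exact: measurable_dV.
Qed.

Lemma measurable_dvel t : measurable_fun setT (dvel ^~ t).
Proof.
apply: measurable_funD; first exact: measurable_dV.
by apply: measurable_funM => //; exact: measurable_nrg_dot.
Qed.

Lemma measurable_lab t : measurable_fun setT ((lab X V) ^~ t).
Proof. exact: measurable_nondecreasing (lab_nondecreasing hL t). Qed.

Lemma integral_nrg_dot_itv a b : a <= b ->
  (\int[@lebesgue_measure R]_(x in `]a, b]) (q x)%:E = (nrg X b - nrg X a)%:E)%E.
Proof. by move=> ab; rewrite -(slow_complement_FTC (lag_slow hL) ab). Qed.

Let m0 := projT1 (cid (density_measure measurable_nrg_dot nrg_dot_ge0)).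
Let m0E A : m0 A = density q A. Proof. exact: (projT2 (cid (density_measure _ _))). Qed.

Lemma integral_nrg_dot_ray b :
  (\int[@lebesgue_measure R]_(x in `]-oo, b]) (q x)%:E = (nrg X b)%:E)%E.
Proof.
pose A n : set mT := `](b - n%:R), b]%classic.
have C1 : m0 (A n) @[n --> \oo] --> m0 (`]-oo, b]%classic : set mT).
  have -> : (`]-oo, b]%classic : set mT) = \bigcup_n A n.
    apply/seteqP; split => [z|z [n _]]; rewrite /A /= !in_itv/=; last by case/andP.
    move=> zb; have hn := unstable.ltr_bound (b - z).
    by exists (Num.Def.archi_bound (b - z)) => //=; rewrite in_itv/= zb andbT; lra.
  apply: nondecreasing_cvg_mu => [n||].
  - exact: measurable_itv.
  - by apply: bigcup_measurable => n _; exact: measurable_itv.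
  - move=> m n mn; apply/subsetPset => z; rewrite /A /= !in_itv/= => /andP[h ->].
    by rewrite andbT; have : (m%:R : R) <= n%:R by [rewrite ler_nat]; lra.
have AE n : m0 (A n) = (nrg X b - nrg X (b - n%:R))%:E.
  by rewrite m0E /density integral_nrg_dot_itv// gerBl.
have C2 : m0 (A n) @[n --> \oo] --> (nrg X b)%:E.
  under eq_fun do rewrite AE.
  apply/fine_cvgP; split; first exact: nearW.
  apply/cvgrPdist_le => e e0; have [a ha] := lag_nrgNy hL e0.
  near=> n => /=; rewrite opprB addrCA subrr addr0.
  have /andP[h0 _] := lag_nrg hL (b - n%:R).
  rewrite ger0_norm// ha//.
  have : `|b - a| < n%:R by near: n; exact: nbhs_infty_gtr.
  by rewrite ltr_norml; lra.
by rewrite -[LHS]m0E; exact: (cvg_unique _ C1 C2).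
Unshelve. all: by end_near. Qed.

Lemma integral_nrg_dot : (\int[@lebesgue_measure R]_x (q x)%:E = M%:E)%E.
Proof.
pose A n : set mT := `]-oo, n%:R]%classic.
have C1 : m0 (A n) @[n --> \oo] --> m0 setT.
  have -> : (setT : set mT) = \bigcup_n A n.
    apply/seteqP; split => [z _|//].
    exists (Num.Def.archi_bound (z : R)) => //=.
    by rewrite /A/= in_itv/= ltW// unstable.ltr_bound.
  apply: nondecreasing_cvg_mu => [n||].
  - exact: measurable_itv.
  - by apply: bigcup_measurable => n _; exact: measurable_itv.
  - move=> m n mn; apply/subsetPset => z; rewrite /A /= !in_itv/= => h.
    by rewrite (le_trans h)// ler_nat.
have AE n : m0 (A n) = (nrg X n%:R)%:E by rewrite m0E /density integral_nrg_dot_ray.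
have C2 : m0 (A n) @[n --> \oo] --> M%:E.
  under eq_fun do rewrite AE.
  apply/fine_cvgP; split; first exact: nearW.
  apply/cvgrPdist_le => e e0; have [a ha] := lag_nrgy hL e0.
  near=> n => /=.
  have /andP[_ hM] := lag_nrg hL n%:R.
  have an : a <= n%:R.
    by apply: ltW; apply: le_lt_trans (ler_norm a) _; near: n; exact: nbhs_infty_gtr.
  by rewrite ger0_norm /nrg; have := ha _ an; lra.
by rewrite -[LHS]m0E; exact: (cvg_unique _ C1 C2).
Unshelve. all: by end_near. Qed.

End lagrangian_derivatives.

Section restricted_density.
Context {R : realType}.
Notation mT := (measurableTypeR R).
Notation mu := (@lebesgue_measure R).

Lemma push_density_restrict (T h : R -> R) (A : set R) (E : set mT) :
  push_density T (h \_ A) E = (\int[mu]_(x in T @^-1` E `&` A) (h x)%:E)%E.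
Proof. by rewrite integral_mkcondr restrict_EFin. Qed.

Lemma measurable_restrict_fun (h : R -> R) (A : set R) : measurable_fun setT h ->
  measurable A -> measurable_fun setT (h \_ A).
Proof. by move=> mh mA; apply/(measurable_restrictT h mA); exact: measurable_funTS. Qed.

Lemma restrict_ge0 (h : R -> R) (A : set R) : (forall x, 0 <= h x) ->
  forall x, 0 <= (h \_ A) x.
Proof. by move=> h0 x; rewrite patchE; case: ifP. Qed.

Lemma integral_restrict_lty (h : R -> R) (A : set R) : measurable_fun setT h ->
  (forall x, 0 <= h x) -> measurable A -> (\int[mu]_x (h x)%:E < +oo)%E ->
  (\int[mu]_x ((h \_ A) x)%:E < +oo)%E.
Proof.
move=> mh h0 mA; apply: le_lt_trans; apply: ge0_le_integral => //.
- by move=> x _; rewrite lee_fin restrict_ge0.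
- by apply/measurable_EFinP; exact: measurable_restrict_fun.
- by apply/measurable_EFinP.
- by move=> x _; rewrite lee_fin patchE; case: ifP.
Qed.

Lemma is_derive0E (f : R -> R) (a : R) :
  is_derive a (1 : R) f 0 <-> derivable f a 1 /\ derive1 f a = 0.
Proof.
split=> [fa|[df fa]]; first by case: (fa) => df _; split=> //; exact: is_derive1_val.
by rewrite -fa; exact: derivable_is_derive1.
Qed.

End restricted_density.

Lemma measurable_inv {R : realType} : measurable_fun setT (@GRing.inv R).
Proof.
rewrite -(setUv [set (0 : R)]); apply/measurable_funU => //; first exact: measurableC.
split.
  by apply: (eq_measurable_fun (cst (0^-1 : R))) => [x /[!inE] ->|].
apply: open_continuous_measurable_fun.
  rewrite (_ : [set~ 0] = [set x : R | x != 0]); first exact: open_neq.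
  by apply/seteqP; split => x /= /eqP.
by move=> x /[!inE]/= /eqP x0; exact: inv_continuous.
Qed.

(** * The transported energy and its Lebesgue decomposition *)

Section lagrangian_measures.
Context {R : realType}.
Notation mT := (measurableTypeR R).
Notation mu := (@lebesgue_measure R).
Variables (X V : R -> R) (M B : R).
Hypothesis hL : lagrangian X V M B.

Local Notation y := (pos X V).
Local Notation U := (vel X V).
Local Notation q := (nrg_dot X).
Local Notation lab := (lab X V).
Local Notation lab2 := (lab2 X V).

(** Counterparts of [A_pp], [A_sc] and [B_L] for general Lagrangian data. *)
Definition flat_pp (t : R) : set R :=
  [set a : R | is_derive a (1 : R) (y ^~ t) 0 /\ lab (y a t) t < lab2 (y a t) t].
Definition flat_sc (t : R) : set R :=
  [set a : R | is_derive a (1 : R) (y ^~ t) 0 /\ lab (y a t) t = lab2 (y a t) t].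
Definition steep (t : R) : set R :=
  [set a : R | derivable (y ^~ t) a 1 /\ 0 < derive1 (y ^~ t) a].

Let mlaby t : measurable_fun setT (fun a => lab (y a t) t).
Proof.
apply: measurable_nondecreasing => a b ab; apply: (lab_nondecreasing hL).
exact: (pos_nondecreasing hL).
Qed.

Lemma lab2_nondecreasing t : {homo lab2 ^~ t : x z / x <= z}.
Proof. by move=> x z xz; rewrite (lab2_ge hL) (lab2K hL). Qed.

Let mlab2y t : measurable_fun setT (fun a => lab2 (y a t) t).
Proof.
apply: measurable_nondecreasing => a b ab; apply: lab2_nondecreasing.
exact: (pos_nondecreasing hL).
Qed.

Let mflat t : measurable [set a : R | is_derive a (1 : R) (y ^~ t) 0].
Proof.
have cy := continuous_pos hL (t := t).
rewrite (_ : mkset _ = [set a | derivable (y ^~ t) a 1] `&` (derive1 (y ^~ t)) @^-1` [set 0]).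
  apply: measurableI; first exact: measurable_derivable.
  by apply: measurable_preimage => //; exact: measurable_derive1.
by apply/seteqP; split => a /= /is_derive0E.
Qed.

Let mgap t : measurable_fun setT (fun a => lab2 (y a t) t - lab (y a t) t).
Proof. exact: measurable_funB. Qed.

Lemma measurable_flat_pp t : measurable (flat_pp t).
Proof.
rewrite (_ : flat_pp t = [set a : R | is_derive a (1 : R) (y ^~ t) 0] `&`
    (fun a => lab2 (y a t) t - lab (y a t) t) @^-1` `]0, +oo[%classic).
  by apply: measurableI => //; apply: measurable_preimage.
by apply/seteqP; split => a /=; rewrite in_itv/= andbT subr_gt0.
Qed.

Lemma measurable_flat_sc t : measurable (flat_sc t).
Proof.
rewrite (_ : flat_sc t = [set a : R | is_derive a (1 : R) (y ^~ t) 0] `&`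
    (fun a => lab2 (y a t) t - lab (y a t) t) @^-1` [set 0]).
  by apply: measurableI => //; apply: measurable_preimage.
apply/seteqP; split => a /= [? h]; split => //; first by rewrite h subrr.
by move/eqP: h; rewrite subr_eq0 => /eqP.
Qed.

Lemma measurable_steep t : measurable (steep t).
Proof.
have cy := continuous_pos hL (t := t).
rewrite (_ : steep t = [set a | derivable (y ^~ t) a 1] `&`
    (derive1 (y ^~ t)) @^-1` `]0, +oo[%classic).
  apply: measurableI; first exact: measurable_derivable.
  by apply: measurable_preimage => //; exact: measurable_derive1.
by apply/seteqP; split => a /=; rewrite in_itv/= andbT.
Qed.

Lemma regular_steep a t : regular_label X V a -> steep t a <-> 0 < dpos X V a t.
Proof.
move=> ra; have [dy _] := is_derive_pos t ra.
by rewrite /steep/= derive1_pos//; split => [[]|].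
Qed.

Lemma regular_flat a t : regular_label X V a ->
  (flat_pp t `|` flat_sc t) a <-> dpos X V a t = 0.
Proof.
move=> ra; have [dy _] := is_derive_pos t ra.
rewrite /flat_pp /flat_sc /= !is_derive0E derive1_pos//; split; first by move=> [[[]]|[[]]].
move=> h; have := lab_le_lab2 hL (y a t) t.
by rewrite le_eqVlt => /orP[/eqP|] e; [right|left].
Qed.

Lemma push_part t (A : set R) : measurable A ->
  exists m : finite_borel_measure R, forall E, m E = push_density (y ^~ t) (q \_ A) E.
Proof.
move=> mA; have mq := measurable_nrg_dot hL; have q0 := nrg_dot_ge0 hL.
apply: push_finite_measure.
- exact: measurable_pos hL t.
- exact: measurable_restrict_fun.
- exact: restrict_ge0.
- by apply: integral_restrict_lty => //; rewrite (integral_nrg_dot hL) ltry.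
Qed.

(** Extracted by choice in order to have a bundled finite measure, as the witnesses of the theorem
    must be. *)
Definition energy_part t A (mA : measurable A) : finite_borel_measure R :=
  projT1 (cid (push_part t mA)).

Lemma energy_partE t A (mA : measurable A) E :
  energy_part t mA E = push_density (y ^~ t) (q \_ A) E.
Proof. by rewrite /energy_part; case: cid. Qed.

Definition energy t := energy_part t (@measurableT _ R).
Definition energy_ac t := energy_part t (measurable_steep t).
Definition energy_pp t := energy_part t (measurable_flat_pp t).
Definition energy_sc t := energy_part t (measurable_flat_sc t).

Lemma energyE t E : energy t E = push_density (y ^~ t) q E.
Proof. by rewrite energy_partE patch_setT. Qed.

Lemma measurable_pos_preimage t (E : set mT) : measurable E -> measurable ((y ^~ t) @^-1` E).
Proof. by move=> mE; apply: measurable_preimage => //; exact: measurable_pos hL t. Qed.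

(** At a regular label [dpos] is either positive or zero, so the label belongs to exactly one of the
    three sets and the restricted densities add up to [q]. *)
Lemma energy_decomposition t : same_measure (energy t)
  (fun E => energy_ac t E + energy_pp t E + energy_sc t E)%E.
Proof.
move=> E mE; rewrite energyE !energy_partE /push_density /pushforward /density.
have mq := measurable_nrg_dot hL; have q0 := nrg_dot_ge0 hL.
have mA := measurable_steep t; have mp := measurable_flat_pp t.
have ms := measurable_flat_sc t.
have mF := measurable_pos_preimage t mE.
have mr A : measurable A -> measurable_fun ((y ^~ t) @^-1` E) (EFin \o (q \_ A)).
  by move=> mA'; apply/measurable_EFinP; apply: measurable_funTS; exact: measurable_restrict_fun.
have r0 A : forall x, ((y ^~ t) @^-1` E) x -> (0 <= ((q \_ A) x)%:E)%E.
  by move=> x _; rewrite lee_fin restrict_ge0.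
rewrite -ge0_integralD//; [|exact: r0|exact: mr|exact: r0|exact: mr].
rewrite -ge0_integralD//; last 4 first.
- by move=> x xE; rewrite adde_ge0 ?r0.
- by apply: emeasurable_funD; exact: mr.
- exact: r0.
- exact: mr.
apply: ge0_ae_eq_integral => //.
- by apply/measurable_EFinP; exact: measurable_funTS.
- by apply: emeasurable_funD; [apply: emeasurable_funD|]; exact: mr.
- by move=> x _; rewrite lee_fin.
- by move=> x xE; rewrite !adde_ge0 ?r0.
have := ae_regular hL; apply: aeS => a ra _.
rewrite -!EFinD; congr EFin; rewrite !patchE.
have st := regular_steep t ra; have fl := regular_flat t ra.
have := dpos_ge0 hL t ra; rewrite le_eqVlt => /orP[/eqP/esym d0|d0].
  have /negbTE -> : a \notin steep t by apply/negP; rewrite inE => /st; rewrite d0 ltxx.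
  case: (fl.2 d0) => ha.
    have /negbTE -> : a \notin flat_sc t.
      by apply/negP; rewrite inE => -[_ e]; case: ha => _; rewrite e ltxx.
    by rewrite mem_set// add0r addr0.
  have /negbTE -> : a \notin flat_pp t.
    by apply/negP; rewrite inE => -[_]; case: ha => _ ->; rewrite ltxx.
  by rewrite mem_set// !add0r.
have na : ~ (flat_pp t `|` flat_sc t) a by move=> /fl e; rewrite e ltxx in d0.
have /negbTE -> : a \notin flat_pp t by apply/negP; rewrite inE => h; apply: na; left.
have /negbTE -> : a \notin flat_sc t by apply/negP; rewrite inE => h; apply: na; right.
by rewrite mem_set ?addr0//; exact/st.
Qed.

(** By [ae_pullback], only a null set of steep labels is mapped into a given null set. *)
Lemma energy_ac_dominated t : energy_ac t `<< mu.
Proof.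
apply/null_content_dominatesP => E mE E0.
rewrite /energy_ac energy_partE push_density_restrict.
have mq := measurable_nrg_dot hL; have q0 := nrg_dot_ge0 hL.
have mA := measurable_steep t; have mF := measurable_pos_preimage t mE.
apply: null_set_integral; first exact: measurableI.
  by apply/measurable_EFinP; exact: measurable_funTS.
have aE : {ae mu, forall x, ~ E x}.
  by exists E; split => // x /= /contrapT.
have := ae_pullback (lipc_gt0 t) (lip_pos hL t) (pos_nondecreasing hL t)
  (pos_surjective hL t) aE.
move=> H; apply/negligibleP; first exact: measurableI.
by apply: negligibleS H => a [Ey [_ d0]] /= /(_ d0); exact.
Qed.

Lemma energy_part_eq0 t A (mA : measurable A) (E : set mT) : measurable E ->
  (forall a, A a -> E (y a t) -> False) -> energy_part t mA E = 0%E.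
Proof.
move=> mE H; rewrite energy_partE push_density_restrict.
rewrite (_ : _ `&` _ = set0) ?integral_set0//.
by apply/seteqP; split => // a [/= ? ?]; apply: (H a).
Qed.

(** The carrier is the set of positions with several labels, countable by [countable_jumps]. *)
Lemma energy_pp_pure_point t : pure_point (energy_pp t).
Proof.
pose C := [set x | lab x t < lab2 x t].
have cC : countable C.
  apply: (countable_jumps (f := lab ^~ t) (g := lab2 ^~ t)).
    by move=> x; exact: (lab_le_lab2 hL).
  move=> x z xz; rewrite leNgt; apply/negP => /ltW /(pos_nondecreasing hL t).
  by rewrite (labK hL) (lab2K hL) leNgt xz.
have mC : measurable C by exact: countable_measurable.
exists C => //; apply: energy_part_eq0; first exact: measurableC.
by move=> a [_ h]; apply.
Qed.

Lemma flat_sc_singleton t a : flat_sc t a -> lab (y a t) t = a.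
Proof.
move=> [_ e]; apply/le_anti; rewrite (lab_le hL) lexx/= e.
by rewrite (lab2_ge hL).
Qed.

(** There are no atoms, since each fibre meets [flat_sc] in at most one label. The carrier is null,
    because by change of variables its measure is an integral of y_a over labels where y_a = 0. *)
Lemma energy_sc_singular_continuous t : singular_continuous (energy_sc t).
Proof.
have mq := measurable_nrg_dot hL; have q0 := nrg_dot_ge0 hL.
have ms := measurable_flat_sc t.
split; last first.
  move=> x; rewrite /energy_sc energy_partE push_density_restrict.
  apply: null_set_integral.
  - by apply: measurableI => //; exact: measurable_pos_preimage.
  - by apply/measurable_EFinP; exact: measurable_funTS.
  apply: (@subset_measure0 _ _ _ mu _ [set lab x t]) => //.
  - by apply: measurableI => //; exact: measurable_pos_preimage.
  - by move=> a [/= <- /flat_sc_singleton ->].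
  exact: (@lebesgue_measure_set1 R (lab x t)).
(* This is the image of [flat_sc t] under y, written as a preimage so that it is measurable. *)
pose N : set mT := (lab ^~ t) @^-1` (flat_sc t).
have mN : measurable N by apply: measurable_preimage => //; exact: (measurable_lab hL).
exists N; split => //; last first.
  apply: energy_part_eq0; first exact: measurableC.
  by move=> a sa; apply; rewrite /N/= flat_sc_singleton.
have mI : measurable_fun setT (EFin \o (\1_N : R -> R)).
  by apply/measurable_EFinP; exact: measurable_indic.
have -> : mu N = (\int[mu]_x (\1_N x)%:E)%E by rewrite integral_indic// setIT.
rewrite (ge0_change_of_variables (lipc_gt0 t) (lip_pos hL t)
  (pos_nondecreasing hL t) (pos_surjective hL t) mI); last first.
  by move=> x; rewrite lee_fin indicE.
apply: integral0_eq => a _; rewrite /= indicE.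
have [|] := boolP (_ \in _); last by rewrite mul0e.
rewrite inE /N /= => sa; have ya : lab (y a t) t = a.
  have := flat_sc_singleton sa; rewrite (labK hL) => h.
  have [_ e] := sa; rewrite (labK hL) in e.
  by apply/le_anti; rewrite (lab_le hL) lexx/= e (lab2_ge hL).
by move: sa; rewrite ya => -[/is_derive0E[_ ->] _]; rewrite mule0.
Qed.

Lemma lebesgue_decomposition_energy t :
  lebesgue_decomposition (energy t) (energy_ac t) (energy_pp t) (energy_sc t).
Proof.
split; [exact: energy_ac_dominated|exact: energy_pp_pure_point|
  exact: energy_sc_singular_continuous|exact: energy_decomposition].
Qed.

(** Restricting to regular labels makes the sets for distinct times genuinely disjoint, as
    [countable_disjoint_mass] requires. *)
Definition collapsed t : set R := [set a | regular_label X V a /\ dpos X V a t = 0].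

Lemma measurable_regular : measurable [set a | regular_label X V a].
Proof.
have cX := slow_continuous (lag_slow hL); have cV := continuous_V hL.
have mq := measurable_nrg_dot hL.
have mX := measurable_dX hL; have mV := measurable_dV hL.
rewrite (_ : mkset _ = [set a | derivable X a 1] `&` [set a | derivable V a 1] `&`
    (fun a => derive1 V a ^+ 2 - derive1 X a * q a) @^-1` [set 0]).
  apply: measurableI; first by apply: measurableI; exact: measurable_derivable.
  apply: measurable_preimage => //; apply: measurable_funB; last exact: measurable_funM.
  exact: measurable_funX.
apply/seteqP; split => a /=; first by move=> [? ? ->]; rewrite subrr.
by move=> [[? ?] /eqP]; rewrite subr_eq0 => /eqP.
Qed.

Lemma measurable_collapsed t : measurable (collapsed t).
Proof.
rewrite (_ : collapsed t = [set a | regular_label X V a] `&` (dpos X V ^~ t) @^-1` [set 0])//.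
apply: measurableI; first exact: measurable_regular.
by apply: measurable_preimage => //; exact: measurable_dpos hL t.
Qed.

Lemma energy_flat_le t A (mA : measurable A) : A `<=` flat_pp t `|` flat_sc t ->
  (energy_part t mA setT <= \int[mu]_(x in collapsed t) (q x)%:E)%E.
Proof.
move=> Af; have mq := measurable_nrg_dot hL; have q0 := nrg_dot_ge0 hL.
have mc := measurable_collapsed t.
rewrite energy_partE /push_density /pushforward /density preimage_setT.
rewrite [leRHS]integral_mkcond restrict_EFin.
apply: ae_ge0_le_integral => //.
- by move=> x _; rewrite lee_fin restrict_ge0.
- by apply/measurable_EFinP; exact: measurable_restrict_fun.
- by move=> x _; rewrite lee_fin restrict_ge0.
- by apply/measurable_EFinP; exact: measurable_restrict_fun.
have := ae_regular hL; apply: aeS => a ra _.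
rewrite lee_fin !patchE; case: ifPn => [|_]; last by case: ifPn => // _; exact: q0.
rewrite inE => /Af/(regular_flat t ra) d0.
by rewrite mem_set.
Qed.

Lemma countable_collapse :
  countable [set t | \int[mu]_(x in collapsed t) (q x)%:E != 0%E]%E.
Proof.
have mq := measurable_nrg_dot hL; have q0 := nrg_dot_ge0 hL.
have [m mE] : exists m : finite_borel_measure R, forall E, m E = push_density id q E.
  by apply: push_finite_measure => //; rewrite (integral_nrg_dot hL) ltry.
have := @countable_disjoint_mass R _ _ m collapsed measurable_collapsed.
under eq_set do rewrite mE.
apply => s t _ _ [a [[ra d1] [_ d2]]].
by apply: (dpos_eq0_unique hL ra); [exact: d1|exact: d2].
Qed.

Lemma countable_pp : countable [set t | energy_pp t setT != 0%E].
Proof.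
apply: sub_countable countable_collapse; apply: subset_card_le => t /=.
apply: contraNN => /eqP h; rewrite -measure_le0 -h; apply: energy_flat_le.
by move=> a; left.
Qed.

Lemma countable_sc : countable [set t | energy_sc t setT != 0%E].
Proof.
apply: sub_countable countable_collapse; apply: subset_card_le => t /=.
apply: contraNN => /eqP h; rewrite -measure_le0 -h; apply: energy_flat_le.
by move=> a; right.
Qed.

(** The chain rule quotient U_a / y_a, with value 0 where y_a = 0 by the convention on inverses. It
    is defined everywhere, and jointly measurable in (x, t). *)
Definition eul_dx (x t : R) : R := dvel X V (lab x t) t / dpos X V (lab x t) t.
Local Notation ux := eul_dx.

Lemma eul_dx_pos a t : regular_label X V a -> 0 < dpos X V a t ->
  ux (y a t) t = dvel X V a t / dpos X V a t.
Proof. by move=> ra d0; rewrite /ux (regular_singleton hL ra d0).1. Qed.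

Let measurable_gap c : measurable_fun setT (fun z : R * R => z.1 - y c z.2).
Proof.
apply: measurable_funB => //; apply: measurable_funD.
  by apply: measurable_funD => //; exact: measurable_funM.
by apply: measurable_funM => //; apply: measurable_funM => //; exact: measurable_funX.
Qed.

(** By adjunction lab x t > c means x > y c t, and for fixed c the function x - y c t is measurable
    in (x, t). *)
Lemma measurable_lab_2d : measurable_fun setT (fun z : R * R => lab z.1 z.2).
Proof.
apply: (measurability (@RGenOInfty.G R)) => [|/= _ [_] [c] -> <-].
  exact: RGenOInfty.measurableE.
rewrite (_ : _ `&` _ = setT `&` (fun z : R * R => z.1 - y c z.2) @^-1` `]0, +oo[%classic).
  by apply: measurable_gap => //; exact: measurable_itv.
rewrite !setTI; apply/seteqP; split=> -[x t] /=; rewrite !in_itv/= !andbT subr_gt0;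
  by rewrite !ltNge (lab_le hL).
Qed.

Lemma measurable_lab2_2d : measurable_fun setT (fun z : R * R => lab2 z.1 z.2).
Proof.
apply: (measurability (@RGenCInfty.G R)) => [|/= _ [_] [c] -> <-].
  exact: RGenCInfty.measurableE.
rewrite (_ : _ `&` _ = setT `&` (fun z : R * R => z.1 - y c z.2) @^-1` `[0, +oo[%classic).
  by apply: measurable_gap => //; exact: measurable_itv.
rewrite !setTI; apply/seteqP; split=> -[x t] /=; rewrite !in_itv/= !andbT subr_ge0;
  by rewrite (lab2_ge hL).
Qed.

Lemma measurable_dpos_2d : measurable_fun setT (fun z : R * R => dpos X V z.1 z.2).
Proof.
have m1 (g : R -> R) : measurable_fun setT g -> measurable_fun setT (fun z : R * R => g z.1).
  by move=> mg; exact: measurableT_comp.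
apply: measurable_funD; last first.
  apply: measurable_funM; last by apply: m1; exact: (measurable_nrg_dot hL).
  by apply: measurable_funM => //; exact: measurable_funX.
apply: measurable_funD; first by apply: m1; exact: (measurable_dX hL).
by apply: measurable_funM => //; apply: m1; exact: (measurable_dV hL).
Qed.

Lemma measurable_dvel_2d : measurable_fun setT (fun z : R * R => dvel X V z.1 z.2).
Proof.
have m1 (g : R -> R) : measurable_fun setT g -> measurable_fun setT (fun z : R * R => g z.1).
  by move=> mg; exact: measurableT_comp.
apply: measurable_funD; first by apply: m1; exact: (measurable_dV hL).
by apply: measurable_funM; [exact: measurable_funM|apply: m1; exact: (measurable_nrg_dot hL)].
Qed.

Lemma measurable_eul_dx : measurable_fun setT (fun z : R * R => ux z.1 z.2).
Proof.
have ml : measurable_fun setT (fun z : R * R => (lab z.1 z.2, z.2)).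
  by apply: measurable_fun_pair => //; exact: measurable_lab_2d.
apply: measurable_funM.
  exact: (measurableT_comp measurable_dvel_2d ml).
apply: (measurableT_comp (@measurable_inv R)).
exact: (measurableT_comp measurable_dpos_2d ml).
Qed.

Lemma measurable_eul : measurable_fun setT (fun z : R * R => eul X V z.1 z.2).
Proof.
have ml := measurable_lab_2d.
apply: measurable_funD; last apply: measurable_funM.
- apply: (measurableT_comp _ ml); apply: continuous_measurable_fun; exact: (continuous_V hL).
- exact: measurable_funM.
apply: (measurableT_comp _ ml); apply: continuous_measurable_fun; exact: (continuous_nrg hL).
Qed.

Lemma measurable_eul_dx1 t : measurable_fun setT (ux ^~ t).
Proof. 
have H : measurable_fun setT (fun x : R => (x, t)) by exact: pair2_measurable.
by have := measurableT_comp measurable_eul_dx H. Qed.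

(** Pulled back to labels, u_x^2 dx has density [dvel ^+ 2 / dpos], that is [q], on steep labels and
    0 on the other regular labels. *)
Lemma energy_ac_density t : same_measure (energy_ac t) (density (fun x => ux x t ^+ 2)).
Proof.
move=> E mE; have mq := measurable_nrg_dot hL; have q0 := nrg_dot_ge0 hL.
have mux2 : measurable_fun setT (fun x => ux x t ^+ 2).
  by apply: measurable_funX; exact: measurable_eul_dx1.
rewrite -(push_change_of_variables (lipc_gt0 t) (lip_pos hL t)
  (pos_nondecreasing hL t) (pos_surjective hL t) mux2 (fun=> sqr_ge0 _))//.
rewrite /energy_ac energy_partE /push_density /pushforward /density.
have mA := measurable_steep t; have mF := measurable_pos_preimage t mE.
apply: ge0_ae_eq_integral => //.
- by apply/measurable_EFinP; apply: measurable_funTS; exact: measurable_restrict_fun.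
- apply/measurable_EFinP; apply: measurable_funTS; apply: measurable_funM.
    exact: (measurableT_comp mux2 (measurable_pos hL t)).
  by apply: measurable_derive1; exact: (continuous_pos hL).
- by move=> x _; rewrite lee_fin restrict_ge0.
- move=> x _; rewrite lee_fin mulr_ge0 ?sqr_ge0//.
  exact: nondecreasing_derive1_ge0 (pos_nondecreasing hL t).
have := ae_regular hL; apply: aeS => a ra _; congr EFin.
rewrite derive1_pos// patchE; have st := regular_steep t ra.
have := dpos_ge0 hL t ra; rewrite le_eqVlt => /orP[/eqP/esym d0|d0].
  rewrite d0 mulr0; case: ifPn => //; rewrite inE => /st.
  by rewrite d0 ltxx.
rewrite mem_set; last exact/st.
rewrite eul_dx_pos// expr_div_n dvel_sqr// expr2.
by field; rewrite gt_eqF.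
Qed.

End lagrangian_measures.

(** * The space derivative of the velocity *)

Section square_integrable.
Context {R : realType}.
Notation mu := (@lebesgue_measure R).

Lemma Lnorm2E (g : R -> R) (c : R) : (\int[mu]_x (g x ^+ 2)%:E = c%:E)%E ->
  ('N[mu]_2%:E[EFin \o g] = (Num.sqrt c)%:E)%E.
Proof.
move=> gc; rewrite unlock.
have -> : (\int[mu]_x `|(EFin \o g) x| `^ 2 = c%:E)%E.
  rewrite -gc; apply: eq_integral => x _ /=.
  by rewrite powR_mulrn// real_normK ?num_real.
rewrite poweR_EFin powR12_sqrt// -lee_fin -gc.
by apply: integral_ge0 => x _; rewrite lee_fin sqr_ge0.
Qed.

Lemma L2_sqr (g : R -> R) (c : R) : measurable_fun setT g ->
  (\int[mu]_x (g x ^+ 2)%:E = c%:E)%E -> L2 g.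
Proof.
move=> mg gc; rewrite /L2 inE; apply/andP; split; rewrite inE//=.
by rewrite /finite_norm (Lnorm2E gc) ltry.
Qed.

Lemma Lnorm2_sqr (g : R -> R) (c : R) : (\int[mu]_x (g x ^+ 2)%:E = c%:E)%E ->
  ('N[mu]_2%:E[EFin \o g] ^+ 2 = c%:E)%E.
Proof.
move=> gc; rewrite (Lnorm2E gc) expe2 -EFinM -expr2 sqr_sqrtr// -lee_fin -gc.
by apply: integral_ge0 => x _; rewrite lee_fin sqr_ge0.
Qed.

Lemma locally_integrable_sqr (g : R -> R) : measurable_fun setT g ->
  (\int[mu]_x (g x ^+ 2)%:E < +oo)%E -> locally_integrable setT g.
Proof.
move=> mg gc; split => //; first exact: openT.
move=> K _ cK; have mK : measurable K by exact: measurable_realfun.compact_measurable.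
have mg2 : measurable_fun setT (fun x => g x ^+ 2) by exact: measurable_funX.
apply: (@le_lt_trans _ _ (\int[mu]_(x in K) (1%:E + (g x ^+ 2)%:E))%E).
  apply: ge0_le_integral => //.
  - by apply/measurable_EFinP; apply: measurableT_comp => //; exact: measurable_funTS.
  - apply: emeasurable_funD => //; apply/measurable_EFinP; exact: measurable_funTS.
  - move=> x _; rewrite -EFinD lee_fin -(real_normK (num_real (g x))).
    by have := normr_ge0 (g x); nra.
rewrite ge0_integralD//; last 2 first.
- by move=> x _; rewrite lee_fin sqr_ge0.
- by apply/measurable_EFinP; exact: measurable_funTS.
rewrite integral_cst// mul1e lte_add_pinfty//; first exact: compact_finite_measure.
apply: le_lt_trans gc; apply: ge0_subset_integral => //; first exact/measurable_EFinP.
by move=> x _; rewrite lee_fin sqr_ge0.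
Qed.

End square_integrable.

(** * Compactly supported functions and integrals of derivatives *)

Section compact_support.
Context {R : realType}.
Notation mu := (@lebesgue_measure R).

Lemma compact_support_bounded (V : normedModType R) (f : V -> R) (K : set V) :
  compact K -> continuous f -> (forall p, ~ K p -> f p = 0) ->
  exists2 C, 0 <= C & forall p, `|f p| <= C.
Proof.
move=> cK cf f0; have cfK : compact (f @` K).
  by apply: continuous_compact => //; exact: continuous_subspaceT.
have [r [_ Hr]] := compact_bounded cfK.
exists (`|r| + 1) => [|p]; first by rewrite addr_ge0.
have [Kp|/f0 ->] := pselect (K p); last by rewrite normr0 addr_ge0.
apply: (Hr (`|r| + 1)); last by exists p.
by rewrite (le_lt_trans (ler_norm r))// ltrDl.
Qed.

Lemma derive_support (V : normedModType R) (f : V -> R) (p v : V) :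
  ~ closure [set p | f p != 0] p -> 'D_v f p = 0.
Proof.
move=> np; have <- : 'D_v (cst (0 : R) : V -> R) p = 0 by exact: derive_cst.
apply: near_eq_derive.
have : (~` closure [set p | f p != 0]) p by [].
have : open (~` closure [set p | f p != 0]) by exact/closed_openC/closed_closure.
rewrite openE => /[apply] H; near=> z; apply/eqP/negPn/negP => fz.
have : (~` closure [set p | f p != 0]) z by near: z.
by apply; exact: subset_closure.
Unshelve. all: by end_near. Qed.

Lemma support_out (V : normedModType R) (f : V -> R) (p : V) :
  ~ closure [set p | f p != 0] p -> f p = 0.
Proof.
by move=> np; apply/eqP/negPn/negP => fp; apply: np; exact: subset_closure.
Qed.

Lemma integrable_bounded_supp (f : R -> R) (C A : R) : measurable_fun setT f ->
  (forall x, `|f x| <= C) -> (forall x, A <= `|x| -> f x = 0) ->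
  mu.-integrable setT (EFin \o f).
Proof.
move=> mf fC fA.
have H : mu.-integrable setT (EFin \o (cst C \_ `[- A, A] : R -> R)).
  rewrite -restrict_EFin; apply/(integrable_mkcond _ _).1 => //.
  by apply: integrable_continuous_itv => x; exact: cvg_cst.
apply: (le_integrable _ _ _ H) => //; first exact/measurable_EFinP.
move=> x _ /=; rewrite lee_fin patchE; case: ifPn => [_|].
  by rewrite (le_trans (fC x))// ler_norm.
rewrite notin_setE/= in_itv/= => /negP h; rewrite fA ?normr0//.
by rewrite leNgt; apply: contraNN h => /ltW; rewrite ler_norml.
Qed.

Lemma lip_le K K' (T : R -> R) : K <= K' -> lip K T -> lip K' T.
Proof.
move=> KK lT a b ab; apply: le_trans (lT _ _ ab) _.
by rewrite ler_wpM2r// subr_ge0.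
Qed.

Lemma lipM K L F G (f g : R -> R) : lip K f -> lip L g ->
  (forall x, `|f x| <= F) -> (forall x, `|g x| <= G) ->
  lip (K * G + F * L) (fun x => f x * g x).
Proof.
move=> lf lg fF gG a b ab.
have -> : f b * g b - f a * g a = (f b - f a) * g b + f a * (g b - g a) by ring.
apply: le_trans (ler_normD _ _) _; rewrite !normrM mulrDl; apply: lerD.
  rewrite mulrAC; apply: ler_pM => //; exact: lf.
by rewrite -mulrA; apply: ler_pM => //; exact: lg.
Qed.

Lemma lip_comp K L (f T : R -> R) : 0 <= K -> lip K f -> {homo T : a b / a <= b} ->
  lip L T -> lip (K * L) (f \o T).
Proof.
move=> K0 lf nT lT a b ab; apply: le_trans (lf _ _ (nT _ _ ab)) _.
by rewrite -mulrA ler_wpM2l// (le_trans (ler_norm _))// lT.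
Qed.

Lemma is_derive_lip C (f g : R -> R) : (forall x : R, is_derive x (1 : R) f (g x)) ->
  (forall x, `|g x| <= C) -> lip C f.
Proof.
move=> fg gC a b; rewrite le_eqVlt => /orP[/eqP->|ab].
  by rewrite !subrr normr0 mulr0.
have [c _ ->] := MVT_is_derive fg ab.
by rewrite normrM ler_pM// ger0_norm// subr_ge0 ltW.
Qed.

Lemma Rintegral_derive1_supp K A (W : R -> R) : 0 < K -> lip K W ->
  (forall x, A <= `|x| -> W x = 0) -> \int[mu]_x derive1 W x = 0.
Proof.
move=> K0 lW W0.
(* Strictly beyond |A|, so that W vanishes in a neighbourhood of every point outside ]-A', A'], and
   at both endpoints. *)
pose A' := `|A| + 1; have A'0 : 0 < A' by rewrite ltr_wpDl.
have WA (x : R) : A' <= `|x| -> W x = 0.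
  by move=> h; apply: W0; rewrite (le_trans _ h)// (le_trans (ler_norm A))// lerDl.
have dW0 (x : R) : x \notin `]- A', A'] -> derive1 W x = 0.
  move=> xA; rewrite derive1E.
  have <- : 'D_(1 : R) (cst (0 : R) : R -> R) x = 0 by exact: derive_cst.
  apply: near_eq_derive; have Ax : `|A| < `|x|.
    move: xA; rewrite in_itv/= negb_and -ltNge -leNgt => /orP[h|h].
      have : - x <= `|x| by rewrite -normrN ler_norm.
      by move: h; rewrite /A'; lra.
    by rewrite (lt_le_trans _ (ler_norm _))// (lt_trans _ h)// ltrDl.
  have : \forall z \near x, `|A| < `|z|.
    have d0 : 0 < `|x| - `|A| by rewrite subr_gt0.
    near=> z; have : `|x - z| < `|x| - `|A| by near: z; exact: cvgr_dist_lt.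
    by have := ler_normD z (x - z); rewrite addrC subrK; lra.
  by apply: filterS => z /ltW Az; apply: W0; rewrite (le_trans (ler_norm A)).
have h : (- A' <= A') by lra.
rewrite /Rintegral (_ : (\int[mu]_x (derive1 W x)%:E = 0)%E)//.
have := lip_FTC K0 lW h; rewrite !WA ?normrN ?(ger0_norm (ltW A'0))// subrr => E.
rewrite -[RHS]E [RHS]integral_mkcond; apply: eq_integral => x _.
by rewrite patchE; case: ifPn => //; rewrite notin_setE/= => /negP/dW0 ->.
Unshelve. all: by end_near. Qed.

End compact_support.

(** * Weak space derivative of the velocity and weak continuity of the energy *)

Section lagrangian_weak.
Context {R : realType}.
Notation mT := (measurableTypeR R).
Notation mu := (@lebesgue_measure R).
Variables (X V : R -> R) (M B : R).
Hypothesis hL : lagrangian X V M B.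

Local Notation y := (pos X V).
Local Notation U := (vel X V).
Local Notation q := (nrg_dot X).
Local Notation u := (eul X V).
Local Notation ux := (eul_dx X V).

Lemma dvel_bound a t : `|dvel X V a t| <= 1 + `|t|.
Proof.
rewrite /dvel (le_trans (ler_normD _ _))// lerD ?(dV_bound hL)//.
have /andP[q0 q1] := nrg_dot_bounds hL a.
rewrite normrM (ger0_norm q0) normrM [`|2^-1|]ger0_norm//.
have := normr_ge0 t; nra.
Qed.

Lemma dpos1_bound a t : `|derive1 (y ^~ t) a| <= lipc t.
Proof. by apply: lip_derive1_le; [exact/ltW/lipc_gt0|exact: (lip_pos hL)]. Qed.

Lemma measurable_derive1_pos t : measurable_fun setT (derive1 (y ^~ t)).
Proof. by apply: measurable_derive1; exact: (continuous_pos hL). Qed.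

Lemma vel_bound a t : `|U a t| <= B + `|t| * M.
Proof. by rewrite -(eulE hL) (eul_bound hL). Qed.

Lemma continuous_vel t : continuous (U ^~ t).
Proof. exact: lip_continuous (lip_vel hL t). Qed.

Lemma measurable_vel t : measurable_fun setT (U ^~ t).
Proof. by apply: continuous_measurable_fun; exact: continuous_vel. Qed.

Lemma pos_escape (A t : R) : exists A', forall a, A' <= `|a| -> A <= `|y a t|.
Proof.
exists (A + (M + B * `|t| + t ^+ 2 * M)) => a Aa.
have := pos_bound hL a t; have := ler_normB (y a t) (y a t - a).
by rewrite subKr; lra.
Qed.

(* Integration by parts along the characteristics. *)
Lemma Rintegral_parts_pos (g gd psi psid : R -> R) (Kg G C A t : R) :
  lip Kg g -> (forall a, `|g a| <= G) -> measurable_fun setT gd ->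
  (forall a, `|gd a| <= Kg) ->
  (forall a, regular_label X V a -> is_derive a (1 : R) g (gd a)) ->
  (forall x : R, is_derive x (1 : R) psi (psid x)) ->
  (forall x, `|psid x| <= C) -> measurable_fun setT psid ->
  (forall x, `|psi x| <= C) -> (forall x, A <= `|x| -> psi x = 0 /\ psid x = 0) ->
  [/\ mu.-integrable setT (EFin \o (fun a => gd a * psi (y a t))),
      mu.-integrable setT (EFin \o (fun a => g a * psid (y a t) * derive1 (y ^~ t) a)) &
  \int[mu]_a (g a * psid (y a t) * derive1 (y ^~ t) a) =
  - \int[mu]_a (gd a * psi (y a t))].
Proof.
move=> lg gG mgd gdK dg dpsi psidC mpsid psiC psiA.
have cpsi : continuous psi.
  by move=> x; apply: differentiable_continuous; apply/derivable1_diffP; have [] := dpsi x.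
have [A' hA] := pos_escape A t.
have mpsiy : measurable_fun setT (fun a => psi (y a t)).
  apply: (measurableT_comp (continuous_measurable_fun cpsi)); exact: (measurable_pos hL).
have mg : measurable_fun setT g.
  by apply: continuous_measurable_fun; exact: lip_continuous lg.
have i1 : mu.-integrable setT (EFin \o (fun a => gd a * psi (y a t))).
  apply: (integrable_bounded_supp (C := Kg * C) (A := A')).
  - exact: measurable_funM.
  - by move=> a; rewrite normrM ler_pM.
  - by move=> a /hA/psiA[-> _]; rewrite mulr0.
have i2 : mu.-integrable setT (EFin \o (fun a => g a * psid (y a t) * derive1 (y ^~ t) a)).
  apply: (integrable_bounded_supp (C := G * C * lipc t) (A := A')).
  - apply: measurable_funM; last exact: measurable_derive1_pos.
    apply: measurable_funM => //; apply: (measurableT_comp mpsid); exact: (measurable_pos hL).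
  - move=> a; rewrite 2!normrM; apply: ler_pM => //; last exact: dpos1_bound.
    exact: ler_pM.
  - by move=> a /hA/psiA[_ ->]; rewrite mulr0 mul0r.
split => //.
have C0 : 0 <= C by exact: le_trans (normr_ge0 _) (psiC 0).
have Kg0 : 0 <= Kg by exact: le_trans (normr_ge0 _) (gdK 0).
have G0 : 0 <= G by exact: le_trans (normr_ge0 _) (gG 0).
(* W is Lipschitz and compactly supported in the label, so its derivative has zero integral; the
   product and chain rules expand it at regular labels. *)
pose W a := g a * psi (y a t).
have lW : lip (Kg * C + G * (C * lipc t)) W.
  apply: lipM => //; apply: lip_comp => //; first exact: is_derive_lip dpsi psidC.
    exact: (pos_nondecreasing hL).
  exact: (lip_pos hL).
have lc0 := ltW (lipc_gt0 t).
have K0 : 0 < Kg * C + G * (C * lipc t) + 1 by rewrite ltr_wpDl// addr_ge0 ?mulr_ge0.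
have lW' : lip (Kg * C + G * (C * lipc t) + 1) W by apply: lip_le lW; rewrite lerDl.
have W0 a : A' <= `|a| -> W a = 0 by move=> /hA/psiA[h _]; rewrite /W h mulr0.
have := Rintegral_derive1_supp K0 lW' W0.
rewrite (_ : \int[mu]_x derive1 W x =
  \int[mu]_a (g a * psid (y a t) * derive1 (y ^~ t) a + gd a * psi (y a t))).
  by rewrite RintegralD// => h; apply/eqP; rewrite -addr_eq0 h.
congr fine; apply: ae_eq_integral => //.
- by apply/measurable_EFinP; apply: measurable_derive1; exact: lip_continuous lW.
- apply/measurable_EFinP; apply: measurable_funD; apply/measurable_EFinP.
    by case/integrableP: i2.
  by case/integrableP: i1.
have := ae_regular hL; apply: aeS => a ra _; congr EFin.
have d1 := is_derive_pos t ra; have d2 := dg _ ra; have d3 := dpsi (y a t).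
apply: is_derive1_val; rewrite derive1_pos// /W.
have d4 : is_derive a (1 : R) (psi \o (y ^~ t)) (psid (y a t) * dpos X V a t).
  exact: is_derive1_comp.
apply: is_derive_eq.
by rewrite /GRing.scale/=; ring.
Qed.

Lemma integral_eul_dx_sqr t :
  exists2 c : R, (\int[mu]_x (ux x t ^+ 2)%:E = c%:E)%E & c <= M.
Proof.
have E := energy_ac_density hL t measurableT; rewrite /density in E.
have f : energy_ac hL t setT \is a fin_num by exact: fin_num_measure.
have le : (energy_ac hL t setT <= M%:E)%E.
  rewrite -(integral_nrg_dot hL) -[leRHS]/(push_density (y ^~ t) q setT) -(energyE hL).
  rewrite (energy_decomposition hL t measurableT) -addeA leeDl// adde_ge0//.
exists (fine (energy_ac hL t setT)); first by rewrite -E fineK.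
by rewrite -lee_fin fineK.
Qed.

Lemma eul_dx_L2 t : L2 (ux ^~ t).
Proof.
by have [c cE _] := integral_eul_dx_sqr t; exact: L2_sqr (measurable_eul_dx1 hL t) cE.
Qed.

Lemma eul_dx_Linfty : Linfty_L2 ux.
Proof.
rewrite /Linfty_L2.
have [N NE] : exists N, N = (fun t => 'N[mu]_2%:E[EFin \o (ux ^~ t)])%E by eexists.
rewrite -NE unlock; case: ifPn => [_|]; last by rewrite ltry.
apply: (@le_lt_trans _ _ (Num.sqrt M)%:E); last by rewrite ltry.
apply/ess_sup_inf.ess_supP; apply: aeW => t /=.
have [c cE cM] := integral_eul_dx_sqr t.
by rewrite NE (Lnorm2E cE) gee0_abs ?lee_fin ?sqrtr_ge0// ler_wsqrtr.
Qed.

(** Where y_a = 0 both sides vanish, since U_a^2 = y_a q. The default value of u_x is therefore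
    harmless after passing to labels. *)
Lemma eul_dx_steep a t : regular_label X V a ->
  ux (y a t) t * derive1 (y ^~ t) a = dvel X V a t.
Proof.
move=> ra; rewrite derive1_pos//.
have := dpos_ge0 hL t ra; rewrite le_eqVlt => /orP[/eqP/esym d0|d0].
  by rewrite d0 mulr0 (dpos_eq0_dvel ra d0).
by rewrite (eul_dx_pos hL ra d0) divfK// gt_eqF.
Qed.

Lemma test_function_bounds (phi : R -> R) : test_function phi ->
  [/\ forall x : R, is_derive x (1 : R) phi (derive1 phi x),
      continuous (derive1 phi),
      (exists C, forall x, `|phi x| <= C /\ `|derive1 phi x| <= C) &
      exists A, forall x, A <= `|x| -> phi x = 0 /\ derive1 phi x = 0].
Proof.
move=> [Cphi ck]; set K := closure _ in ck.
have [cphi /(_ 1) [dphi cdphi]] := Cphi 1%N.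
have D1 : derive1 phi = 'D_1 phi by apply/funext => x; rewrite derive1E.
have dK x : ~ K x -> derive1 phi x = 0 by rewrite D1; exact: derive_support.
have [C1 C10 h1] := compact_support_bounded ck cphi (@support_out _ _ phi).
have cd1 : continuous (derive1 phi) by rewrite D1.
have [C2 C20 h2] := compact_support_bounded ck cd1 dK.
split.
- by move=> x; exact: derivable_is_derive1.
- exact: cd1.
- exists (C1 + C2) => x; split; first by apply: le_trans (h1 x) _; rewrite lerDl.
  by apply: le_trans (h2 x) _; rewrite lerDr.
have [r [_ Hr]] := compact_bounded ck.
exists (`|r| + 2) => x rx.
have nKx : ~ K x.
  move=> /(Hr (`|r| + 1)) h; have : `|r| + 2 <= `|r| + 1.
    by apply: le_trans rx _; apply: h; rewrite (le_lt_trans (ler_norm r))// ltrDl.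
  by rewrite lerD2l (ler_nat _ 2 1).
by split; [exact: support_out|exact: dK].
Qed.

(** In labels the two integrands are U phi'(y) y_a and, almost everywhere, U_a phi(y); integration
    by parts exchanges them. *)
Lemma weak_derivative_eul t : weak_derivative (u ^~ t) (ux ^~ t).
Proof.
split.
  apply: locally_integrable_sqr; first exact: (measurable_eul_dx1 hL).
  by have [c -> _] := integral_eul_dx_sqr t; rewrite ltry.
move=> phi /test_function_bounds[dphi cdphi [C hC] [A hA]].
have mdphi : measurable_fun setT (derive1 phi) by exact: continuous_measurable_fun.
have mphi : measurable_fun setT phi.
  apply: continuous_measurable_fun => x; apply: differentiable_continuous.
  by apply/derivable1_diffP; have [] := dphi x.
have ml := measurable_eul_dx1 hL t.
have mu_ : measurable_fun setT (u ^~ t).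
  apply: continuous_measurable_fun; exact: (eul_continuous_x hL).
have P := (lipc_gt0 t, lip_pos hL t, pos_nondecreasing hL t, pos_surjective hL t).
rewrite (Rintegral_change_of_variables P.1.1.1 P.1.1.2 P.1.2 P.2 (measurable_funM mu_ mdphi)).
rewrite (Rintegral_change_of_variables P.1.1.1 P.1.1.2 P.1.2 P.2 (measurable_funM ml mphi)).
have [i1 i2 E] := @Rintegral_parts_pos (U ^~ t) (dvel X V ^~ t) phi (derive1 phi)
  (1 + `|t|) (B + `|t| * M) C A t (lip_vel hL t) (vel_bound ^~ t)
  (measurable_dvel hL t) (dvel_bound ^~ t) (fun a ra => is_derive_vel t ra)
  dphi (fun x => (hC x).2) mdphi (fun x => (hC x).1) hA.
have -> : \int[mu]_a (u (y a t) t * derive1 phi (y a t) * derive1 (y ^~ t) a) =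
    \int[mu]_a (U a t * derive1 phi (y a t) * derive1 (y ^~ t) a).
  by apply: eq_Rintegral => a _; rewrite (eulE hL).
rewrite E; congr (- _); congr fine; apply: ae_eq_integral => //.
- by case/integrableP: i1.
- apply/measurable_EFinP; apply: measurable_funM; last exact: measurable_derive1_pos.
  have my := measurable_pos hL t.
  by apply: measurable_funM; [exact: (measurableT_comp ml my)|exact: (measurableT_comp mphi my)].
have := ae_regular hL; apply: aeS => a ra _; congr EFin.
by rewrite -(eul_dx_steep t ra) /=; ring.
Qed.

Lemma weak_dx_eul : weak_dx u ux.
Proof. by split; [exact: (measurable_eul_dx hL)|exact: weak_derivative_eul]. Qed.

Lemma ac_part_density_energy t : ac_part_density (energy hL t) (fun x => ux x t ^+ 2).
Proof.
exists (energy_ac hL t), (energy_pp hL t), (energy_sc hL t).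
split; first exact: (lebesgue_decomposition_energy hL).
exact: (energy_ac_density hL).
Qed.

Lemma energy_density t : ~ [set t | \int[mu]_(x in collapsed X V t) (q x)%:E != 0%E]%E t ->
  same_measure (energy hL t) (density (fun x => ux x t ^+ 2)).
Proof.
move=> /negP/negPn/eqP c0 E mE.
rewrite (energy_decomposition hL t mE) -(energy_ac_density hL t mE).
have pp0 : energy_pp hL t setT = 0%E.
  by apply/eqP; rewrite -measure_le0 -c0 (energy_flat_le hL)// => a; left.
have sc0 : energy_sc hL t setT = 0%E.
  by apply/eqP; rewrite -measure_le0 -c0 (energy_flat_le hL)// => a; right.
have p0 : energy_pp hL t E = 0%E by apply: (subset_measure0 mE measurableT).
have s0 : energy_sc hL t E = 0%E by apply: (subset_measure0 mE measurableT).
by rewrite p0 s0 !adde0.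
Qed.

Lemma energy_total t : energy hL t setT = M%:E.
Proof. by rewrite energyE -(integral_nrg_dot hL). Qed.

(** In labels the measure [q] da is fixed and only the argument of psi moves with time; sup |psi|
    times [q] dominates. *)
Lemma weakly_continuous_energy : weakly_continuous (energy hL).
Proof.
move=> psi [cpsi bpsi] t0.
have [C hC] := bounded_Cb (conj cpsi bpsi).
have mpsi : measurable_fun setT psi by exact: continuous_measurable_fun.
have mq := measurable_nrg_dot hL; have q0 := nrg_dot_ge0 hL.
have E t : \int[energy hL t]_x psi x = \int[mu]_a (psi (y a t) * q a).
  apply: (Rintegral_push (measurable_pos hL t) mq q0) => //.
  by move=> A mA; exact: energyE.
have iq : mu.-integrable setT (EFin \o q).
  apply/integrableP; split; first exact/measurable_EFinP.
  under eq_integral => a _ do rewrite /= ger0_norm ?q0//.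
  by rewrite (integral_nrg_dot hL) ltry.
have iqC : mu.-integrable setT (EFin \o (fun a => C * q a)).
  by have := integrableZl measurableT C iq; apply.
have mpq t : measurable_fun setT (fun a => psi (y a t) * q a).
  by apply: measurable_funM => //; apply: (measurableT_comp mpsi); exact: (measurable_pos hL).
have bpq t a : `|psi (y a t) * q a| <= C * q a.
  by rewrite normrM (ger0_norm (q0 a)) ler_wpM2r.
rewrite (_ : (fun t => _) = (fun t => \int[mu]_a (psi (y a t) * q a))); last exact/funext.
suff H : {in `](t0 - 1), (t0 + 1)[%classic,
    continuous (fun t => \int[mu]_(a in setT) (psi (y a t) * q a))}.
  by apply: H; rewrite inE/= in_itv/= ltrBlDr !ltrDl ltr01.
apply: (continuity_under_integral _ _ _ iqC) => //.
- move=> t _; apply: (le_integrable _ _ _ iqC) => //.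
    by apply/measurable_EFinP; exact: mpq.
  by move=> a _ /=; rewrite lee_fin (le_trans (bpq t a))// ler_norm.
- apply: aeW => a _ t _; apply: cvgMl; apply: continuous_comp; last exact: cpsi.
  apply: cvgD; last by apply: cvgMl; apply: cvgMl; apply: exprn_continuous.
  by apply: cvgD; [exact: cvg_cst|apply: cvgMr; exact: cvg_id].
- by move=> t _; apply: aeW => a _; exact: bpq.
Qed.

End lagrangian_weak.

(** * The weak equations *)

Section plane_topology.
Context {R : realType}.

(** An open set is the countable union of the squares with rational centre and radius 1/(n+1) that
    it contains. *)
Lemma measurable_open2 (O : set (R * R)) : open O -> measurable O.
Proof.
move=> oO.
pose box (k : rat * rat * nat) : set (R * R) :=
  ball (ratr k.1.1 : R) k.2.+1%:R^-1 `*` ball (ratr k.1.2 : R) k.2.+1%:R^-1.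
pose G k := if `[< box k `<=` O >] then box k else set0.
have -> : O = \bigcup_k G k.
  apply/seteqP; split => [z Oz|z [k _]]; last first.
    by rewrite /G; case: ifPn => // /asboolP; exact.
  move: oO; rewrite openE => /(_ _ Oz)/nbhs_ballP[e /= e0 eO].
  (* Twice the radius is below e: one radius from z to the rational centre, one from the centre to
     any point of the square. *)
  pose n := Num.Def.archi_bound (2 / e).
  have ne : n.+1%:R^-1 * 2 < e.
    have := unstable.ltr_bound (2 / e); rewrite -/n ltr_pdivrMr// => h.
    rewrite mulrC ltr_pdivrMr// (lt_le_trans h)// mulrC ler_pM2l// ler_nat//.
  have n0 : 0 < n.+1%:R^-1 :> R by rewrite invr_gt0.
  have rat_close (x : R) : exists q : rat, `|ratr q - x| < n.+1%:R^-1.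
    have [|r [xr [q _ qr]]] := dense_rat (_ : ball x n.+1%:R^-1 !=set0) (ball_open _ _).
      by exists x; exact: ballxx.
    by exists q; rewrite qr distrC.
  have [q1 h1] := rat_close z.1; have [q2 h2] := rat_close z.2.
  exists (q1, q2, n) => //; rewrite /G ifT; first by split.
  apply/asboolP => w [w1 w2]; apply: eO; rewrite /ball/= in w1 w2.
  move: ne h1 h2 w1 w2; move: (n.+1%:R^-1 : R) => r ne h1 h2 w1 w2.
  split; rewrite /ball/=.
    have -> : z.1 - w.1 = - (ratr q1 - z.1) + (ratr q1 - w.1) by ring.
    by rewrite (le_lt_trans (ler_normD _ _))// normrN; lra.
  have -> : z.2 - w.2 = - (ratr q2 - z.2) + (ratr q2 - w.2) by ring.
  by rewrite (le_lt_trans (ler_normD _ _))// normrN; lra.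
apply: countable_bigcupT_measurable; first exact: countableP.
move=> k; rewrite /G; case: ifP => _; last exact: measurable0.
by apply: measurableX; exact: measurable_ball.
Qed.

Lemma measurable_continuous2 (f : R * R -> R) : continuous f -> measurable_fun setT f.
Proof.
move=> cf; apply: (measurability (@RGenOInfty.G R)) => [|/= _ [_] [c] -> <-].
  exact: RGenOInfty.measurableE.
rewrite setTI; apply: measurable_open2; apply: open_comp => [z _|]; first exact: cf.
exact: interval_open.
Qed.

Lemma measurable_compact2 (K : set (R * R)) : compact K -> measurable K.
Proof.
move=> cK; rewrite -(setCK K); apply: measurableC; apply: measurable_open2.
by apply: closed_openC; apply: compact_closed => //; exact: norm_hausdorff.
Qed.

Lemma is_derive_x (phi : R * R -> R) (x t : R) : derivable phi (x, t) (1, 0) ->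
  is_derive x (1 : R) (fun x => phi (x, t)) (Dx phi x t).
Proof.
move=> d; apply: is_derive_quotient.
rewrite (_ : (fun h => _) =
  (fun h : R => h^-1 *: ((phi \o shift (x, t)) (h *: ((1, 0) : R * R)) - phi (x, t)))).
  exact: d.
apply/funext => h /=; congr (_ * (phi _ - _)).
have -> : h *: ((1, 0) : R * R) + (x, t) = (h * 1 + x, h * 0 + t) by [].
by rewrite mulr1 mulr0 add0r.
Qed.

Lemma is_derive_t (phi : R * R -> R) (x t : R) : derivable phi (x, t) (0, 1) ->
  is_derive t (1 : R) (fun t => phi (x, t)) (Dt phi x t).
Proof.
move=> d; apply: is_derive_quotient.
rewrite (_ : (fun h => _) =
  (fun h : R => h^-1 *: ((phi \o shift (x, t)) (h *: ((0, 1) : R * R)) - phi (x, t)))).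
  exact: d.
apply/funext => h /=; congr (_ * (phi _ - _)).
have -> : h *: ((0, 1) : R * R) + (x, t) = (h * 0 + x, h * 1 + t) by [].
by rewrite mulr1 mulr0 add0r.
Qed.

(* Only [Dx phi] needs to be continuous: it controls the increment of [phi] in
   the first variable at the displaced time. *)
Lemma is_derive_along (phi : R * R -> R) (g : R -> R) (t l : R) :
  (forall z, derivable phi z (1, 0)) -> (forall z, derivable phi z (0, 1)) ->
  continuous (fun z : R * R => Dx phi z.1 z.2) ->
  is_derive t (1 : R) g l ->
  is_derive t (1 : R) (fun s => phi (g s, s)) (Dx phi (g t) t * l + Dt phi (g t) t).
Proof.
move=> dx dt cDx gl; apply: is_derive_quotient.
set D := Dx phi (g t) t.
have [dg _] := gl; have lE := is_derive1_val gl.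
have cg := derivable_derive1_cvg dg; rewrite lE in cg.
have ct : h^-1 * (phi (g t, h + t) - phi (g t, t)) @[h --> 0^'] --> Dt phi (g t) t.
  have H := is_derive_t (dt (g t, t)); have [d _] := H.
  by have := derivable_derive1_cvg d; rewrite (is_derive1_val H).
have cx : h^-1 * (phi (g (h + t), h + t) - phi (g t, h + t)) @[h --> 0^'] --> D * l.
  have cDl : D * (h^-1 * (g (h + t) - g t)) @[h --> 0^'] --> D * l by exact: cvgMr.
  apply/cvgrPdist_le => e e0.
  (* The quotients of g near t are bounded by |l| + 1, which this tolerance on the oscillation of
     [Dx phi] compensates. *)
  pose e1 := e / 2 / (`|l| + 1).
  have l0 : 0 < `|l| + 1 by rewrite ltr_wpDl.
  have e10 : 0 < e1 by rewrite !divr_gt0.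
  have e20 : 0 < e / 2 by rewrite divr_gt0.
  have : \forall z \near ((g t, t) : R * R), `|D - Dx phi z.1 z.2| < e1.
    by move/cvgrPdist_lt : (cDx (g t, t)) => /(_ _ e10).
  move=> /nbhs_ballP[d /= d0 Hd].
  have cg0 : g (h + t) @[h --> 0^'] --> g t.
    have cgt : {for t, continuous g}.
      by have /derivable1_diffP/differentiable_continuous := dg.
    apply: (cvg_comp (fun h : R => h + t) g _ cgt).
    have : h + t @[h --> 0^'] --> (0 + t : R).
      by apply: cvgD; [exact: cvg_within|exact: cvg_cst].
    by rewrite add0r.
  suff : \forall h \near 0^', `|D * l - h^-1 * (phi (g (h + t), h + t) - phi (g t, h + t))| <= e.
    by [].
  move/cvgrPdist_lt : cDl => /(_ _ e20) n1.
  move/cvgrPdist_lt : cg => /(_ _ ltr01) n2.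
  move/cvgrPdist_lt : cg0 => /(_ _ d0) n3.
  near=> h.
  have h0 : h != 0 by near: h; exact: nbhs_dnbhs_neq.
  have hd : `|h| < d by near: h; exact: dnbhs0_lt.
  have k1 : `|D * l - D * (h^-1 * (g (h + t) - g t))| < e / 2.
    by near: h; exact: n1.
  have k2 : `|l - h^-1 * (g (h + t) - g t)| < 1.
    by near: h; exact: n2.
  have k3 : `|g t - g (h + t)| < d by near: h; exact: n3.
  (* With the linear part removed, the mean value theorem bounds the increment of F by the
     oscillation of [Dx phi] around (g t, t). *)
  pose F x := phi (x, h + t) - D * x.
  have dF (x : R) : is_derive x (1 : R) F (Dx phi x (h + t) - D).
    have H := is_derive_x (dx (x, h + t)).
    apply: is_derive_eq; by rewrite /GRing.scale/= mulr1.
  have FF : `|F (g (h + t)) - F (g t)| <= e1 * `|g (h + t) - g t|.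
    have aux (a b : R) : a < b -> `|g t - a| < d -> `|g t - b| < d ->
        `|F b - F a| <= e1 * `|b - a|.
      move=> ab ta tb; have [c /andP[ac cb] ->] := MVT_is_derive dF ab.
      rewrite normrM ler_wpM2r// distrC; apply/ltW.
      apply: (Hd (c, h + t)); split; rewrite /ball/=.
        by move: ta tb; rewrite !ltr_norml; lra.
      by rewrite opprD addrCA subrr addr0 normrN.
    have [ab|ab|->] := ltgtP (g t) (g (h + t)).
    - by apply: aux => //; rewrite subrr normr0.
    - by rewrite distrC [X in _ * X]distrC; apply: aux => //; rewrite subrr normr0.
    - by rewrite !subrr normr0 mulr0.
  have -> : D * l - h^-1 * (phi (g (h + t), h + t) - phi (g t, h + t)) =
     (D * l - D * (h^-1 * (g (h + t) - g t))) - h^-1 * (F (g (h + t)) - F (g t)).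
    by rewrite /F; ring.
  rewrite (le_trans (ler_normB _ _))// [leRHS]splitr lerD//; first exact: ltW.
  rewrite normrM.
  have k4 : `|h^-1 * (g (h + t) - g t)| <= `|l| + 1.
    have -> : h^-1 * (g (h + t) - g t) = l - (l - h^-1 * (g (h + t) - g t)) by ring.
    by rewrite (le_trans (ler_normB _ _))// lerD2l ltW.
  rewrite (le_trans (ler_wpM2l (normr_ge0 _) FF))// mulrCA -normrM.
  by apply: (le_trans (ler_wpM2l (ltW e10) k4)); rewrite /e1 divfK// gt_eqF.
rewrite (_ : (fun h => h^-1 * (phi (g (h + t), h + t) - phi (g t, t))) = (fun h =>
  h^-1 * (phi (g (h + t), h + t) - phi (g t, h + t)) +
  h^-1 * (phi (g t, h + t) - phi (g t, t)))); first exact: cvgD cx ct.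
by apply/funext => h; ring.
Unshelve. all: by end_near. Qed.


Notation mT := (measurableTypeR R).
Notation mu := (@lebesgue_measure R).
Notation mu2 := (mu \x mu)%E.

Lemma test_function2_bounds (phi : R * R -> R) : test_function phi ->
  [/\ continuous phi,
      continuous (fun z : R * R => Dx phi z.1 z.2),
      continuous (fun z : R * R => Dt phi z.1 z.2),
      (forall z, derivable phi z (1, 0)) /\ (forall z, derivable phi z (0, 1)) &
      exists A C, [/\ 0 <= A, 0 <= C,
        (forall x t, [/\ `|phi (x, t)| <= C, `|Dx phi x t| <= C & `|Dt phi x t| <= C]) &
        (forall x t, A <= `|x| \/ A <= `|t| ->
           [/\ phi (x, t) = 0, Dx phi x t = 0 & Dt phi x t = 0])]].
Proof.
move=> [Cphi ck]; set K := closure _ in ck.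
have [cphi dphi] := Cphi 1%N.
have [dx cdx] := dphi (1, 0); have [dt cdt] := dphi (0, 1).
have DxE : (fun z : R * R => Dx phi z.1 z.2) = 'D_(1, 0) phi by apply/funext => -[].
have DtE : (fun z : R * R => Dt phi z.1 z.2) = 'D_(0, 1) phi by apply/funext => -[].
have [C0 C00 h0] := compact_support_bounded ck cphi (@support_out _ _ phi).
have [C1 C10 h1] := compact_support_bounded ck cdx (fun z => @derive_support _ _ phi z (1, 0)).
have [C2 C20 h2] := compact_support_bounded ck cdt (fun z => @derive_support _ _ phi z (0, 1)).
have cDx : continuous (fun z : R * R => Dx phi z.1 z.2) by rewrite DxE; exact: cdx.
have cDt : continuous (fun z : R * R => Dt phi z.1 z.2) by rewrite DtE; exact: cdt.
split; [exact: cphi|exact: cDx|exact: cDt|split; [exact: dx|exact: dt]|].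
have [r [_ Hr]] := compact_bounded ck.
exists (`|r| + 2), (C0 + C1 + C2); split; first by rewrite addr_ge0.
- by rewrite !addr_ge0.
- move=> x t; split.
  + by apply: le_trans (h0 (x, t)) _; rewrite -addrA lerDl addr_ge0.
  + by apply: le_trans (h1 (x, t)) _; rewrite addrAC lerDr addr_ge0.
  + by apply: le_trans (h2 (x, t)) _; rewrite lerDr addr_ge0.
move=> x t xt; have nK : ~ K (x, t).
  move=> /(Hr (`|r| + 1)) h; have {}h : `|(x, t)| <= `|r| + 1.
    by apply: h; rewrite (le_lt_trans (ler_norm r))// ltrDl.
  have : `|r| + 2 <= `|(x, t)|.
    by rewrite [leRHS]/(Num.max _ _) le_max; apply/orP; case: xt; [left|right].
  by move=> /le_trans /(_ h); rewrite lerD2l (ler_nat _ 2 1).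
split; [exact: support_out|exact: derive_support|exact: derive_support].
Qed.

(** The inner integral is finite for almost every x, so applying [fine] to it does not change the
    outer integral. *)
Lemma Rfubini (f : R * R -> R) : mu2.-integrable setT (EFin \o f) ->
  \int[mu]_x \int[mu]_t f (x, t) = \int[mu2]_z f z.
Proof.
move=> fi; rewrite /Rintegral -(integral12_prod_meas1 fi); congr fine.
apply: ae_eq_integral => //.
- apply/measurable_EFinP; apply: measurableT_comp => //.
  exact: measurable_fubini_F fi.
- exact: measurable_fubini_F fi.
have := integrable_ae measurableT (integrable_fubini_F fi).
by apply: aeS => x /(_ Logic.I) h _; rewrite -[RHS]fineK.
Qed.

Lemma Rfubini_sym (f : R * R -> R) : mu2.-integrable setT (EFin \o f) ->
  \int[mu]_t \int[mu]_x f (x, t) = \int[mu2]_z f z.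
Proof.
move=> fi; rewrite /Rintegral -(integral21_prod_meas1 fi); congr fine.
have /integrableP[mf _] := fi.
have mG := measurable_fubini_G fi.
apply: ae_eq_integral => //.
  by apply/measurable_EFinP; apply: measurableT_comp.
have iG : mu.-integrable setT (fubini_G mu (EFin \o f)).
  apply/integrableP; split => //.
  have /(integrable21ltyP mu mu mf) := fi; apply: le_lt_trans.
  apply: ge0_le_integral => //.
  - exact: measurableT_comp.
  - have maf : measurable_fun setT (abse \o (EFin \o f)) by exact: measurableT_comp.
    by have := @measurable_fun_fubini_tonelli_G _ _ mT mT R mu _ maf (fun z => abse_ge0 _).
  - move=> t _; apply: le_abse_integral => //.
    exact: (measurableT_comp mf (pair2_measurable t)).
have := integrable_ae measurableT iG.
by apply: aeS => x /(_ Logic.I) h _; rewrite -[RHS]fineK.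
Qed.

Lemma Rfubini_swap (f : R * R -> R) : mu2.-integrable setT (EFin \o f) ->
  \int[mu]_t \int[mu]_x f (x, t) = \int[mu]_x \int[mu]_t f (x, t).
Proof. by move=> fi; rewrite Rfubini_sym// Rfubini. Qed.

Lemma integrable_bounded_supp2 (f : R * R -> R) (C A : R) : measurable_fun setT f ->
  (forall x t, `|f (x, t)| <= C) ->
  (forall x t, A <= `|x| \/ A <= `|t| -> f (x, t) = 0) ->
  mu2.-integrable setT (EFin \o f).
Proof.
move=> mf fC fA; have mf' : measurable_fun setT (EFin \o f) by exact/measurable_EFinP.
have C0 : 0 <= C by exact: le_trans (normr_ge0 _) (fC 0 0).
pose I : set mT := `[- A, A]%classic; pose Q : set (mT * mT) := I `*` I.
have mI : measurable I by exact: measurable_itv.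
have mQ : measurable Q by exact: measurableX.
have lI : (mu I < +oo)%E by exact: leb_itv_lty.
have lQ : (mu2 Q < +oo)%E.
  have -> : mu2 Q = (mu I * mu I)%E by exact: product_measure1E.
  by rewrite lte_mul_pinfty// ge0_fin_numE.
have nI x : ~ I x -> A <= `|x|.
  by move=> nIx; rewrite leNgt; apply/negP => h; apply: nIx; rewrite /I/= in_itv/= -ler_norml ltW.
have fb z : `|f z| <= C * \1_Q z.
  rewrite indicE; have [_|] := boolP (z \in Q).
    by rewrite mulr1; case: z => x t; exact: fC.
  rewrite notin_setE => /not_andP nQ; rewrite mulr0.
  case: z nQ => x t /= nQ; rewrite fA ?normr0//.
  by case: nQ => /nI; [left|right].
have m1 : measurable_fun setT (EFin \o (\1_Q : mT * mT -> R)).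
  by apply/measurable_EFinP; exact: measurable_indic.
apply/integrableP; split => //.
apply: (@le_lt_trans _ _ (\int[mu2]_z (C%:E * (EFin \o \1_Q) z))%E).
  apply: ge0_le_integral => //.
  - by apply: measurableT_comp.
  - by apply: measurable_funeM.
  - by move=> z _; rewrite /= lee_fin.
rewrite ge0_integralZl//; last by move=> z _; rewrite lee_fin indicE.
by rewrite integral_indic// setIT lte_mul_pinfty// lee_fin.
Qed.

End plane_topology.

Lemma Rintegral_supp_derive {R : realType} (h h' : R -> R) (C A : R) :
  (forall t : R, is_derive t (1 : R) h (h' t)) -> (forall t, `|h' t| <= C) ->
  (forall t, A <= `|t| -> h t = 0) -> \int[@lebesgue_measure R]_t h' t = 0.
Proof.
move=> dh hC hA; have C0 : 0 <= C by exact: le_trans (normr_ge0 _) (hC 0).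
have K0 : 0 < C + 1 by rewrite ltr_wpDl.
have lh : lip (C + 1) h by apply: lip_le (is_derive_lip dh hC); rewrite lerDl.
rewrite -(Rintegral_derive1_supp K0 lh hA); apply: eq_Rintegral => t _.
by rewrite (is_derive1_val (dh t)).
Qed.

(** * Energy and momentum equations in label coordinates *)

Section lagrangian_equations.
Context {R : realType}.
Notation mT := (measurableTypeR R).
Notation mu := (@lebesgue_measure R).
Notation mu2 := (mu \x mu)%E.
Variables (X V : R -> R) (M B : R).
Hypothesis hL : lagrangian X V M B.

Local Notation y := (pos X V).
Local Notation U := (vel X V).
Local Notation q := (nrg_dot X).
Local Notation u := (eul X V).
Local Notation ux := (eul_dx X V).
Local Notation dp := (dpos X V).
Local Notation dv := (dvel X V).

(** The last label makes the cumulative energy include the atom at x, in agreement with the closed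
    ray in [F]. *)
Definition cum (x t : R) : R := nrg X (lab2 X V x t).
(** The value of u_t prescribed by the first equation, - u u_x + F/2. *)
Definition eul_dt (z : R * R) : R :=
  - (u z.1 z.2 * ux z.1 z.2 - 2^-1 * cum z.1 z.2).

Lemma F_energy x t : F (energy hL) x t = cum x t.
Proof.
rewrite /F energyE /push_density /pushforward /density.
rewrite (_ : (y ^~ t) @^-1` _ = `]-oo, lab2 X V x t]%classic).
  by rewrite (integral_nrg_dot_ray hL).
by apply/seteqP; split => a; rewrite /= !in_itv/= (lab2_ge hL).
Qed.

Lemma is_derive_pos_dt a (t : R) : is_derive t (1 : R) (y a) (U a t).
Proof.
rewrite /pos /vel; apply: is_derive_eq.
by rewrite /GRing.scale/=; field.
Qed.

Lemma is_derive_vel_dt a (t : R) : is_derive t (1 : R) (U a) (2^-1 * nrg X a).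
Proof.
rewrite /vel; apply: is_derive_eq.
by rewrite /GRing.scale/=; field.
Qed.

Lemma is_derive_dpos_dt a (t : R) : is_derive t (1 : R) (dp a) (dv a t).
Proof.
rewrite /dpos /dvel; apply: is_derive_eq.
by rewrite /GRing.scale/=; field.
Qed.

Lemma measurable_pos_2d : measurable_fun setT (fun z : R * R => y z.1 z.2).
Proof.
have m1 (g : R -> R) : continuous g -> measurable_fun setT (fun z : R * R => g z.1).
  by move=> mg; apply: measurableT_comp => //; exact: continuous_measurable_fun.
apply: measurable_funD; last first.
  apply: measurable_funM; last by apply: m1; exact: (continuous_nrg hL).
  by apply: measurable_funM => //; exact: measurable_funX.
apply: measurable_funD; first by apply: m1; exact: slow_continuous (lag_slow hL).
by apply: measurable_funM => //; apply: m1; exact: (continuous_V hL).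
Qed.

Lemma measurable_vel_2d : measurable_fun setT (fun z : R * R => U z.1 z.2).
Proof.
have m1 (g : R -> R) : continuous g -> measurable_fun setT (fun z : R * R => g z.1).
  by move=> mg; apply: measurableT_comp => //; exact: continuous_measurable_fun.
apply: measurable_funD; first by apply: m1; exact: (continuous_V hL).
apply: measurable_funM; last by apply: m1; exact: (continuous_nrg hL).
exact: measurable_funM.
Qed.

Lemma measurable_cum : measurable_fun setT (fun z : R * R => cum z.1 z.2).
Proof.
apply: (measurableT_comp (continuous_measurable_fun (continuous_nrg hL))).
exact: (measurable_lab2_2d hL).
Qed.

Lemma measurable_eul_dt : measurable_fun setT eul_dt.
Proof.
apply: measurable_funN; apply: measurable_funB.
  by apply: measurable_funM; [exact: (measurable_eul hL)|exact: (measurable_eul_dx hL)].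
by apply: measurable_funM => //; exact: measurable_cum.
Qed.

Lemma cum_bound x t : 0 <= cum x t <= M.
Proof. exact: lag_nrg hL _. Qed.

Lemma pos_escape2 (A a t : R) : `|t| <= A ->
  A + (M + B * A + A ^+ 2 * M) <= `|a| -> A <= `|y a t|.
Proof.
move=> tA; have := pos_bound hL a t; have := ler_normB (y a t) (y a t - a).
rewrite subKr; have M0 := M_ge0 hL; have B0 := B_ge0 hL.
have A0 : 0 <= A by exact: le_trans tA.
have h1 : B * `|t| <= B * A by rewrite ler_wpM2l.
have h2 : t ^+ 2 * M <= A ^+ 2 * M.
  by rewrite ler_wpM2r// -(real_normK (num_real t)) lerXn2r ?nnegrE.
by move: h1 h2; lra.
Qed.

Lemma lipc_le (A t : R) : `|t| <= A -> lipc t <= lipc A.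
Proof.
move=> tA; have A0 : 0 <= A by exact: le_trans tA.
rewrite /lipc (ger0_norm A0) -[t ^+ 2](real_normK (num_real t)).
by rewrite !lerD// lerXn2r ?nnegrE.
Qed.

Lemma dpos_bound a t : `|dp a t| <= lipc t.
Proof.
rewrite /dpos /lipc (le_trans (ler_normD _ _))// lerD//.
  rewrite (le_trans (ler_normD _ _))// lerD//.
    by have /andP[p0 p1] := dX_bounds hL a; rewrite ger0_norm.
  by rewrite normrM ler_piMl// (dV_bound hL).
have /andP[q0 q1] := nrg_dot_bounds hL a; have := sqr_ge0 t.
move: q0 q1; move: (q a) (t ^+ 2) => b s b0 b1 s0.
by rewrite ger0_norm ?mulr_ge0 ?divr_ge0//; nra.
Qed.

Section test.
Variables (phi : R * R -> R) (A C : R).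
Hypotheses (cphi : continuous phi)
  (cDx : continuous (fun z : R * R => Dx phi z.1 z.2))
  (cDt : continuous (fun z : R * R => Dt phi z.1 z.2))
  (dx : forall z, derivable phi z (1, 0)) (dt : forall z, derivable phi z (0, 1))
  (A0 : 0 <= A) (C0 : 0 <= C)
  (phiC : forall x t, [/\ `|phi (x, t)| <= C, `|Dx phi x t| <= C & `|Dt phi x t| <= C])
  (phiA : forall x t, A <= `|x| \/ A <= `|t| ->
     [/\ phi (x, t) = 0, Dx phi x t = 0 & Dt phi x t = 0]).

Let mphi := measurable_continuous2 cphi.
Let mDx := measurable_continuous2 cDx.
Let mDt := measurable_continuous2 cDt.

Let along (f : R * R -> R) : measurable_fun setT f ->
  measurable_fun setT (fun z : R * R => f (y z.1 z.2, z.2)).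
Proof.
move=> mf; apply: (measurableT_comp mf).
by apply: measurable_fun_pair => //; exact: measurable_pos_2d.
Qed.

Let mphiy := along mphi.
Let mDxy := along mDx.
Let mDty := along mDt.

(** Radius of the support in the variables (a, t): for |t| <= A positions differ from labels by at
    most the bracket. *)
Let A' := A + (M + B * A + A ^+ 2 * M).

Let A_le_A' : A <= A'.
Proof.
have M0 := M_ge0 hL; have B0 := B_ge0 hL.
by rewrite /A' lerDl !addr_ge0// ?mulr_ge0// sqr_ge0.
Qed.

Let phiyA a t : A' <= `|a| \/ A' <= `|t| ->
  [/\ phi (y a t, t) = 0, Dx phi (y a t) t = 0 & Dt phi (y a t) t = 0].
Proof.
move=> H; apply: phiA; have [At|tA] := leP A `|t|; [by right|left].
case: H => [h|h]; first exact: pos_escape2 (ltW tA) h.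
by have := le_trans A_le_A' h; rewrite leNgt tA.
Qed.

Let A'0 : 0 <= A'. Proof. exact: le_trans A_le_A'. Qed.

Let Bv := B + A' * M.

Let Bv0 : 0 <= Bv.
Proof. by rewrite addr_ge0 ?mulr_ge0 ?(M_ge0 hL) ?(B_ge0 hL). Qed.

Let vel_le a t : `|t| <= A' -> `|U a t| <= Bv.
Proof.
move=> tA; apply: le_trans (vel_bound hL a t) _.
by rewrite lerD2l ler_wpM2r// (M_ge0 hL).
Qed.

(* d/dt (phi (y(a,t), t)) *)
Let Dphi a t := Dx phi (y a t) t * U a t + Dt phi (y a t) t.

Let is_derive_phiy a (t : R) : is_derive t (1 : R) (fun t => phi (y a t, t)) (Dphi a t).
Proof. exact: is_derive_along dx dt cDx (is_derive_pos_dt a t). Qed.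

Let Dphi_bound a t : `|t| <= A' -> `|Dphi a t| <= C * Bv + C.
Proof.
move=> tA; have [_ h1 h2] := phiC (y a t) t.
rewrite /Dphi (le_trans (ler_normD _ _))// lerD// normrM ler_pM//.
exact: vel_le.
Qed.

Let Dphi_supp a t : A' <= `|a| \/ A' <= `|t| -> Dphi a t = 0.
Proof. by move=> /phiyA[_ e1 e2]; rewrite /Dphi e1 e2 mul0r addr0. Qed.

Let measurable_Dphi : measurable_fun setT (fun z : R * R => Dphi z.1 z.2).
Proof.
apply: measurable_funD; last exact: mDty.
by apply: measurable_funM; [exact: mDxy|exact: measurable_vel_2d].
Qed.

Let CD0 : 0 <= C * Bv + C. Proof. by rewrite addr_ge0 ?mulr_ge0. Qed.

Let integral_Dphi a : \int[mu]_t Dphi a t = 0.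
Proof.
apply: (Rintegral_supp_derive (is_derive_phiy a) (C := C * Bv + C) (A := A')).
  move=> t; have [At|/ltW tA] := leP A' `|t|; last exact: Dphi_bound.
  by rewrite Dphi_supp ?normr0//; right.
by move=> t At; have [] := @phiyA a t (or_intror At).
Qed.

Lemma energy_equation_supp :
  \int[mu]_t (\int[energy hL t]_x (Dt phi x t + u x t * Dx phi x t)) = 0.
Proof.
have mq := measurable_nrg_dot hL; have q0 := nrg_dot_ge0 hL.
have E t : \int[energy hL t]_x (Dt phi x t + u x t * Dx phi x t) =
    \int[mu]_a (Dphi a t * q a).
  rewrite (Rintegral_push (measurable_pos hL t) mq q0); last 2 first.
  - by move=> F mF; exact: energyE.
  - apply: measurable_funD; first exact: (measurableT_comp mDt (pair2_measurable t)).
    apply: measurable_funM.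
      by apply: continuous_measurable_fun; exact: (eul_continuous_x hL).
    exact: (measurableT_comp mDx (pair2_measurable t)).
  apply: eq_Rintegral => a _; rewrite (eulE hL) /Dphi; congr (_ * _); ring.
under eq_Rintegral do rewrite E.
rewrite (@Rfubini_swap _ (fun z => Dphi z.1 z.2 * q z.1)); last first.
  apply: (integrable_bounded_supp2 (C := C * Bv + C) (A := A')).
  - by apply: measurable_funM => //; exact: measurableT_comp.
  - move=> a t /=; have [At|/ltW tA] := leP A' `|t|.
      by rewrite Dphi_supp ?mul0r ?normr0//; right.
    have /andP[_ q1] := nrg_dot_bounds hL a.
    by rewrite normrM (ger0_norm (q0 a)) (le_trans (ler_piMr _ q1))// Dphi_bound.
  - by move=> a t /= /Dphi_supp ->; rewrite mul0r.
rewrite /Rintegral integral0_eq// => a _; congr EFin.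
rewrite -[LHS]/(\int[mu]_t (Dphi a t * q a)) RintegralZr ?integral_Dphi ?mul0r//.
apply: (integrable_bounded_supp (C := C * Bv + C) (A := A')) => [|t|t h].
- exact: (measurableT_comp measurable_Dphi (pair1_measurable a)).
- have [At|/ltW tA] := leP A' `|t|; last exact: Dphi_bound.
  by rewrite Dphi_supp ?normr0//; right.
- by rewrite Dphi_supp//; right.
Qed.

(* d/dt (U phi(y, t) y_a) *)
Let K1 a t := 2^-1 * nrg X a * phi (y a t, t) * dp a t + U a t * Dphi a t * dp a t
  + U a t * phi (y a t, t) * dv a t.

Let is_derive_K1 a (t : R) :
  is_derive t (1 : R) (fun t => U a t * phi (y a t, t) * dp a t) (K1 a t).
Proof.
have d1 := is_derive_phiy a t; have d2 := is_derive_vel_dt a t.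
have d3 := is_derive_dpos_dt a t.
apply: is_derive_eq; rewrite /K1 /GRing.scale/=; ring.
Qed.

Let K := 2^-1 * M * C * lipc A' + Bv * (C * Bv + C) * lipc A' + Bv * C * (1 + A').

Let K1_bound a t : `|t| <= A' -> `|K1 a t| <= K.
Proof.
move=> tA; have [h0 _ _] := phiC (y a t) t.
have hd : `|dp a t| <= lipc A' by exact: le_trans (dpos_bound a t) (lipc_le tA).
have hv : `|dv a t| <= 1 + A' by apply: le_trans (dvel_bound hL a t) _; rewrite lerD2l.
have hu := vel_le a tA; have hD := Dphi_bound a tA.
have /andP[n0 nM] : 0 <= nrg X a <= M := lag_nrg hL a.
rewrite /K1 /K (le_trans (ler_normD _ _))// lerD//; last first.
  by rewrite 2!normrM; apply: ler_pM => //; exact: ler_pM.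
rewrite (le_trans (ler_normD _ _))// lerD//.
  rewrite 2!normrM; apply: ler_pM => //; apply: ler_pM => //.
  by rewrite ger0_norm ?mulr_ge0// ler_wpM2l.
by rewrite 2!normrM; apply: ler_pM => //; exact: ler_pM.
Qed.

Let K1_supp a t : A' <= `|a| \/ A' <= `|t| -> K1 a t = 0.
Proof.
move=> h; have [e _ _] := phiyA h; rewrite /K1 e Dphi_supp//; ring.
Qed.

Let K_ge0 : 0 <= K.
Proof. by apply: le_trans (normr_ge0 _) (@K1_bound 0 0 _); rewrite normr0. Qed.

Let integral_K1 a : \int[mu]_t K1 a t = 0.
Proof.
apply: (Rintegral_supp_derive (is_derive_K1 a) (C := K) (A := A')).
  move=> t; have [At|/ltW tA] := leP A' `|t|; last exact: K1_bound.
  by rewrite K1_supp ?normr0//; right.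
move=> t At; have [-> _ _] := @phiyA a t (or_intror At).
by rewrite mulr0 mul0r.
Qed.

Let measurable_K1 : measurable_fun setT (fun z : R * R => K1 z.1 z.2).
Proof.
have m1 : measurable_fun setT (fun z : R * R => nrg X z.1).
  by apply: measurableT_comp => //; apply: continuous_measurable_fun; exact: (continuous_nrg hL).
have m2 := measurable_dpos_2d hL; have m3 := measurable_dvel_2d hL.
have m4 := measurable_vel_2d.
apply: measurable_funD; last by apply: measurable_funM => //; exact: measurable_funM.
apply: measurable_funD; apply: measurable_funM => //; apply: measurable_funM => //.
exact: measurable_funM.
Qed.

Let K1_all a t : `|K1 a t| <= K.
Proof.
have [At|/ltW tA] := leP A' `|t|; last exact: K1_bound.
by rewrite K1_supp ?normr0//; right.
Qed.

Let integrable_K1 : mu2.-integrable setT (EFin \o (fun z : R * R => K1 z.1 z.2)).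
Proof. exact: integrable_bounded_supp2 measurable_K1 K1_all K1_supp. Qed.

Let integrable_K1t t : mu.-integrable setT (EFin \o (K1 ^~ t)).
Proof.
apply: (integrable_bounded_supp (C := K) (A := A')) => [|a|a h].
- exact: (measurableT_comp measurable_K1 (pair2_measurable t)).
- exact: K1_all.
- by rewrite K1_supp//; left.
Qed.

Definition momentum (x t : R) : R :=
  u x t * Dt phi x t - phi (x, t) * (u x t * ux x t - 2^-1 * cum x t).

Let measurable_momentum : measurable_fun setT (fun z : R * R => momentum z.1 z.2).
Proof.
have m1 := measurable_eul hL; have m2 := measurable_eul_dx hL.
have m3 := measurable_cum.
apply: measurable_funB; first exact: measurable_funM.
apply: measurable_funM.
  by rewrite (_ : (fun z : R * R => _) = phi)//; apply/funext => -[].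
apply: measurable_funB; exact: measurable_funM.
Qed.

(** In labels the momentum integrand is [K1] minus the derivative in a of U^2 phi(y, t), whose
    integral vanishes by [Rintegral_parts_pos] with g = U^2. *)
Let integral_momentum t : \int[mu]_x momentum x t = \int[mu]_a K1 a t.
Proof.
have P := (lipc_gt0 t, lip_pos hL t, pos_nondecreasing hL t, pos_surjective hL t).
have mm : measurable_fun setT (momentum ^~ t).
  exact: (measurableT_comp measurable_momentum (pair2_measurable t)).
rewrite (Rintegral_change_of_variables P.1.1.1 P.1.1.2 P.1.2 P.2 mm).
pose bv := B + `|t| * M.
have bv0 : 0 <= bv by rewrite addr_ge0 ?mulr_ge0 ?(M_ge0 hL) ?(B_ge0 hL).
pose kg := (1 + `|t|) * bv + bv * (1 + `|t|).
have lg : lip kg (fun a => U a t ^+ 2).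
  by apply: (lipM (lip_vel hL t) (lip_vel hL t)) => a; exact: (vel_bound hL).
have gG a : `|U a t ^+ 2| <= bv ^+ 2.
  by rewrite normrX lerXn2r ?nnegrE// (vel_bound hL).
have mgd : measurable_fun setT (fun a => 2 * U a t * dv a t).
  apply: measurable_funM; last exact: (measurable_dvel hL t).
  by apply: measurable_funM => //; exact: (measurable_vel hL t).
have gdK a : `|2 * U a t * dv a t| <= kg.
  have -> : kg = 2 * bv * (1 + `|t|) by rewrite /kg; ring.
  rewrite 2!normrM (ger0_norm (ler0n _ 2)); apply: ler_pM => //; last exact: (dvel_bound hL).
  by rewrite ler_wpM2l// (vel_bound hL).
have dg a : regular_label X V a -> is_derive a (1 : R) (fun a => U a t ^+ 2) (2 * U a t * dv a t).
  move=> ra; have d := is_derive_vel t ra; apply: is_derive_eq.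
  by rewrite /GRing.scale/=; ring.
have mDxt : measurable_fun setT (fun x => Dx phi x t).
  exact: (measurableT_comp mDx (pair2_measurable t)).
have [i1 i2 E] := @Rintegral_parts_pos _ X V M B hL (fun a => U a t ^+ 2)
  (fun a => 2 * U a t * dv a t) (fun x => phi (x, t)) (fun x => Dx phi x t)
  kg (bv ^+ 2) C A t lg gG mgd gdK dg (fun x => is_derive_x (@dx (x, t)))
  (fun x => let: And3 _ h _ := phiC x t in h) mDxt
  (fun x => let: And3 h _ _ := phiC x t in h)
  (fun x h => let: And3 e1 e2 _ := @phiA x t (or_introl h) in conj e1 e2).
have -> : \int[mu]_a K1 a t = \int[mu]_a (K1 a t -
   (U a t ^+ 2 * Dx phi (y a t) t * derive1 (y ^~ t) a + 2 * U a t * dv a t * phi (y a t, t))).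
  rewrite RintegralB//; last first.
    by have := integrableD measurableT i2 i1; apply.
  by rewrite [X in _ - X]RintegralD// E addNr subr0.
congr fine; apply: ae_eq_integral => //.
- apply/measurable_EFinP; apply: measurable_funM; last exact: (measurable_derive1_pos hL).
  exact: (measurableT_comp mm (measurable_pos hL t)).
- apply/measurable_EFinP; apply: measurable_funB.
    by apply/measurable_EFinP; case/integrableP: (integrable_K1t t).
  by apply: measurable_funD; apply/measurable_EFinP; [case/integrableP: i2|case/integrableP: i1].
have := ae_regular hL; apply: aeS => a ra _; congr EFin.
rewrite /momentum (eulE hL).
have S := eul_dx_steep hL t ra.
(* The last label of the fibre may differ from a, but at a regular label only where y_a = 0. *)
have F : cum (y a t) t * derive1 (y ^~ t) a = nrg X a * derive1 (y ^~ t) a.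
  rewrite derive1_pos//; have := dpos_ge0 hL t ra; rewrite le_eqVlt => /orP[/eqP <-|d0].
    by rewrite !mulr0.
  by rewrite /cum (regular_singleton hL ra d0).2.
rewrite [LHS](_ : _ = U a t * Dt phi (y a t) t * derive1 (y ^~ t) a
  - phi (y a t, t) * U a t * (ux (y a t) t * derive1 (y ^~ t) a)
  + 2^-1 * phi (y a t, t) * (cum (y a t) t * derive1 (y ^~ t) a)); last by ring.
by rewrite F S /K1 /Dphi derive1_pos//; field.
Qed.

Lemma momentum_equation_supp : \int[mu]_t \int[mu]_x momentum x t = 0.
Proof.
under eq_Rintegral do rewrite integral_momentum.
rewrite (Rfubini_swap integrable_K1).
by rewrite /Rintegral integral0_eq// => a _; congr EFin; exact: integral_K1.
Qed.


End test.

Let slab (A : R) : set R := `[- A, A]%classic.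

(** By Tonelli: every time slice contributes at most M, over a bounded range of times. *)
Lemma integrable_sqr_slab A :
  mu2.-integrable setT (EFin \o (fun z : R * R => ux z.1 z.2 ^+ 2 * \1_(slab A) z.2)).
Proof.
have mI : measurable (slab A : set mT) by exact: measurable_itv.
have m1 : measurable_fun setT (fun z : R * R => ux z.1 z.2 ^+ 2 * \1_(slab A) z.2).
  apply: measurable_funM; first by apply: measurable_funX; exact: (measurable_eul_dx hL).
  by apply: measurableT_comp => //; exact: measurable_indic.
have m2 : measurable_fun setT (EFin \o (fun z : R * R => ux z.1 z.2 ^+ 2 * \1_(slab A) z.2)).
  exact/measurable_EFinP.
apply/(integrable21ltyP mu mu m2).
have M0 := M_ge0 hL.
have b0 t : 0 <= \1_(slab A) t :> R by rewrite indicE.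
apply: (@le_lt_trans _ _ (\int[mu]_t (M%:E * (EFin \o \1_(slab A)) t))%E).
  apply: ge0_le_integral => //.
  - by move=> t _; apply: integral_ge0.
  - have maf : measurable_fun setT (abse \o (EFin \o
      (fun z : R * R => ux z.1 z.2 ^+ 2 * \1_(slab A) z.2))) by exact: measurableT_comp.
    by have := @measurable_fun_fubini_tonelli_G _ _ mT mT R mu _ maf (fun z => abse_ge0 _).
  - by apply: measurable_funeM; apply/measurable_EFinP; exact: measurable_indic.
  - move=> t _ /=; have [c cE cM] := integral_eul_dx_sqr hL t.
    have -> : (\int[mu]_x `|ux x t ^+ 2 * \1_(slab A) t|%:E =
        \int[mu]_x ((ux x t ^+ 2)%:E * (\1_(slab A) t)%:E))%E.
      by apply: eq_integral => x _; rewrite -EFinM ger0_norm// mulr_ge0// sqr_ge0.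
    rewrite ge0_integralZr//.
    + by rewrite cE -!EFinM lee_fin ler_wpM2r.
    + by apply/measurable_EFinP; apply: measurable_funX; exact: (measurable_eul_dx1 hL).
    + by move=> x _; rewrite lee_fin sqr_ge0.
rewrite ge0_integralZl//.
- by rewrite integral_indic// setIT lte_mul_pinfty// ?lee_fin//; exact: leb_itv_lty.
- by apply/measurable_EFinP; exact: measurable_indic.
- by move=> t _; rewrite lee_fin.
Qed.

(** An integrable majorant equal to c u_x^2 + d on the square of half-side A; it dominates u_t^2 on
    compact sets and u_t phi for test functions. *)
Let dom (c d A : R) (z : R * R) : R :=
  c * (ux z.1 z.2 ^+ 2 * \1_(slab A) z.2) + d * (\1_(slab A) z.1 * \1_(slab A) z.2).

Let integrable_dom c d A : mu2.-integrable setT (EFin \o dom c d A).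
Proof.
have i1 : mu2.-integrable setT (EFin \o (fun z : R * R => c * (ux z.1 z.2 ^+ 2 * \1_(slab A) z.2))).
  by have := integrableZl measurableT c (integrable_sqr_slab A); apply.
have mI : measurable (slab A : set mT) by exact: measurable_itv.
have m1 : measurable_fun setT (\1_(slab A) : R -> R) by exact: measurable_indic.
have i2 : mu2.-integrable setT (EFin \o (fun z : R * R => d * (\1_(slab A) z.1 * \1_(slab A) z.2))).
  apply: (integrable_bounded_supp2 (C := `|d|) (A := A + 1)).
  - apply: measurable_funM => //; apply: measurable_funM; exact: measurableT_comp.
  - move=> x t /=; rewrite !indicE normrM ler_piMr//.
    by case: (_ \in _); case: (_ \in _); rewrite ?mulr1 ?mul0r ?mulr0 ?normr1 ?normr0.
  - move=> x t /= h; have nz z : A + 1 <= `|z| -> \1_(slab A) z = 0 :> R.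
      move=> zA; rewrite indicE memNset// /slab/= in_itv/= -ler_norml; lra.
    by case: h => /nz ->; rewrite ?mulr0 ?mul0r ?mulr0.
by have := integrableD measurableT i1 i2; apply.
Qed.

Let dom_out c d A x t : 0 <= c -> 0 <= d -> 0 <= dom c d A (x, t).
Proof.
move=> c0 d0; rewrite /dom; apply: addr_ge0; apply: mulr_ge0 => //.
by apply: mulr_ge0; [exact: sqr_ge0|rewrite indicE].
Qed.

Let dom_in c d A x t : `|x| <= A -> `|t| <= A -> dom c d A (x, t) = c * ux x t ^+ 2 + d.
Proof.
move=> xA tA; have e z : `|z| <= A -> \1_(slab A) z = 1 :> R.
  by move=> zA; rewrite indicE mem_set// /slab/= in_itv/= -ler_norml.
by rewrite /dom/= !e// !mulr1.
Qed.

Let mult_bound x t A : `|t| <= A ->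
  `|u x t * ux x t - 2^-1 * cum x t| <= (B + A * M) * (1 + ux x t ^+ 2) + M.
Proof.
move=> tA; have /andP[c0 cM] := cum_bound x t.
rewrite (le_trans (ler_normB _ _))// lerD//; last by rewrite ger0_norm ?mulr_ge0//; lra.
rewrite normrM ler_pM//.
  by apply: le_trans (eul_bound hL x t) _; rewrite lerD2l ler_wpM2r// (M_ge0 hL).
rewrite -(real_normK (num_real (ux x t))).
by have := normr_ge0 (ux x t); nra.
Qed.

Lemma L2_loc2_eul_dt : L2_loc2 eul_dt.
Proof.
split; first exact: measurable_eul_dt.
move=> K cK; have mK := measurable_compact2 cK.
have [r [_ Hr]] := compact_bounded cK.
pose A := `|r| + 1; have A0 : 0 <= A by rewrite addr_ge0.
have KA x t : K (x, t) -> `|x| <= A /\ `|t| <= A.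
  move=> /(Hr A) h; have {}h : `|(x, t)| <= A.
    by apply: h; rewrite (le_lt_trans (ler_norm r))// ltrDl.
  by move: h; rewrite [leLHS]/(Num.max _ _) ge_max => /andP[].
have M0 := M_ge0 hL; have B0 := B_ge0 hL.
pose bv := B + A * M; have bv0 : 0 <= bv by rewrite addr_ge0 ?mulr_ge0.
(* From (u u_x - F/2)^2 <= 2 u^2 u_x^2 + F^2/2, with |u| <= bv and F <= M. *)
have /integrableP[md] := integrable_dom (2 * bv ^+ 2) (M ^+ 2) A.
apply: le_lt_trans.
apply: (@le_trans _ _
    (\int[mu2]_(z in K) `|(EFin \o dom (2 * bv ^+ 2) (M ^+ 2) A) z|)%E); last first.
  by apply: ge0_subset_integral => //; exact: measurableT_comp.
apply: ge0_le_integral => //.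
- by move=> z _; rewrite lee_fin sqr_ge0.
- apply/measurable_EFinP; apply: measurable_funTS; apply: measurable_funX.
  exact: measurable_eul_dt.
- by apply: measurable_funTS; exact: measurableT_comp.
move=> [x t] /KA[xA tA]; rewrite /= lee_fin dom_in// (le_trans _ (ler_norm _))//.
rewrite /eul_dt/= sqrrN; have /andP[c0 cM] := cum_bound x t.
have hu : `|u x t| <= bv.
  by apply: le_trans (eul_bound hL x t) _; rewrite lerD2l ler_wpM2r.
have : u x t ^+ 2 <= bv ^+ 2.
  by rewrite -(real_normK (num_real (u x t))) lerXn2r ?nnegrE.
have : cum x t ^+ 2 <= M ^+ 2 by rewrite lerXn2r ?nnegrE.
have := sqr_ge0 (u x t * ux x t + 2^-1 * cum x t).
have := sqr_ge0 (ux x t).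
move: (u x t) (ux x t) (cum x t) (bv ^+ 2) (M ^+ 2) => a b c k m h1 h2 h3 h4.
have : a ^+ 2 * b ^+ 2 <= k * b ^+ 2 by exact: ler_wpM2r.
by have := sqr_ge0 c; nra.
Qed.

Section test.
Variables (phi : R * R -> R).
Hypothesis tphi : test_function phi.

Let integrable_parts :
  mu2.-integrable setT (EFin \o (fun z => u z.1 z.2 * Dt phi z.1 z.2)) /\
  mu2.-integrable setT (EFin \o (fun z => eul_dt z * phi z)).
Proof.
have [cphi cDx cDt [dx dt] [A [C [A0 C0 phiC phiA]]]] := test_function2_bounds tphi.
have M0 := M_ge0 hL; have B0 := B_ge0 hL.
have bv0 : 0 <= B + A * M by rewrite addr_ge0 ?mulr_ge0.
have mphi := measurable_continuous2 cphi; have mDt := measurable_continuous2 cDt.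
split.
  apply: (integrable_bounded_supp2 (C := (B + A * M) * C) (A := A)) => /=.
  - by apply: measurable_funM => //; exact: (measurable_eul hL).
  - move=> x t /=; have [At|/ltW tA] := leP A `|t|.
      have [_ _ ->] := phiA x t (or_intror At).
      by rewrite mulr0 normr0 mulr_ge0.
    have [_ _ h] := phiC x t; rewrite normrM ler_pM//.
    by apply: le_trans (eul_bound hL x t) _; rewrite lerD2l ler_wpM2r.
  - by move=> x t /phiA[_ _ ->]; rewrite mulr0.
have mf : measurable_fun setT (fun z => eul_dt z * phi z).
  by apply: measurable_funM => //; exact: measurable_eul_dt.
(* The constants are those of [mult_bound] multiplied by the bound C on phi. *)
apply: (le_integrable _ _ _ (integrable_dom ((B + A * M) * C) ((B + A * M + M) * C) A)) => //.
  exact/measurable_EFinP.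
have dom0 x t : 0 <= dom ((B + A * M) * C) ((B + A * M + M) * C) A (x, t).
  by apply: dom_out; rewrite mulr_ge0// addr_ge0.
move=> [x t] _ /=; rewrite lee_fin [leRHS]ger0_norm//.
have [At|/ltW tA] := leP A `|t|.
  by have [-> _ _] := phiA x t (or_intror At); rewrite mulr0 normr0.
have [Ax|/ltW xA] := leP A `|x|.
  by have [-> _ _] := phiA x t (or_introl Ax); rewrite mulr0 normr0.
rewrite dom_in// normrM /eul_dt/= normrN; have [h _ _] := phiC x t.
apply: le_trans (ler_pM _ _ (mult_bound x tA) h) _ => //.
by rewrite le_eqVlt; apply/orP; left; apply/eqP; ring.
Qed.

Lemma energy_equation :
  \int[mu]_t (\int[energy hL t]_x (Dt phi x t + u x t * Dx phi x t)) = 0.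
Proof.
have [cphi cDx cDt [dx dt] [A [C [A0 C0 phiC phiA]]]] := test_function2_bounds tphi.
exact: (energy_equation_supp cDx cDt dx dt A0 C0 phiC phiA).
Qed.

Let integrable_momentum :
  mu2.-integrable setT (EFin \o (fun z => momentum phi z.1 z.2)).
Proof.
have [i1 i2] := integrable_parts.
have := integrableD measurableT i1 i2; congr (_.-integrable _ _).
apply/funext => -[x t]; rewrite /= -EFinD; congr EFin.
by rewrite /momentum /eul_dt/=; ring.
Qed.

Let momentum0 : \int[mu]_t \int[mu]_x momentum phi x t = 0.
Proof.
have [cphi cDx cDt [dx dt] [A [C [A0 C0 phiC phiA]]]] := test_function2_bounds tphi.
exact: (momentum_equation_supp cphi cDx cDt dx dt A0 phiC phiA).
Qed.

Lemma momentum_equation :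
  \int[mu]_t (\int[mu]_x (u x t * Dt phi x t
    - phi (x, t) * (u x t * ux x t - 2^-1 * F (energy hL) x t))) = 0.
Proof.
rewrite -[RHS]momentum0; apply: eq_Rintegral => t _; apply: eq_Rintegral => x _.
by rewrite F_energy.
Qed.

Lemma time_derivative_equation : \int[mu2]_z (u z.1 z.2 * Dt phi z.1 z.2) =
  - \int[mu2]_z (eul_dt z * phi z).
Proof.
have [i1 i2] := integrable_parts.
apply/eqP; rewrite -addr_eq0 -RintegralD//; apply/eqP; rewrite -[RHS]momentum0.
rewrite (Rfubini_sym integrable_momentum); apply: eq_Rintegral => -[x t] _.
by rewrite /momentum /eul_dt/=; ring.
Qed.

End test.

Lemma weak_dt_eul : weak_dt u eul_dt.
Proof. by move=> phi tphi; exact: time_derivative_equation. Qed.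

Lemma energy_ae_density :
  \forall t \ae mu, same_measure (energy hL t) (density (fun x => ux x t ^+ 2)).
Proof.
have cC := countable_collapse hL.
exists [set t | \int[mu]_(x in collapsed X V t) (q x)%:E != 0%E]%E; split.
- exact: countable_measurable.
- exact: countable_lebesgue_measure0.
move=> t /= h; apply: contrapT => nt; apply: h; exact: (energy_density hL nt).
Qed.

End lagrangian_equations.

(** * Restarting and singular parts *)

Section restart.
Context {R : realType}.
Notation mT := (measurableTypeR R).
Notation mu := (@lebesgue_measure R).
Variables (X V : R -> R) (M B : R).
Hypothesis hL : lagrangian X V M B.
Variable s : R.
Hypothesis acs : energy hL s `<< mu.

Local Notation y := (pos X V).
Local Notation U := (vel X V).
Local Notation q := (nrg_dot X).
Local Notation u := (eul X V).
Local Notation ux := (eul_dx X V).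

Let part_le t (A : set R) (mA : measurable A) (E : set mT) : measurable E ->
  (energy_part hL t mA E <= energy hL t E)%E.
Proof.
move=> mE; rewrite energyE energy_partE; apply: ge0_le_integral => //.
- exact: (measurable_pos_preimage hL).
- by move=> x _; rewrite lee_fin restrict_ge0//; exact: (nrg_dot_ge0 hL).
- apply/measurable_EFinP; apply: measurable_funTS.
  by apply: measurable_restrict_fun => //; exact: (measurable_nrg_dot hL).
- by apply/measurable_EFinP; apply: measurable_funTS; exact: (measurable_nrg_dot hL).
- move=> x _; rewrite lee_fin patchE; case: ifP => // _; exact: (nrg_dot_ge0 hL).
Qed.

Let part_null (m : finite_borel_measure R) (N : set mT) : measurable N ->
  mu N = 0%E -> (m N <= energy hL s N)%E -> m (~` N) = 0%E -> forall E, measurable E -> m E = 0%E.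
Proof.
move=> mN N0 mNle mNc E mE.
have eN : energy hL s N = 0%E by move/null_content_dominatesP : acs; apply.
have m0 : m N = 0%E by apply/eqP; rewrite -measure_le0 -eN.
apply: (subset_measure0 mE (measurableU _ _ mN (measurableC mN))).
  by rewrite setUv.
have := measureU m mN (measurableC mN).
rewrite setICr => /(_ erefl) ->; rewrite -[RHS]adde0; congr (_ + _)%E => //.
Qed.

(** Each singular part is carried by a Lebesgue null set, which the whole energy at time s does not
    charge by hypothesis. *)
Lemma energy_density_dominated : same_measure (energy hL s) (density (fun x => ux x s ^+ 2)).
Proof.
move=> E mE; rewrite (energy_decomposition hL s mE) -(energy_ac_density hL s mE).
have [C cC Cp] := energy_pp_pure_point hL s.
have [[N [mN N0 Nc]] _] := energy_sc_singular_continuous hL s.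
have mC : measurable (C : set mT) by exact: countable_measurable.
have -> : energy_pp hL s E = 0%E.
  apply: (part_null mC _ _ Cp) => //; first exact: countable_lebesgue_measure0.
  exact: part_le.
have -> : energy_sc hL s E = 0%E by apply: (part_null mN _ _ Nc) => //; exact: part_le.
by rewrite !adde0.
Qed.

Definition cum_ac (xi : R) : R := \int[mu]_(z in `]-oo, xi[) (ux z s ^+ 2).
Definition restart_pos (xi t : R) : R := xi + u xi s * t + t ^+ 2 / 4 * cum_ac xi.

Lemma cum_acE xi : cum_ac xi = cum X V xi s.
Proof.
have mux2 : measurable_fun setT (fun z => ux z s ^+ 2).
  by apply: measurable_funX; exact: (measurable_eul_dx1 hL).
have I A : measurable A -> mu.-integrable A (EFin \o (fun z => ux z s ^+ 2)).
  move=> mA; apply: (@integrableS _ _ _ mu setT) => //.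
  apply/integrableP; split; first exact/measurable_EFinP.
  have [c cE _] := integral_eul_dx_sqr hL s.
  by under eq_integral do rewrite /= ger0_norm ?sqr_ge0//; rewrite cE ltry.
rewrite /cum_ac Rintegral_itv_bndo_bndc; last exact: I.
by rewrite -(F_energy hL) /F (energy_density_dominated (measurable_itv _)).
Qed.

(** The fibre of y(., s) through a may extend beyond a, but the energy between a and its last label
    sits at the single position y a s, which carries no mass at an absolutely continuous time. *)
Lemma cum_ac_pos a : cum_ac (y a s) = nrg X a.
Proof.
rewrite cum_acE; apply/le_anti/andP; split; last first.
  by apply: (nrg_nondecreasing hL); rewrite (lab2_ge hL).
have Ey : energy hL s [set y a s] = 0%E.
  rewrite energy_density_dominated// /density.
  exact: integral_set1.
have al : a <= lab2 X V (y a s) s by rewrite (lab2_ge hL).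
rewrite -subr_le0 -lee_fin -(integral_nrg_dot_itv hL al) -[leRHS]Ey energyE.
apply: ge0_subset_integral => //.
- by apply: (measurable_pos_preimage hL); exact: measurable_set1.
- by apply/measurable_EFinP; apply: measurable_funTS; exact: (measurable_nrg_dot hL).
- by move=> x _; rewrite lee_fin; exact: (nrg_dot_ge0 hL).
move=> x /=; rewrite in_itv/= => /andP[/ltW/(pos_nondecreasing hL s) h1].
by rewrite (lab2_ge hL) => h2; apply/le_anti; rewrite h1 h2.
Qed.

(** Taylor expansion at s of a quadratic in time: its coefficients there are the position, the
    velocity and a quarter of the energy. *)
Lemma restart_posE a t : y a t = restart_pos (y a s) (t - s).
Proof. by rewrite /restart_pos (eulE hL) cum_ac_pos /pos /vel; field. Qed.

Lemma measurable_restart_pos t : measurable_fun setT (restart_pos ^~ t).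
Proof.
apply: measurable_funD; last first.
  apply: measurable_funM => //; apply: measurable_nondecreasing => x z xz.
  by rewrite !cum_acE; apply: (nrg_nondecreasing hL); exact: (lab2_nondecreasing hL).
apply: measurable_funD => //; apply: measurable_funM => //.
by apply: continuous_measurable_fun; exact: (eul_continuous_x hL).
Qed.

Lemma restart_energy t : same_measure (energy hL t)
  (push_density (restart_pos ^~ (t - s)) (fun x => ux x s ^+ 2)).
Proof.
move=> E mE; have mP : measurable ((restart_pos ^~ (t - s)) @^-1` E).
  by apply: measurable_preimage => //; exact: measurable_restart_pos.
rewrite /push_density /pushforward -energy_density_dominated// !energyE.
rewrite /push_density /pushforward; congr (density _ _).
rewrite (_ : y ^~ t = restart_pos ^~ (t - s) \o y ^~ s)//.
by apply/funext => a; exact: restart_posE.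
Qed.

Lemma restart_eul xi t :
  is_derive t (1 : R) (fun r => restart_pos xi (r - s)) (u (restart_pos xi (t - s)) t) /\
  u (restart_pos xi (t - s)) t = u xi s + (t - s) / 2 * cum_ac xi.
Proof.
have [a <-] := pos_surjective hL s xi.
have E : u (restart_pos (y a s) (t - s)) t = u (y a s) s + (t - s) / 2 * cum_ac (y a s).
  by rewrite -restart_posE !(eulE hL) cum_ac_pos /vel; field.
split; last exact: E.
by rewrite E /restart_pos; apply: is_derive_eq; rewrite /GRing.scale/=; field.
Qed.

Lemma restart_mass : ('N[mu]_2%:E[EFin \o (ux ^~ s)] ^+ 2 = M%:E)%E.
Proof.
apply: Lnorm2_sqr; rewrite -(energy_total hL s).
by rewrite energy_density_dominated.
Qed.

End restart.

(** * Exhaustion by compact sets *)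

Section inner_regularity.
Context {R : realType}.
Notation mT := (measurableTypeR R).
Notation mu := (@lebesgue_measure R).

(** Inner regularity is applied to the finite pieces Z in [-n, n], with an error below 1/(n+1) that
    is absorbed by letting n grow. *)
Lemma ae_compact_exhaustion (Z : set R) : measurable Z ->
  exists K : nat -> set R, [/\ forall n, compact (K n), forall n, K n `<=` Z &
    mu (Z `\` \bigcup_n K n) = 0%E].
Proof.
move=> mZ; pose I n : set R := `[- n%:R, n%:R]%classic.
have mI n : measurable (I n) by exact: measurable_itv.
have mZI n : measurable (Z `&` I n) by exact: measurableI.
have fZI n : (mu (Z `&` I n) < +oo)%E.
  apply: (@le_lt_trans _ _ (mu (I n))); last exact: leb_itv_lty.
  by apply: le_measure => [||x []//]; rewrite inE; [exact: mZI|exact: mI].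
have H n : exists K : set R, [/\ compact K, K `<=` Z `&` I n &
    (mu ((Z `&` I n) `\` K) < (n.+1%:R^-1)%:E)%E].
  by apply: lebesgue_regularity_inner => //; exact: fZI.
have [K HK] := choice H.
have mK n : measurable (K n) by apply: measurable_realfun.compact_measurable; case: (HK n).
have mUK : measurable (\bigcup_n K n) by exact: bigcup_measurable.
exists K; split => [n|n|]; first by case: (HK n).
  by case: (HK n) => _ h _ x /h[].
have Nm m : mu ((Z `&` I m) `\` \bigcup_n K n) = 0%E.
  apply/eqP; rewrite -measure_le0; apply/lee_addgt0Pr => e e0; rewrite add0e.
  (* Large enough for the n-th piece to contain the m-th, and for 1/(n+1) to be at most e. *)
  pose n := maxn m (Num.Def.archi_bound e^-1).
  have [_ _ h] := HK n; apply: (@le_trans _ _ (mu ((Z `&` I n) `\` K n))).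
    have mD k (A : set R) : measurable A -> measurable ((Z `&` I k) `\` A).
      by move=> mA; exact: measurableD.
    apply: le_measure; [by rewrite inE; exact: mD|by rewrite inE; exact: mD|].
    move=> x [[Zx Ix] nK]; split; last by move=> Kx; apply: nK; exists n.
    split => //; move: Ix; rewrite /I/= !in_itv/= => /andP[x1 x2].
    have : m%:R <= n%:R :> R by rewrite ler_nat leq_maxl.
    by move=> mn; apply/andP; split; lra.
  apply: (le_trans (ltW h)); rewrite lee_fin.
  rewrite -[leRHS]invrK lef_pV2 ?posrE ?invr_gt0//.
  apply: ltW; apply: (lt_le_trans (unstable.ltr_bound _)).
  by rewrite ler_nat (leq_trans (leq_maxr m _))// leqnSn.
have -> : Z `\` \bigcup_n K n = \bigcup_m ((Z `&` I m) `\` \bigcup_n K n).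
  apply/seteqP; split => [x [Zx nK]|x [m _ [[Zx _] nK]]]; last by split.
  exists (Num.Def.archi_bound x) => //; split => //; split => //.
  by rewrite /I/= in_itv/= -ler_norml ltW// unstable.ltr_norm_bound.
have mD m : measurable ((Z `&` I m) `\` \bigcup_n K n) by exact: measurableD.
apply/negligibleP; first by apply: bigcup_measurable => m _; exact: mD.
by apply: negligible_bigcup => m; apply/negligibleP; [exact: mD|exact: Nm].
Qed.

End inner_regularity.

(** * Initial data as Lagrangian data; the singular part of the energy *)

Section characteristics.
Context {R : realType}.
Notation mT := (measurableTypeR R).
Notation mu := (@lebesgue_measure R).
Variables (ubar : R -> R) (mubar : finite_borel_measure R) (B : R).
Hypothesis hD : in_D ubar mubar.
Hypothesis HB : forall x, `|ubar x| <= B.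
Notation X := (char_x mubar).
Notation V := (ubar \o X).
Notation f := (char_f mubar).
Local Notation q := (nrg_dot X).
Notation M := (mass mubar).
Notation y := (char_y ubar mubar).

Lemma lagrangian_char : lagrangian X V M B.
Proof.
split.
- exact: slow_char_x.
- exact: velocity_increment hD.
- by move=> a; rewrite energy_ge0 energy_le_mass.
- exact: energyNy.
- exact: energy_y.
- by move=> a; exact: HB.
have [_ [g [wg _ _]]] := hD.
by have := ae_relations hD wg; apply: aeS => a [].
Qed.

Let hL := lagrangian_char.

Lemma char_x_cvgNy : X a @[a --> -oo] --> -oo.
Proof.
apply/cvgrNyPle => A; near=> a; have /andP[h _] : 0 <= a - X a <= M := lag_nrg hL a.
have : a <= A by near: a; apply: nbhs_ninfty_le; exact: num_real.
lra.
Unshelve. all: by end_near. Qed.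

Lemma char_x_cvgy : X a @[a --> +oo] --> +oo.
Proof.
apply/cvgryPge => A; near=> a; have /andP[_ h] : 0 <= a - X a <= M := lag_nrg hL a.
have : A + M <= a by near: a; apply: nbhs_pinfty_ge; exact: num_real.
lra.
Unshelve. all: by end_near. Qed.

Lemma eul0 : (eul X V) ^~ 0 = ubar.
Proof.
apply/funext => x; rewrite /eul /vel mul0r mul0r addr0 /=.
by have := labK hL 0 x; rewrite /pos !mulr0 expr0n/= !mul0r !addr0 => ->.
Qed.

Lemma energy0 : same_measure (energy hL 0) mubar.
Proof.
move=> E mE; rewrite energyE (mubar_push mubar mE).
rewrite (_ : (pos X V) ^~ 0 = X)//; apply/funext => a.
by rewrite /pos !mulr0 expr0n/= !mul0r !addr0.
Qed.

Section singular.
Variables (w : R -> R) (t : R).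
Hypotheses (ww : weak_derivative ubar w) (t0 : t != 0).

Let AE := [set x | w x = - (2 / t)].
Let Xt x := x + ubar x * t + t ^+ 2 / 4 * fine (mubar `]-oo, x[%classic).
Let msing E := (energy_pp hL t E + energy_sc hL t E)%E.

(* Where [X' > 0], the jacobian of [y] is [X' (1 + w(X) t / 2)^2]. *)
Lemma ae_collapsed : \forall a \ae mu,
  (A_pp ubar mubar t `|` A_sc ubar mubar t) a <-> B_L0 mubar a /\ w (X a) = - (2 / t).
Proof.
have := aeI (ae_regular hL) (ae_relations hD ww); apply: aeS => a [ra [dX _ _ H]].
rewrite -/(flat_pp X V t) -/(flat_sc X V t) (regular_flat hL t ra) /B_L0/=.
have /andP[p0 _] := dX_bounds hL a.
have dpE : 0 < derive1 X a -> dpos X V a t = derive1 X a * (1 + w (X a) * t / 2) ^+ 2.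
  by move=> /H[e1 e2]; rewrite /dpos e1 [nrg_dot X a]e2; field.
split=> [d0|[[_ p1] wE]]; last by rewrite dpE// wE; field.
(* If X' = 0, then V' = 0 and [dpos] equals t^2/4, which is nonzero: labels inside an initial atom
   or singular set do not collapse at t <> 0. *)
have p1 : 0 < derive1 X a.
  rewrite lt_neqAle p0 andbT; apply/negP => /eqP/esym pz; move: d0.
  case: ra => _ _; rewrite pz mul0r => /eqP; rewrite sqrf_eq0 => /eqP vz.
  rewrite /dpos pz vz /nrg_dot pz subr0 mul0r !add0r mulr1 => /eqP.
  by apply/negP; rewrite mulf_neq0 ?expf_neq0// invr_neq0// pnatr_eq0.
split => //; move: d0; rewrite dpE// => /eqP; rewrite mulf_eq0 gt_eqF//= sqrf_eq0 => /eqP h.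
apply: (mulIf t0); rewrite mulNr divfK//; lra.
Qed.

Let AEm : measurable AE.
Proof.
have [[mw _ _] _] := ww.
by apply: (measurable_preimage mw (measurable_set1 _)).
Qed.

Let measurable_Xt : measurable_fun setT Xt.
Proof.
have [[cu _] _] := hD.
apply: measurable_funD; last first.
  by apply: measurable_funM => //; apply: measurable_nondecreasing; exact: cdfo_nondecreasing.
by apply: measurable_funD => //; apply: measurable_funM => //; exact: continuous_measurable_fun.
Qed.

(* A fibre of [X] reduced to a point carries no atom of [mubar]. *)
Let pos_Xt a : derivable X a 1 -> 0 < derive1 X a -> y a t = Xt (X a).
Proof.
move=> dX p1; have nX := slow_nondecreasing (slow_char_x mubar).
have aE : X a + cdfo mubar (X a) = a.
  apply/eqP/negPn/negP => na; move: p1.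
  rewrite (monotone_flat_derive nX dX _ na) ?ltxx//.
  by apply: char_x_unique; rewrite lexx/= lerD2l cdfo_le_cdfc.
rewrite /char_y /Xt -/(cdfo mubar (X a)); congr (_ + _ * _).
by rewrite -{1}aE addrAC subrr add0r.
Qed.

(** At almost every collapsed label y = Xt o X and q = w(X)^2 X', so the singular energy is the
    pull-back under X of w^2 restricted to [AE]. *)
Lemma singular_density : same_measure msing (push_density Xt ((fun x => w x ^+ 2) \_ AE)).
Proof.
move=> E mE; have [[mw _ _] _] := ww.
have mq := measurable_nrg_dot hL; have q0 := nrg_dot_ge0 hL.
have mw2 : measurable_fun setT ((fun x => w x ^+ 2) \_ AE).
  by apply: measurable_restrict_fun => //; exact: measurable_funX.
have w20 x : 0 <= ((fun x => w x ^+ 2) \_ AE) x.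
  by apply: restrict_ge0 => z; exact: sqr_ge0.
have nX := slow_nondecreasing (slow_char_x mubar).
have mXE : measurable (Xt @^-1` E) by exact: measurable_preimage.
rewrite [RHS](_ : _ = density ((fun x => w x ^+ 2) \_ AE) (Xt @^-1` E))//.
rewrite -(push_change_of_variables ltr01 (lip_char_x mubar) nX
  (char_x_surjective mubar) mw2 w20 mXE).
have mX : measurable_fun setT X by exact: measurable_nondecreasing.
have mXXE : measurable (X @^-1` (Xt @^-1` E)) by exact: measurable_preimage.
have mp := measurable_flat_pp hL t; have ms := measurable_flat_sc hL t.
rewrite /msing /energy_pp /energy_sc !energy_partE.
rewrite /push_density /pushforward /density.
have mF := measurable_pos_preimage hL t mE.
rewrite -ge0_integralD//; last 4 first.
- by move=> x _; rewrite lee_fin restrict_ge0.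
- by apply/measurable_EFinP; apply: measurable_funTS; exact: measurable_restrict_fun.
- by move=> x _; rewrite lee_fin restrict_ge0.
- by apply/measurable_EFinP; apply: measurable_funTS; exact: measurable_restrict_fun.
under eq_integral do rewrite -EFinD.
rewrite integral_mkcond [RHS]integral_mkcond !restrict_EFin.
have mG : measurable_fun setT (fun a => (q \_ (flat_pp X V t)) a + (q \_ (flat_sc X V t)) a).
  by apply: measurable_funD; exact: measurable_restrict_fun.
have mH : measurable_fun setT
    (fun a => ((fun x => w x ^+ 2) \_ AE) (X a) * derive1 X a).
  apply: measurable_funM; first exact: (measurableT_comp mw2 mX).
  exact: (measurable_dX hL).
apply: ge0_ae_eq_integral => //.
- by apply/measurable_EFinP; exact: measurable_restrict_fun.
- by apply/measurable_EFinP; exact: measurable_restrict_fun.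
- by move=> a _; rewrite lee_fin restrict_ge0// => b; rewrite addr_ge0 ?restrict_ge0.
- move=> a _; rewrite lee_fin restrict_ge0// => b; rewrite mulr_ge0//.
  exact: nondecreasing_derive1_ge0.
have := aeI (ae_regular hL) (aeI (ae_relations hD ww) ae_collapsed).
apply: aeS => a [ra [[dX _ _ H] cE]] _; congr EFin.
have [fa|nfa] := pselect ((flat_pp X V t `|` flat_sc X V t) a).
  have [[_ p1] wE] := cE.1 fa; have [_ e2] := H p1.
  have sumE : (q \_ (flat_pp X V t)) a + (q \_ (flat_sc X V t)) a = q a.
    rewrite !patchE; case: fa => [fa|fa].
      rewrite mem_set// memNset ?addr0// => -[_ e].
      by case: fa => _; rewrite e ltxx.
    rewrite [a \in flat_sc _ _ _]mem_set// memNset ?add0r// => -[_ e].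
    by case: fa => _ e'; rewrite e' ltxx in e.
  rewrite !(patchE _ (_ @^-1` _)) sumE.
  have -> : (a \in X @^-1` (Xt @^-1` E)) = (a \in (pos X V) ^~ t @^-1` E).
    by congr asbool; rewrite /= -(pos_Xt dX p1).
  by case: ifP => // _; rewrite patchE mem_set.
have -> : (((fun a => (q \_ (flat_pp X V t)) a + (q \_ (flat_sc X V t)) a))
    \_ ((pos X V) ^~ t @^-1` E)) a = 0.
  rewrite patchE; case: ifP => // _; rewrite !patchE.
  by rewrite !memNset ?addr0// => h; apply: nfa; [right|left].
apply/esym; rewrite patchE; case: ifP => // _.
have [p0|p0] := pselect (0 < derive1 X a); last first.
  suff -> : derive1 X a = 0 by rewrite mulr0.
  apply/eqP; rewrite eq_le nondecreasing_derive1_ge0// andbT leNgt.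
  exact/negP.
rewrite patchE memNset ?mul0r// => h; apply: nfa; apply: cE.2.
by split.
Qed.

Let msing0 (E : set mT) : measurable E ->
  mu ((pos X V) ^~ t @^-1` E `&` (flat_pp X V t `|` flat_sc X V t)) = 0%E -> msing E = 0%E.
Proof.
move=> mE E0; have mq := measurable_nrg_dot hL.
have mF := measurable_pos_preimage hL t mE.
rewrite /msing /energy_pp /energy_sc !energy_partE !push_density_restrict.
have mp := measurable_flat_pp hL t; have ms := measurable_flat_sc hL t.
have Z A : measurable A -> A `<=` flat_pp X V t `|` flat_sc X V t ->
    (\int[mu]_(x in (pos X V) ^~ t @^-1` E `&` A) (q x)%:E = 0)%E.
  move=> mA Af; apply: null_set_integral.
  - exact: measurableI.
  - by apply/measurable_EFinP; exact: measurable_funTS.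
  apply: (subset_measure0 _ _ _ E0).
  - exact: measurableI.
  - by apply: measurableI => //; exact: measurableU.
  - exact: setIS.
by rewrite (Z _ mp (@subsetUl _ _ _)) (Z _ ms (@subsetUr _ _ _)) adde0.
Qed.

(* [Xt] need not be continuous, but on the collapsed labels it factors through
   the continuous map [y], so inner regularity applies there. *)
Lemma singular_negligible : negligible msing (~` (Xt @` AE)).
Proof.
have cy := continuous_pos hL (t := t).
pose Z := [set a | (derivable X a 1 /\ 0 < derive1 X a) /\ w (X a) = - (2 / t)].
have mX : measurable_fun setT X.
  exact: measurable_nondecreasing (slow_nondecreasing (slow_char_x mubar)).
have cX := slow_continuous (slow_char_x mubar).
have mZ : measurable Z.
  rewrite (_ : Z = ([set a | derivable X a 1] `&`
      (derive1 X) @^-1` `]0, +oo[%classic) `&` X @^-1` AE).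
    apply: measurableI; last exact: measurable_preimage.
    apply: measurableI; first exact: measurable_derivable.
    by apply: measurable_preimage; [exact: (measurable_dX hL)|exact: measurable_itv].
  by apply/seteqP; split => a /=; rewrite in_itv/= andbT.
have [K [cK KZ K0]] := ae_compact_exhaustion mZ.
(* A sigma-compact, hence measurable, subset of the image of [AE] under [Xt] that carries all of the
   singular energy. *)
pose G := \bigcup_n ((pos X V) ^~ t @` K n).
have mG : measurable (G : set mT).
  apply: bigcup_measurable => n _; apply: measurable_realfun.compact_measurable.
  by apply: continuous_compact => //; exact: continuous_subspaceT.
have GX : G `<=` Xt @` AE.
  by move=> _ [n _ [a Ka <-]]; have [[dX p1] wE] := KZ n a Ka; exists (X a) => //; rewrite -pos_Xt.
exists (~` G); split; [exact: measurableC|apply: msing0; first exact: measurableC|exact: subsetC].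
have mK n : measurable (K n) by exact: measurable_realfun.compact_measurable.
have mp := measurable_flat_pp hL t; have ms := measurable_flat_sc hL t.
apply/negligibleP.
  apply: measurableI; last exact: measurableU.
  by apply: (measurable_pos_preimage hL); exact: measurableC.
have nK : mu.-negligible (Z `\` \bigcup_n K n).
  apply/negligibleP => //; apply: measurableD => //.
  by apply: bigcup_measurable => n _; exact: mK.
apply: negligibleS (negligibleU nK ae_collapsed) => a [nG fa].
have [h|h] := pselect (Z a); last by right => /= cE; apply: h; exact: cE.1.
by left; split => // -[n _ Ka]; apply: nG; exists n => //; exists a.
Qed.

Lemma singular_supp : supp msing `<=` closure (Xt @` AE).
Proof.
move=> x sx; apply: contrapT => nx.
have oU : open (~` closure (Xt @` AE)) by exact/closed_openC/closed_closure.
have := sx _ oU nx; apply/negP; rewrite -leNgt.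
have [A [mA A0 HA]] := singular_negligible.
have mU : measurable (~` closure (Xt @` AE) : set mT) by exact: open_measurable.
rewrite -A0 /msing; apply: leeD; apply: le_measure; rewrite ?inE//;
  by apply: subset_trans HA; apply: subsetC; exact: subset_closure.
Qed.

End singular.
End characteristics.

Theorem theorem3p1 (R : realType) (ubar : R -> R)
    (mubar : finite_borel_measure R) (hD : in_D ubar mubar) :
  let xbar := char_x mubar in
  let f := char_f mubar in
  let y := char_y ubar mubar in
  let App := A_pp ubar mubar in
  let Asc := A_sc ubar mubar in
  let BL := B_L ubar mubar in
  let BL0 := B_L0 mubar in
  (forall x t : R, exists alpha, y alpha t = x) /\
  exists (u : R -> R -> R) (mu : R -> finite_borel_measure R),
  (forall alpha t : R,
     is_derive t (1 : R) (y alpha) (u (y alpha t) t) /\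
     u (y alpha t) t = ubar (xbar alpha) + t / 2 * (alpha - xbar alpha)) /\
  (forall t, same_measure (mu t) (push_density (y ^~ t) f)) /\
  conservative_solution ubar mubar u mu /\
  (* (i) *)
  (weakly_continuous mu /\ forall t, mu t setT = mubar setT) /\
  (* (ii) and (iii) *)
  (exists mac mpp msc : R -> finite_borel_measure R,
     (forall t,
        [/\ lebesgue_decomposition (mu t) (mac t) (mpp t) (msc t),
            same_measure (mpp t) (push_density (y ^~ t) (f \_ (App t))),
            same_measure (msc t) (push_density (y ^~ t) (f \_ (Asc t))) &
            same_measure (mac t) (push_density (y ^~ t) (f \_ (BL t)))]) /\
     (forall (ubarx : R -> R) (t : R), weak_derivative ubar ubarx -> t != 0 ->
        let AE := [set x | ubarx x = - (2 / t)] in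
        let X := fun x =>
          x + ubar x * t + t ^+ 2 / 4 * fine (mubar `]-oo, x[%classic) in
        let msing := fun E => (mpp t E + msc t E)%E in
        [/\ (\forall alpha \ae leb,
               (App t `|` Asc t) alpha <->
               BL0 alpha /\ ubarx (xbar alpha) = - (2 / t)),
            same_measure msing
              (push_density X ((fun x => ubarx x ^+ 2) \_ AE)),
            negligible msing (~` (X @` AE)) &
            supp msing `<=` closure (X @` AE)]) /\
     countable [set t | mpp t setT != 0%E] /\
     countable [set t | msc t setT != 0%E]) /\
  (* (iv) *)
  ((exists ux : R -> R -> R,
      [/\ weak_dx u ux,
          (forall t, absolutely_continuous (u ^~ t)),
          (forall t, ac_part_density (mu t) (fun x => ux x t ^+ 2)),
          (forall t, L2 (ux ^~ t)) &
          Linfty_L2 ux]) /\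
   continuous_in_Cb u /\ holder_half_loc u /\
   exists ut, weak_dt u ut /\ L2_loc2 ut) /\
  (* (v) *)
  ((forall l : R, ubar x @[x --> -oo] --> l ->
      forall t, u x t @[x --> -oo] --> l) /\
   (forall l : R, ubar x @[x --> +oo] --> l ->
      forall t, u x t @[x --> +oo] --> l + 2^-1 * fine (mubar setT) * t)) /\
  (* (vi) *)
  (forall s : R, mu s `<< leb ->
     let utilde := u ^~ s in
     Cb utilde /\
     exists utildex : R -> R,
       let Ftilde := fun xi =>
         \int[leb]_(z in `]-oo, xi[) (utildex z ^+ 2) in
       let X := fun xi t => xi + utilde xi * t + t ^+ 2 / 4 * Ftilde xi in
       [/\ weak_derivative utilde utildex, L2 utildex,
           ('N[leb]_2%:E[EFin \o utildex] ^+ 2 = mubar setT)%E &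
           forall t,
             [/\ (forall alpha, y alpha t = X (y alpha s) (t - s)),
                 same_measure (mu t)
                   (push_density (X ^~ (t - s)) (fun x => utildex x ^+ 2)) &
                 forall xi : R,
                   is_derive t (1 : R) (fun r => X xi (r - s))
                     (u (X xi (t - s)) t) /\
                   u (X xi (t - s)) t = utilde xi + (t - s) / 2 * Ftilde xi]]).
Proof.
move=> xbar f y App Asc BL BL0.
have [cub _] := hD; have [B HB] := bounded_Cb cub.
(* For these data [char_y], [char_f], [A_pp], [A_sc] and [B_L] coincide by conversion with [pos],
   [nrg_dot], [flat_pp], [flat_sc] and [steep]. *)
pose hL := lagrangian_char hD HB.
have massM : mubar setT = (mass mubar)%:E := massE mubar.
have cC := eul_continuous_in_Cb hL; have hC := eul_holder_half_loc hL.
have wt := weak_dt_eul hL; have lt := L2_loc2_eul_dt hL.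
have wx := weak_dx_eul hL; have l2 := eul_dx_L2 hL.
have wc : weakly_continuous (energy hL) by exact: weakly_continuous_energy.
have ac := ac_part_density_energy hL.
pose V := ubar \o char_x mubar.
split; first by move=> x t; exact: pos_surjective hL t x.
exists (eul (char_x mubar) V), (energy hL).
split.
  move=> a t; rewrite -[y a t]/(pos (char_x mubar) V a t) (eulE hL).
  by split; [exact: is_derive_pos_dt|].
split; first by move=> t E mE; rewrite energyE.
split.
  exists (eul_dx (char_x mubar) V), (eul_dt (char_x mubar) V); split.
  - by split.
  - split; [exact: eul0|exact: energy0|exact: energy_ae_density].
  - by move=> phi tphi; exact: momentum_equation.
  - by move=> phi tphi; exact: energy_equation.
  - exact: ac.
split; first by split=> // t; rewrite massM; exact: energy_total.
split.
  exists (energy_ac hL), (energy_pp hL), (energy_sc hL); split.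
    move=> t; split; first exact: lebesgue_decomposition_energy.
    - by move=> E mE; rewrite /energy_pp energy_partE.
    - by move=> E mE; rewrite /energy_sc energy_partE.
    - by move=> E mE; rewrite /energy_ac energy_partE.
  split.
    move=> w t ww t0; split.
    - exact: ae_collapsed ww t0.
    - exact: singular_density ww t0.
    - exact: singular_negligible ww t0.
    - exact: singular_supp ww t0.
  by split; [exact: countable_pp|exact: countable_sc].
split.
  split; last by split=> //; split=> //; exists (eul_dt (char_x mubar) V).
  exists (eul_dx (char_x mubar) V); split => //.
  - exact: eul_absolutely_continuous hL.
  - exact: eul_dx_Linfty hL.
split.
  split=> l ul t.
    apply: (eul_cvgNy hL); exact: cvg_comp (char_x_cvgNy hD HB) ul.
  have -> : l + 2^-1 * fine (mubar setT) * t = l + t / 2 * mass mubar.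
    by rewrite massM /=; ring.
  apply: (eul_cvgy hL); exact: cvg_comp (char_x_cvgy hD HB) ul.
move=> s acs utilde; split; first exact: (eul_Cb hL).
exists ((eul_dx (char_x mubar) V) ^~ s) => Ftilde Xs; split.
- exact: (weak_derivative_eul hL).
- exact: l2.
- by rewrite massM; exact: (restart_mass acs).
- move=> t; split.
  + by move=> a; exact: (restart_posE acs).
  + exact: (restart_energy acs).
  + by move=> xi; exact: (restart_eul acs).
Qed.
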